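(* Let initial data (K) for a K-surface be given, and let $f^\epsilon$ be the corresponding canonical discrete K-surfaces. Then for some $r>0$ the canonical discrete K-surfaces $f^\epsilon:\mathcal{B}^\epsilon(r)\to\mathbb{R}^3$ (defined for all sufficiently small $\epsilon>0$) converge, as $\epsilon\to0$, to the unique K-surface $f:\mathcal{B}(r)\to\mathbb{R}^3$ with the initial data (K), where all surfaces are normalized by the same fixed value $f^\epsilon(0)=f(0)\in\mathbb{R}^3$. The convergence is with the order $O(\epsilon)$ in $C^\infty(\mathcal{B}(r))$.
   Context: Put $\mathcal{B}_1=\mathbb{R}\times\{0\}$, $\mathcal{B}_2=\{0\}\times\mathbb{R}$, $\mathcal{B}(r)=[0,r]^2$, $\mathcal{B}^\epsilon(r)=(\epsilon\mathbb{Z})^2\cap[0,r]^2$, $\mathcal{B}_i^\epsilon=\mathcal{B}_i\cap(\epsilon\mathbb{Z})^2$. On $(\epsilon\mathbb{Z})^2$: $(\tau_i f)(u)=f(u+\epsilon e_i)$, $\delta_i=\epsilon^{-1}(\tau_i-1)$, $\delta^\alpha=\delta_1^{\alpha_1}\delta_2^{\alpha_2}$. $\mathbb{S}^2\subset\mathbb{R}^3$ is the unit sphere. A K-surface is a surface in $\mathbb{R}^3$ with constant Gaussian curvature $K=-1$, parametrized along asymptotic lines. Its Gauss map $n$ with values in $\mathbb{S}^2$ satisfies $\partial_1\partial_2n=q_{12}n$ with $q_{12}=-\langle\partial_1n,\partial_2n\rangle$, and $f$ is recovered from $n$, up to translation, by $\partial_1f=\partial_1n\times n$, $\partial_2f=n\times\partial_2n$.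 Initial data (K): two smooth curves $n|_{\mathcal{B}_1}$, $n|_{\mathcal{B}_2}$ in $\mathbb{S}^2$ with a common point $n(0)$. The K-surface with initial data (K) is the one whose Gauss map has these data. Canonical discrete K-surfaces for (K): $n^\epsilon:(\epsilon\mathbb{Z})^2\to\mathbb{S}^2$ is the solution of $$\tau_1\tau_2n+n=a_{12}(\tau_1n+\tau_2n),\qquad a_{12}=\frac{\langle n,\tau_1n+\tau_2n\rangle}{1+\langle\tau_1n,\tau_2n\rangle},$$ with $n^\epsilon(u)=n(u)$ for $u\in\mathcal{B}_i^\epsilon$, $i=1,2$; then $f^\epsilon$ is defined by $\delta_1f^\epsilon=\delta_1n^\epsilon\times n^\epsilon$, $\delta_2f^\epsilon=n^\epsilon\times\delta_2n^\epsilon$. Convergence $f^\epsilon\to f$ with the order $O(\epsilon)$ in $C^\infty(\mathcal{B}(r))$ means: for every multi-index $\alpha$ there is $c_\alpha$ such that $|\delta^\alpha(f^\epsilon-f)(u)|\le c_\alpha\epsilon$ for all sufficiently small $\epsilon>0$ and all $u\in\mathcal{B}^\epsilon(r)$ at which this difference quotient is defined on $\mathcal{B}^\epsilon(r)$. *)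

(* Defs.v *)
From Stdlib Require Import Reals.
From Coquelicot Require Import Coquelicot.
Open Scope R_scope.

(* Euclidean 3-space. Coquelicot's product structure supplies [plus], [minus],
   [scal], and a [norm] that is the Euclidean one. *)
Definition V3 : Type := (R * R * R)%type.

Definition c1 (v : V3) : R := fst (fst v).
Definition c2 (v : V3) : R := snd (fst v).
Definition c3 (v : V3) : R := snd v.

Definition dot (v w : V3) : R := c1 v * c1 w + c2 v * c2 w + c3 v * c3 w.

Definition cross (v w : V3) : V3 :=
  (c2 v * c3 w - c3 v * c2 w,
   c3 v * c1 w - c1 v * c3 w,
   c1 v * c2 w - c2 v * c1 w).

Definition on_sphere (v : V3) : Prop := norm (v : R * R * R) = 1.

(** * Smooth K-surfaces *)

Definition in_square (r x y : R) : Prop := 0 <= x <= r /\ 0 <= y <= r.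

Definition D1 (f : R -> R -> V3) (x y : R) : V3 :=
  (Derive (fun t => c1 (f t y)) x,
   Derive (fun t => c2 (f t y)) x,
   Derive (fun t => c3 (f t y)) x).

Definition D2 (f : R -> R -> V3) (x y : R) : V3 :=
  (Derive (fun t => c1 (f x t)) y,
   Derive (fun t => c2 (f x t)) y,
   Derive (fun t => c3 (f x t)) y).

Definition smooth_curve (g : R -> V3) : Prop :=
  forall (k : nat) (t : R),
    ex_derive_n (fun s => c1 (g s)) k t /\
    ex_derive_n (fun s => c2 (g s)) k t /\
    ex_derive_n (fun s => c3 (g s)) k t.

(* A map on the closed square [0,r]^2 is smooth when it is the restriction of a
   C^infinity map on an open neighbourhood; maps are total functions here, and
   only this neighbourhood matters. *)
Definition smooth_on_square (r : R) (f : R -> R -> V3) : Prop :=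
  exists d : R, 0 < d /\
    forall (k : nat) (x y : R), - d < x < r + d -> - d < y < r + d ->
      ex_diff_n (fun u v => c1 (f u v)) k x y /\
      ex_diff_n (fun u v => c2 (f u v)) k x y /\
      ex_diff_n (fun u v => c3 (f u v)) k x y.

(* Coefficients E, F, G and L, M, N of the two fundamental forms of f, the
   latter with respect to the unit normal n. *)
Definition fundE (f : R -> R -> V3) (x y : R) : R := dot (D1 f x y) (D1 f x y).
Definition fundF (f : R -> R -> V3) (x y : R) : R := dot (D1 f x y) (D2 f x y).
Definition fundG (f : R -> R -> V3) (x y : R) : R := dot (D2 f x y) (D2 f x y).
Definition fundL (f n : R -> R -> V3) (x y : R) : R := dot (D1 (D1 f) x y) (n x y).
Definition fundM (f n : R -> R -> V3) (x y : R) : R := dot (D1 (D2 f) x y) (n x y).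
Definition fundN (f n : R -> R -> V3) (x y : R) : R := dot (D2 (D2 f) x y) (n x y).

Definition det_I (f : R -> R -> V3) (x y : R) : R :=
  fundE f x y * fundG f x y - fundF f x y * fundF f x y.

Definition gauss_curvature (f n : R -> R -> V3) (x y : R) : R :=
  (fundL f n x y * fundN f n x y - fundM f n x y * fundM f n x y) / det_I f x y.

Definition q12 (n : R -> R -> V3) (x y : R) : R := - dot (D1 n x y) (D2 n x y).

(* f is a K-surface over [0,r]^2 with Gauss map n. Arbitrary initial curves may
   be tangent to each other or stationary, so f need not be an immersion
   everywhere: the curvature is prescribed at the points where it is defined
   (det_I <> 0), and the equations for n and for f in terms of n hold everywhere.
   Where f is immersed, these equations follow from the preceding conditions up
   to the choice between f and its reflection -f, which has the same Gauss map. *)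
Record K_surface (r : R) (f n : R -> R -> V3) : Prop := {
  K_smooth : smooth_on_square r f;
  K_gauss_smooth : smooth_on_square r n;
  K_gauss_unit : forall x y, in_square r x y -> on_sphere (n x y);
  K_gauss_normal : forall x y, in_square r x y ->
    dot (D1 f x y) (n x y) = 0 /\ dot (D2 f x y) (n x y) = 0;
  K_asymptotic : forall x y, in_square r x y ->
    fundL f n x y = 0 /\ fundN f n x y = 0;
  K_curvature : forall x y, in_square r x y ->
    det_I f x y <> 0 -> gauss_curvature f n x y = -1;
  K_gauss_equation : forall x y, in_square r x y ->
    D1 (D2 n) x y = scal (q12 n x y) (n x y);
  K_representation : forall x y, in_square r x y ->
    D1 f x y = cross (D1 n x y) (n x y) /\
    D2 f x y = cross (n x y) (D2 n x y)
}.

(* Initial data (K): n1 and n2 are the restrictions of n to the two axes. *)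
Record initial_data_K (n1 n2 : R -> V3) : Prop := {
  data_smooth1 : smooth_curve n1;
  data_smooth2 : smooth_curve n2;
  data_sphere1 : forall t, on_sphere (n1 t);
  data_sphere2 : forall t, on_sphere (n2 t);
  data_common : n1 0 = n2 0
}.

Definition K_surface_with_data (n1 n2 : R -> V3) (r : R) (f n : R -> R -> V3) : Prop :=
  K_surface r f n /\
  (forall x, 0 <= x <= r -> n x 0 = n1 x) /\
  (forall y, 0 <= y <= r -> n 0 y = n2 y).

(** * Discrete K-surfaces *)

(* A function on the lattice quadrant is indexed by (i,j) : nat * nat, standing
   for the point (eps i, eps j); [in_grid eps r] singles out the indices of
   (eps Z)^2 /\ [0,r]^2. *)
Definition lattice_fun : Type := nat -> nat -> V3.

Definition in_grid (eps r : R) (i j : nat) : Prop :=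
  in_square r (eps * INR i) (eps * INR j).

Definition tau1 (g : lattice_fun) : lattice_fun := fun i j => g (S i) j.
Definition tau2 (g : lattice_fun) : lattice_fun := fun i j => g i (S j).

Definition delta1 (eps : R) (g : lattice_fun) : lattice_fun :=
  fun i j => scal (/ eps) (minus (tau1 g i j) (g i j)).
Definition delta2 (eps : R) (g : lattice_fun) : lattice_fun :=
  fun i j => scal (/ eps) (minus (tau2 g i j) (g i j)).

Definition delta (eps : R) (a1 a2 : nat) (g : lattice_fun) : lattice_fun :=
  Nat.iter a1 (delta1 eps) (Nat.iter a2 (delta2 eps) g).

Definition a12 (n : lattice_fun) (i j : nat) : R :=
  dot (n i j) (plus (tau1 n i j) (tau2 n i j)) /
  (1 + dot (tau1 n i j) (tau2 n i j)).

(* The nonvanishing denominator in [dks_equation] says that a12 is defined. *)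
Record canonical_discrete_K_surface
    (n1 n2 : R -> V3) (eps r : R) (f n : lattice_fun) : Prop := {
  dks_sphere : forall i j, in_grid eps r i j -> on_sphere (n i j);
  dks_data1 : forall i, in_grid eps r i 0 -> n i 0%nat = n1 (eps * INR i);
  dks_data2 : forall j, in_grid eps r 0 j -> n 0%nat j = n2 (eps * INR j);
  dks_equation : forall i j, in_grid eps r (S i) (S j) ->
    1 + dot (tau1 n i j) (tau2 n i j) <> 0 /\
    plus (tau1 (tau2 n) i j) (n i j) =
      scal (a12 n i j) (plus (tau1 n i j) (tau2 n i j));
  dks_surface1 : forall i j, in_grid eps r (S i) j ->
    delta1 eps f i j = cross (delta1 eps n i j) (n i j);
  dks_surface2 : forall i j, in_grid eps r i (S j) ->
    delta2 eps f i j = cross (n i j) (delta2 eps n i j)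
}.

(** * Convergence with order O(eps) in C^infinity *)

Definition lattice_restrict (eps : R) (f : R -> R -> V3) : lattice_fun :=
  fun i j => f (eps * INR i) (eps * INR j).

(* The difference quotient of multi-index (a1,a2) at (i,j) uses the values on
   [i,i+a1] x [j,j+a2], hence the condition on the far corner. *)
Definition converges_smooth_order_eps
    (r : R) (feps : R -> lattice_fun) (f : R -> R -> V3) : Prop :=
  forall a1 a2 : nat, exists c eps1 : R, 0 < eps1 /\
    forall eps : R, 0 < eps < eps1 ->
    forall i j : nat, in_grid eps r (i + a1) (j + a2) ->
      norm (delta eps a1 a2
              (fun k l => minus (feps eps k l) (lattice_restrict eps f k l)) i j
            : R * R * R)
        <= c * eps.

(* Main.v *)
(* The Gauss map solves the Goursat problem [n_xy = - <n_x, n_y> n]. Picard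
   iteration on [G = n_xy], with [n_x], [n_y], [n] recovered by integration, is
   defined for globally smooth iterates and converges geometrically on a small
   square together with all derivatives: differentiating the recursion gives one
   for the derivatives whose top-order part is linear with the same small
   constant. The limit stays on the sphere because [<n, n> - 1] satisfies a
   homogeneous Goursat problem. Any two solutions agree because [|n_x|] and
   [|n_y|] are determined by the data, so that the difference is contracted.

   In the discrete problem each step is a half-turn, hence the lengths of the
   edges are those of the data; for small [eps] the denominators stay away from
   zero. With [m = (tau_1 n + tau_2 n) / (1 + <tau_1 n, tau_2 n>)] the equation
   reads exactly [delta_1 delta_2 n = - <delta_1 n, delta_2 n> m], and the
   restriction of the smooth Gauss map satisfies it up to [O(eps)] with all
   difference quotients. The error is first bounded with its first difference
   quotients, by induction on [i + j]; the higher ones follow order by order,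
   because [delta_1] of the error solves a linear first order equation in the
   second direction. The surface is obtained from the Gauss map by summation. *)

Require Import Defs.
From Stdlib Require Import Reals Lra Lia FunctionalExtensionality.
From Coquelicot Require Import Coquelicot.
(* Repeated because [Reals] shadows [c1], [c2] and [D1]. *)
Require Import Defs.
Open Scope R_scope.

(** * Integrals with respect to one variable *)

(** Smallness must not depend on the order of differentiation, or no fixed square would serve for
    all derivatives. With [G = n_xy], the function [G_x] reappears in its own equation only through
    [n_xx], that is, under an integral in y and with the old coefficients; all other terms have
    lower order. The lattice adds an obstacle: the equation for [delta_1] of the error contains
    [delta_2] of the error at the same order. Its next quotients in the first direction are supplied
    by the Gauss equation, those in the second are still unknown. So the linear equation is used to
    bound quotients in the first direction alone, and mixed ones are read off from the equation.
    Estimates are predicates closed under sums, products and integration or shifts: geometric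
    convergence with ratio 1/2 for sequences, a bound by a power of [eps] for lattice families.
    Iterates are global functions with estimates on a box only, so integrals and derivatives carry
    no domain conditions. A lattice bound is asserted for each r below a fixed R0 once [eps] is
    small, which absorbs the shifts in difference quotients. *)

Definition cont2 (f : R -> R -> R) : Prop := forall x y, continuity_2d_pt f x y.
Definition dx (f fx : R -> R -> R) : Prop :=
  forall x y, is_derive (fun t => f t y) x (fx x y).
Definition dy (f fy : R -> R -> R) : Prop :=
  forall x y, is_derive (fun t => f x t) y (fy x y).

Definition swap (f : R -> R -> R) : R -> R -> R := fun x y => f y x.
Definition I2 (g : R -> R -> R) (x y : R) : R := RInt (fun t => g x t) 0 y.
(** Defined through [swap], so that each fact about it is the one for [I2] with the coordinates
    exchanged. *)
Definition I1 (g : R -> R -> R) : R -> R -> R := swap (I2 (swap g)).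

Lemma continuity_2d_pt_swap f x y :
  continuity_2d_pt f y x -> continuity_2d_pt (swap f) x y.
Proof.
  intros H eps. destruct (H eps) as [d Hd]. exists d.
  intros u v Hu Hv. apply Hd; assumption.
Qed.

Lemma cont2_swap f : cont2 f -> cont2 (swap f).
Proof. intros H x y. apply continuity_2d_pt_swap, H. Qed.

Lemma continuity_2d_pt_section2 f x y :
  continuity_2d_pt f x y -> continuous (fun t => f x t) y.
Proof.
  intros H. apply continuity_pt_filterlim. intros eps He.
  destruct (H (mkposreal eps He)) as [d Hd]. exists d. split. apply cond_pos.
  intros t [_ Ht]. apply Hd. rewrite Rminus_diag, Rabs_R0. apply cond_pos. exact Ht.
Qed.

Lemma continuity_2d_pt_section1 f x y :
  continuity_2d_pt f x y -> continuous (fun t => f t y) x.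
Proof.
  intros H. apply (continuity_2d_pt_section2 (swap f)), continuity_2d_pt_swap, H.
Qed.

Lemma ex_RInt_cont2 g x a b : cont2 g -> ex_RInt (fun t => g x t) a b.
Proof.
  intros H. apply (ex_RInt_continuous (V := R_CompleteNormedModule)).
  intros z _. apply continuity_2d_pt_section2, H.
Qed.

Lemma I2_dy g : cont2 g -> dy (I2 g) g.
Proof.
  intros H x y. apply (is_derive_RInt (fun t => g x t) (I2 g x) 0 y).
  - exists (mkposreal 1 Rlt_0_1). intros z _. apply (RInt_correct (V := R_CompleteNormedModule)).
    apply ex_RInt_cont2, H.
  - apply continuity_2d_pt_section2, H.
Qed.

Lemma I2_0 g x : I2 g x 0 = 0.
Proof. unfold I2. apply (RInt_point (V := R_CompleteNormedModule)). Qed.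

Lemma mvt (f df : R -> R) a b :
  (forall t, Rmin a b <= t <= Rmax a b -> is_derive f t (df t)) ->
  exists c, Rmin a b <= c <= Rmax a b /\ f b - f a = df c * (b - a).
Proof.
  intros H. apply MVT_gen.
  - intros; apply H; lra.
  - intros t Ht. apply continuity_pt_filterlim. apply (ex_derive_continuous f).
    exists (df t). apply H, Ht.
Qed.

Lemma Rmin_Rmax_0 c y : Rmin 0 y <= c <= Rmax 0 y -> Rabs c <= Rabs y.
Proof.
  unfold Rmin, Rmax, Rabs. destruct (Rle_dec 0 y), (Rcase_abs c), (Rcase_abs y); lra.
Qed.

(** The mean value theorem for the difference of the two primitives. Allowing both different
    integrands and different first arguments lets it serve for contraction estimates and for
    continuity in [x]. *)
Lemma I2_diff_le g h x x' y M : cont2 g -> cont2 h ->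
  (forall t, Rabs t <= Rabs y -> Rabs (g x t - h x' t) <= M) ->
  Rabs (I2 g x y - I2 h x' y) <= M * Rabs y.
Proof.
  intros Hg Hh HM.
  destruct (mvt (fun t => I2 g x t - I2 h x' t) (fun t => g x t - h x' t) 0 y) as [c [Hc E]].
  - intros t _. apply (is_derive_minus (I2 g x) (I2 h x')); now apply I2_dy.
  - rewrite !I2_0 in E. replace (I2 g x y - I2 h x' y) with ((g x c - h x' c) * (y - 0)) by lra.
    rewrite Rabs_mult, Rminus_0_r. apply Rmult_le_compat_r. apply Rabs_pos.
    apply HM. now apply Rmin_Rmax_0.
Qed.

Lemma cont2_const c : cont2 (fun _ _ => c).
Proof. intros x y. apply continuity_2d_pt_const. Qed.

Lemma I2_zero x y : I2 (fun _ _ => 0) x y = 0.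
Proof.
  unfold I2. rewrite RInt_const. unfold scal; simpl; unfold mult; simpl. ring.
Qed.

Lemma I2_le g x y M : cont2 g ->
  (forall t, Rabs t <= Rabs y -> Rabs (g x t) <= M) -> Rabs (I2 g x y) <= M * Rabs y.
Proof.
  intros Hg HM. rewrite <- (Rminus_0_r (I2 g x y)), <- (I2_zero x y).
  apply I2_diff_le. exact Hg. apply cont2_const.
  intros t Ht. rewrite Rminus_0_r. auto.
Qed.

(** The first argument is moved by uniform continuity of [g] near the compact segment over [x], the
    second by continuity of a primitive. *)
Lemma cont2_I2 g : cont2 g -> cont2 (I2 g).
Proof.
  (* The margin 1 keeps every second argument within distance 1 of [y] inside the segment; an
     integrand error [eps / (2 * b)] then integrates to at most [eps / 2]. *)
  intros H x y eps. set (b := Rabs y + 1).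
  assert (Hb : 0 < b) by (unfold b; generalize (Rabs_pos y); lra).
  destruct (uniform_continuity_2d_1d' g (- b) b x (fun t _ => H x t)
    (mkposreal (eps / (2 * b)) ltac:(apply Rdiv_lt_0_compat; [apply cond_pos|lra])))
    as [d Hd]. simpl in Hd.
  assert (Hc : continuity_pt (I2 g x) y).
  { apply continuity_pt_filterlim, (ex_derive_continuous (I2 g x)). exists (g x y). now apply I2_dy. }
  destruct (Hc (eps / 2) ltac:(generalize (cond_pos eps); lra)) as [d' [Hd' Hy]].
  assert (Hp : 0 < Rmin 1 (Rmin d d')) by (repeat apply Rmin_pos; try lra; apply cond_pos).
  exists (mkposreal _ Hp). simpl. intros u v Hu Hv.
  assert (E1 : Rmin 1 (Rmin d d') <= 1) by apply Rmin_l.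
  assert (E2 : Rmin 1 (Rmin d d') <= d) by (eapply Rle_trans; [apply Rmin_r|apply Rmin_l]).
  assert (E3 : Rmin 1 (Rmin d d') <= d') by (eapply Rle_trans; [apply Rmin_r|apply Rmin_r]).
  assert (Hvb : Rabs v < b).
  { unfold b. replace v with (y + (v - y)) by ring.
    eapply Rle_lt_trans; [apply Rabs_triang|]. lra. }
  assert (P1 : Rabs (I2 g u v - I2 g x v) <= eps / (2 * b) * Rabs v).
  { apply I2_diff_le; auto. intros t Ht. apply Rlt_le, Hd.
    - apply Rabs_le_between; lra.
    - generalize (cond_pos d); intros; lra.
    - apply Rabs_le_between; lra.
    - apply Rabs_lt_between in Hu. lra.
    - rewrite Rminus_diag, Rabs_R0. apply cond_pos. }
  assert (P2 : Rabs (I2 g x v - I2 g x y) < eps / 2).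
  { destruct (Req_dec v y) as [->|N].
    - rewrite Rminus_diag, Rabs_R0. generalize (cond_pos eps); lra.
    - apply (Hy v). split. split; [exact I| intro; now apply N]. simpl. unfold Rdist. lra. }
  replace (I2 g u v - I2 g x y) with ((I2 g u v - I2 g x v) + (I2 g x v - I2 g x y)) by ring.
  eapply Rle_lt_trans; [apply Rabs_triang|].
  assert (eps / (2 * b) * Rabs v <= eps / (2 * b) * b).
  { apply Rmult_le_compat_l. apply Rlt_le, Rdiv_lt_0_compat; [apply cond_pos|lra]. lra. }
  replace (eps / (2 * b) * b) with (eps / 2) in H0 by (field; lra). lra.
Qed.

Lemma I2_dx g gx : cont2 g -> cont2 gx -> dx g gx -> dx (I2 g) (I2 gx).
Proof.
  intros Hg Hgx D x y.
  assert (E : forall u t, Derive (fun z => g z t) u = gx u t).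
  { intros. apply is_derive_unique, D. }
  unfold I2 at 2. rewrite (RInt_ext _ (fun t => Derive (fun u => g u t) x)).
  2: { intros; now rewrite E. }
  apply is_derive_RInt_param.
  - exists (mkposreal 1 Rlt_0_1). intros z _ t _. exists (gx z t). apply D.
  - intros t _. apply (continuity_2d_pt_ext gx). intros; now rewrite E. apply Hgx.
  - exists (mkposreal 1 Rlt_0_1). intros z _. apply ex_RInt_cont2, Hg.
Qed.

Lemma cont2_I1 g : cont2 g -> cont2 (I1 g).
Proof. intros H. apply cont2_swap, cont2_I2, cont2_swap, H. Qed.
Lemma I1_dx g : cont2 g -> dx (I1 g) g.
Proof. intros H x y. apply (I2_dy (swap g)), cont2_swap, H. Qed.
Lemma I1_dy g gy : cont2 g -> cont2 gy -> dy g gy -> dy (I1 g) (I1 gy).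
Proof.
  intros Hg Hgy D x y. apply (I2_dx (swap g) (swap gy)).
  apply cont2_swap, Hg. apply cont2_swap, Hgy. intros u v; apply D.
Qed.

Lemma I1_0 g y : I1 g 0 y = 0.
Proof. apply I2_0. Qed.
Lemma cont2_plus f g : cont2 f -> cont2 g -> cont2 (fun x y => f x y + g x y).
Proof. intros F G x y; now apply continuity_2d_pt_plus. Qed.
Lemma cont2_mult f g : cont2 f -> cont2 g -> cont2 (fun x y => f x y * g x y).
Proof. intros F G x y; now apply continuity_2d_pt_mult. Qed.
Lemma der_plus (f g : R -> R) t a b :
  is_derive f t a -> is_derive g t b -> is_derive (fun s => f s + g s) t (a + b).
Proof. apply (is_derive_plus f g). Qed.
Lemma der_minus (f g : R -> R) t a b :
  is_derive f t a -> is_derive g t b -> is_derive (fun s => f s - g s) t (a - b).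
Proof. apply (is_derive_minus f g). Qed.
Lemma der_opp (f : R -> R) t a : is_derive f t a -> is_derive (fun s => - f s) t (- a).
Proof. apply (is_derive_opp f). Qed.
Lemma der_mult (f g : R -> R) t a b :
  is_derive f t a -> is_derive g t b -> is_derive (fun s => f s * g s) t (a * g t + f t * b).
Proof. intros; apply (is_derive_mult f g); auto. intros; apply Rmult_comm. Qed.
Lemma der_const (c t : R) : is_derive (fun _ : R => c) t 0.
Proof. apply (is_derive_const (K := R_AbsRing) c). Qed.

(** * Sequences of smooth functions converging with all derivatives *)

Definition box (rho x y : R) : Prop := Rabs x <= rho /\ Rabs y <= rho.

(** One constant serves both as a uniform bound and in the rate; enlarging it is harmless, which is
    what makes the closure properties short. *)
Definition gconv (rho : R) (g : nat -> R -> R -> R) : Prop :=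
  exists c, forall m x y, box rho x y ->
    Rabs (g m x y) <= c /\ Rabs (g (S m) x y - g m x y) <= c * (/ 2) ^ m.

(** Derivatives are existential witnesses rather than [Derive] terms, so that explicit recursions
    can be supplied for them. Continuity and the derivative relations are global; only [gconv]
    refers to the box. *)
Fixpoint Cau (rho : R) (k : nat) (g : nat -> R -> R -> R) : Prop :=
  (forall m, cont2 (g m)) /\ gconv rho g /\
  match k with
  | O => True
  | S k' => exists gx gy : nat -> R -> R -> R,
      (forall m, dx (g m) (gx m)) /\ (forall m, dy (g m) (gy m)) /\
      Cau rho k' gx /\ Cau rho k' gy
  end.

Lemma pow_half_pos m : 0 < (/ 2) ^ m.
Proof. apply pow_lt; lra. Qed.

Lemma Cau_cont rho k g : Cau rho k g -> forall m, cont2 (g m).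
Proof. destruct k; intros H; apply H. Qed.
Lemma Cau_gconv rho k g : Cau rho k g -> gconv rho g.
Proof. destruct k; intros H; apply H. Qed.

Lemma Cau_pred rho k g : Cau rho (S k) g -> Cau rho k g.
Proof.
  revert g; induction k; intros g H.
  - destruct H as (A & B & _). repeat split; auto.
  - destruct H as (A & B & gx & gy & X & Y & P & Q). split; [|split]; auto.
    exists gx, gy. auto 6.
Qed.

Lemma gconv_plus rho f g : gconv rho f -> gconv rho g ->
  gconv rho (fun m x y => f m x y + g m x y).
Proof.
  intros [a Ha] [b Hb]. exists (a + b). intros m x y Hxy.
  destruct (Ha m x y Hxy) as [A A'], (Hb m x y Hxy) as [B B']. split.
  - eapply Rle_trans; [apply Rabs_triang|]. lra.
  - replace (f (S m) x y + g (S m) x y - (f m x y + g m x y))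
      with ((f (S m) x y - f m x y) + (g (S m) x y - g m x y)) by ring.
    eapply Rle_trans; [apply Rabs_triang|]. lra.
Qed.

Lemma gconv_mult rho f g : gconv rho f -> gconv rho g ->
  gconv rho (fun m x y => f m x y * g m x y).
Proof.
  intros [a Ha] [b Hb]. exists (2 * Rabs a * Rabs b). intros m x y Hxy.
  destruct (Ha m x y Hxy) as [A A'], (Hb m x y Hxy) as [B B'].
  destruct (Ha (S m) x y Hxy) as [A1 _].
  pose proof (pow_half_pos m) as P.
  pose proof (Rle_abs a). pose proof (Rle_abs b).
  assert (C : forall p q s t, Rabs p <= s -> Rabs q <= t -> Rabs (p * q) <= s * t).
  { intros. rewrite Rabs_mult. apply Rmult_le_compat; auto using Rabs_pos. }
  assert (0 <= a) by (eapply Rle_trans; [apply Rabs_pos|apply A]).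
  assert (0 <= b) by (eapply Rle_trans; [apply Rabs_pos|apply B]).
  rewrite (Rabs_pos_eq a), (Rabs_pos_eq b) by lra.
  split.
  - eapply Rle_trans; [apply C; eassumption|]. nra.
  - replace (f (S m) x y * g (S m) x y - f m x y * g m x y)
      with ((f (S m) x y) * (g (S m) x y - g m x y) + (f (S m) x y - f m x y) * g m x y) by ring.
    eapply Rle_trans; [apply Rabs_triang|].
    pose proof (C _ _ _ _ A1 B'). pose proof (C _ _ _ _ A' B). lra.
Qed.

Lemma Cau_plus rho k : forall f g, Cau rho k f -> Cau rho k g ->
  Cau rho k (fun m x y => f m x y + g m x y).
Proof.
  induction k; intros f g F G.
  - split; [|split]; auto; [intro; apply cont2_plus; [apply F|apply G]|apply gconv_plus; [apply F|apply G]].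
  - destruct F as (F1 & F2 & fx & fy & F3 & F4 & F5 & F6).
    destruct G as (G1 & G2 & gx & gy & G3 & G4 & G5 & G6).
    split; [|split]. intro; now apply cont2_plus. now apply gconv_plus.
    exists (fun m x y => fx m x y + gx m x y), (fun m x y => fy m x y + gy m x y).
    split; [|split; [|split]]; auto; intros m x y;
      [exact (der_plus _ _ _ _ _ (F3 m x y) (G3 m x y))|exact (der_plus _ _ _ _ _ (F4 m x y) (G4 m x y))].
Qed.

Lemma Cau_mult rho k : forall f g, Cau rho k f -> Cau rho k g ->
  Cau rho k (fun m x y => f m x y * g m x y).
Proof.
  induction k; intros f g F G.
  - split; [|split]; auto; [intro; apply cont2_mult; [apply F|apply G]|apply gconv_mult; [apply F|apply G]].
  - pose proof (Cau_pred _ _ _ F) as F'. pose proof (Cau_pred _ _ _ G) as G'.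
    destruct F as (F1 & F2 & fx & fy & F3 & F4 & F5 & F6).
    destruct G as (G1 & G2 & gx & gy & G3 & G4 & G5 & G6).
    split; [|split]. intro; now apply cont2_mult. now apply gconv_mult.
    exists (fun m x y => fx m x y * g m x y + f m x y * gx m x y),
           (fun m x y => fy m x y * g m x y + f m x y * gy m x y).
    split; [|split; [|split]]; try (apply Cau_plus; auto); intros m x y;
      [exact (der_mult _ _ _ _ _ (F3 m x y) (G3 m x y))|exact (der_mult _ _ _ _ _ (F4 m x y) (G4 m x y))].
Qed.

Lemma Cau_const rho k c : Cau rho k (fun _ _ _ => c).
Proof.
  revert c; induction k; intros c;
  (split; [intro; apply cont2_const|split; [exists (Rabs c); intros; split; [lra|
     rewrite Rminus_diag, Rabs_R0; apply Rmult_le_pos; [apply Rabs_pos|apply Rlt_le, pow_half_pos]]|]]); auto.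
  exists (fun _ _ _ => 0), (fun _ _ _ => 0).
  split; [|split; [|split]]; auto; intros m x y; apply der_const.
Qed.

Lemma Cau_opp rho k f : Cau rho k f -> Cau rho k (fun m x y => - f m x y).
Proof.
  intros F. replace (fun m x y => - f m x y) with (fun m x y => -1 * f m x y).
  apply Cau_mult; auto. apply Cau_const.
  do 3 (apply functional_extensionality; intro). ring.
Qed.

Lemma Cau_minus rho k f g : Cau rho k f -> Cau rho k g -> Cau rho k (fun m x y => f m x y - g m x y).
Proof. intros F G. apply Cau_plus; auto. now apply Cau_opp. Qed.

Lemma Cau_swap rho k : forall f, Cau rho k f -> Cau rho k (fun m => swap (f m)).
Proof.
  induction k; intros f F.
  - destruct F as (F1 & [c Hc] & _). split; [|split]; auto. intro; now apply cont2_swap.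
    exists c. intros m x y [X Y]. now apply Hc.
  - destruct F as (F1 & [c Hc] & fx & fy & F3 & F4 & F5 & F6).
    split; [|split]; auto. intro; now apply cont2_swap.
    exists c. intros m x y [X Y]. now apply Hc.
    exists (fun m => swap (fy m)), (fun m => swap (fx m)).
    split; [|split; [|split]]; auto; intros m x y; [apply F4|apply F3].
Qed.

Lemma box_sub rho x y t : box rho x y -> Rabs t <= Rabs y -> box rho x t.
Proof. intros [X Y] T; split; lra. Qed.

(** The second partial derivative of the integral is the integrand itself and the first one passes
    under the integral. Estimates survive because the box contains, with each point, the vertical
    segment from it to the axis. *)
Lemma Cau_I2 rho k : 0 < rho -> forall f, Cau rho k f -> Cau rho k (fun m => I2 (f m)).
Proof.
  intros Hr.
  assert (B : forall f, (forall m, cont2 (f m)) -> gconv rho f -> gconv rho (fun m => I2 (f m))).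
  { intros f F1 [c Hc].
    assert (0 <= c).
    { eapply Rle_trans; [apply (Rabs_pos (f 0%nat 0 0))|]. apply (Hc 0%nat 0 0). split; rewrite Rabs_R0; lra. }
    exists (c * rho). intros m x y Hxy. pose proof (pow_half_pos m). split.
    - eapply Rle_trans; [apply (I2_le (f m) x y c)|]; auto.
      intros t Ht. apply Hc. eapply box_sub; eauto.
      apply Rmult_le_compat_l; auto. apply Hxy.
    - eapply Rle_trans; [apply (I2_diff_le (f (S m)) (f m) x x y (c * (/ 2) ^ m))|]; auto.
      intros t Ht. apply Hc. eapply box_sub; eauto.
      rewrite !Rmult_assoc. apply Rmult_le_compat_l; auto. rewrite Rmult_comm.
      apply Rmult_le_compat_r; [lra|]. apply Hxy. }
  induction k; intros f F.
  - destruct F as (F1 & F2 & _). split; [|split]; auto. intro; now apply cont2_I2.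
  - pose proof (Cau_pred _ _ _ F) as F'.
    destruct F as (F1 & F2 & fx & fy & F3 & F4 & F5 & F6). split; [|split]; auto.
    intro; now apply cont2_I2.
    exists (fun m => I2 (fx m)), f. split; [|split; [|split]]; auto.
    intro; apply I2_dx; auto. eapply Cau_cont; eauto.
    intro; now apply I2_dy.
Qed.

Lemma Cau_I1 rho k f : 0 < rho -> Cau rho k f -> Cau rho k (fun m => I1 (f m)).
Proof. intros. apply Cau_swap, Cau_I2, Cau_swap; auto. Qed.

(** Derivatives of a recursion at index [S m] are formulas in data at index [m]; a leading zero
    realigns such a sequence and only enlarges the constant. *)
Definition prepend0 (g : nat -> R -> R -> R) : nat -> R -> R -> R :=
  fun m => match m with O => fun _ _ => 0 | S m' => g m' end.

Lemma gconv_prepend rho f : gconv rho f -> gconv rho (prepend0 f).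
Proof.
  intros [c Hc]. exists (2 * Rabs c). intros m x y Hxy. destruct (Hc 0%nat x y Hxy) as [A0 _].
  pose proof (Rle_abs c). pose proof (Rabs_pos c).
  destruct m; simpl.
  - rewrite Rabs_R0, Rminus_0_r. split; lra.
  - destruct (Hc m x y Hxy) as [A B]. pose proof (pow_half_pos m). split; [lra|].
    eapply Rle_trans; [apply B|]. nra.
Qed.

Lemma Cau_prepend rho k : forall f, Cau rho k f -> Cau rho k (prepend0 f).
Proof.
  induction k; intros f F.
  - destruct F as (F1 & F2 & _). split; [|split]; auto using gconv_prepend.
    intros [|m]; simpl; auto. apply cont2_const.
  - destruct F as (F1 & F2 & fx & fy & F3 & F4 & F5 & F6). split; [|split]; auto using gconv_prepend.
    intros [|m]; simpl; auto. apply cont2_const.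
    exists (prepend0 fx), (prepend0 fy).
    split; [|split; [|split]]; auto; intros [|m]; simpl; auto;
      intros x y; apply der_const.
Qed.

Lemma Cau_unshift rho k g : g 0%nat = (fun _ _ => 0) -> Cau rho k (fun m => g (S m)) -> Cau rho k g.
Proof.
  intros H0 H. replace g with (prepend0 (fun m => g (S m))). now apply Cau_prepend.
  apply functional_extensionality; intros [|m]; simpl; auto.
Qed.

Definition smooth1 (h : R -> R) : Prop := forall k t, ex_derive_n h k t.

Lemma smooth1_Derive h : smooth1 h -> smooth1 (Derive h).
Proof.
  intros H k t. specialize (H (S k) t). destruct k. exact I.
  simpl in *. replace (Derive_n (Derive h) k) with (Derive (Derive_n h k)). exact H.
  apply functional_extensionality; intro u. clear. revert u. induction k; intro u; simpl; auto.
  apply Derive_ext; intro. apply IHk.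
Qed.

Lemma smooth1_is_derive h t : smooth1 h -> is_derive h t (Derive h t).
Proof. intros H. apply Derive_correct. apply (H 1%nat t). Qed.

Lemma smooth1_bounded h a b : a <= b -> smooth1 h -> exists c, forall t, a <= t <= b -> Rabs (h t) <= c.
Proof.
  intros Hab H.
  assert (C : forall t, continuity_pt (fun t => Rabs (h t)) t).
  { intro t. apply (continuity_pt_comp h Rabs). 2: apply Rcontinuity_abs.
    apply continuity_pt_filterlim, (ex_derive_continuous h). apply (H 1%nat t). }
  destruct (continuity_ab_maj (fun t => Rabs (h t)) a b Hab (fun t _ => C t)) as [M [HM _]].
  exists (Rabs (h M)). exact HM.
Qed.

Lemma Cau_fun1 rho k : forall h, 0 < rho -> smooth1 h -> Cau rho k (fun _ x _ => h x).
Proof.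
  assert (A : forall h, smooth1 h -> cont2 (fun x _ => h x)).
  { intros h H x y. apply (continuity_1d_2d_pt_comp h (fun u _ => u)).
    apply continuity_pt_filterlim, (ex_derive_continuous h). apply (H 1%nat x).
    apply continuity_2d_pt_id1. }
  assert (B : forall h, 0 < rho -> smooth1 h -> gconv rho (fun _ x _ => h x)).
  { intros h Hr H. destruct (smooth1_bounded h (- rho) rho ltac:(lra) H) as [c Hc].
    exists c. intros m x y [X _].
    assert (C : Rabs (h x) <= c) by (apply Hc; now apply Rabs_le_between).
    split; auto. rewrite Rminus_diag, Rabs_R0. apply Rmult_le_pos.
    pose proof (Rabs_pos (h x)); lra. apply Rlt_le, pow_half_pos. }
  induction k; intros h Hr H; (split; [|split]); auto.
  exists (fun _ x _ => Derive h x), (fun _ _ _ => 0).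
  split; [|split; [|split]]; auto.
  - intros m x y. apply smooth1_is_derive, H.
  - intros m x y. apply der_const.
  - apply IHk; auto. now apply smooth1_Derive.
  - apply Cau_const.
Qed.

(** * Vector-valued functions *)

Definition v0 : V3 := (0, 0, 0).
Definition vadd (v w : V3) : V3 := (c1 v + c1 w, c2 v + c2 w, c3 v + c3 w).
Definition vsub (v w : V3) : V3 := (c1 v - c1 w, c2 v - c2 w, c3 v - c3 w).
Definition vsc (a : R) (v : V3) : V3 := (a * c1 v, a * c2 v, a * c3 v).
(** The right-hand side of the Gauss equation, [n_xy = tri n_x n_y n], as a trilinear map. *)
Definition tri (u v w : V3) : V3 := vsc (- dot u v) w.
(** The sum norm is used for all estimates since it unfolds to linear arithmetic on coordinates.
    Mean value estimates are taken in each coordinate separately, which is the origin of the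
    recurring factor 3. *)
Definition nrm (v : V3) : R := Rabs (c1 v) + Rabs (c2 v) + Rabs (c3 v).

Lemma V3_eq (v w : V3) : c1 v = c1 w -> c2 v = c2 w -> c3 v = c3 w -> v = w.
Proof.
  destruct v as [[a b] c], w as [[a' b'] c']; unfold c1, c2, c3; simpl; congruence.
Qed.

Ltac vunfold := cbv beta iota delta [tri vadd vsub vsc v0 cross dot c1 c2 c3 fst snd].
Ltac vring := apply V3_eq; vunfold; ring.
Ltac vfield := apply V3_eq; vunfold; field.

Lemma nrm_pos v : 0 <= nrm v.
Proof. unfold nrm. generalize (Rabs_pos (c1 v)) (Rabs_pos (c2 v)) (Rabs_pos (c3 v)). lra. Qed.
Lemma nrm_add v w : nrm (vadd v w) <= nrm v + nrm w.
Proof.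
  unfold nrm, vadd, c1, c2, c3; simpl.
  generalize (Rabs_triang (fst (fst v)) (fst (fst w))) (Rabs_triang (snd (fst v)) (snd (fst w)))
    (Rabs_triang (snd v) (snd w)). lra.
Qed.

Lemma nrm_sc a v : nrm (vsc a v) = Rabs a * nrm v.
Proof. unfold nrm, vsc, c1, c2, c3; simpl. rewrite !Rabs_mult. ring. Qed.
Lemma nrm_v0 : nrm v0 = 0.
Proof. unfold nrm, v0, c1, c2, c3; simpl. rewrite Rabs_R0. ring. Qed.
Lemma nrm_sub v w : nrm (vsub v w) <= nrm v + nrm w.
Proof.
  replace (vsub v w) with (vadd v (vsc (-1) w)) by vring.
  eapply Rle_trans; [apply nrm_add|]. rewrite nrm_sc, Rabs_left by lra. lra.
Qed.

Lemma nrm_c v : Rabs (c1 v) <= nrm v /\ Rabs (c2 v) <= nrm v /\ Rabs (c3 v) <= nrm v.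
Proof. unfold nrm. generalize (Rabs_pos (c1 v)) (Rabs_pos (c2 v)) (Rabs_pos (c3 v)). lra. Qed.
Lemma dot_comm a b : dot a b = dot b a.
Proof. unfold dot; ring. Qed.
Lemma nrm_dot v w : Rabs (dot v w) <= nrm v * nrm w.
Proof.
  unfold dot, nrm. eapply Rle_trans; [apply Rabs_triang|].
  eapply Rle_trans; [apply Rplus_le_compat_r, Rabs_triang|]. rewrite !Rabs_mult.
  generalize (Rabs_pos (c1 v)) (Rabs_pos (c2 v)) (Rabs_pos (c3 v))
    (Rabs_pos (c1 w)) (Rabs_pos (c2 w)) (Rabs_pos (c3 w)). intros. nra.
Qed.

Lemma nrm_tri u v w : nrm (tri u v w) <= nrm u * nrm v * nrm w.
Proof.
  unfold tri. rewrite nrm_sc, Rabs_Ropp. apply Rmult_le_compat_r. apply nrm_pos. apply nrm_dot.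
Qed.

Lemma nrm_0_eq v w : nrm (vsub v w) <= 0 -> v = w.
Proof.
  intros H. assert (E : nrm (vsub v w) = 0) by (generalize (nrm_pos (vsub v w)); lra).
  revert E. unfold nrm. generalize (Rabs_pos (c1 (vsub v w))) (Rabs_pos (c2 (vsub v w))) (Rabs_pos (c3 (vsub v w))).
  intros A B C E. apply V3_eq; apply Rminus_diag_uniq.
  - destruct (Req_dec (c1 v - c1 w) 0) as [|N]; auto. apply Rabs_pos_lt in N. unfold vsub, c1, c2, c3 in *; simpl in *. lra.
  - destruct (Req_dec (c2 v - c2 w) 0) as [|N]; auto. apply Rabs_pos_lt in N. unfold vsub, c1, c2, c3 in *; simpl in *. lra.
  - destruct (Req_dec (c3 v - c3 w) 0) as [|N]; auto. apply Rabs_pos_lt in N. unfold vsub, c1, c2, c3 in *; simpl in *. lra.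
Qed.

Lemma Rmult3_le a b c a' b' c' : 0 <= a <= a' -> 0 <= b <= b' -> 0 <= c <= c' ->
  a * b * c <= a' * b' * c'.
Proof. intros [] [] []. repeat apply Rmult_le_compat; auto. now apply Rmult_le_pos. Qed.
Lemma nrm_prod u v w a b c : nrm u <= a -> nrm v <= b -> nrm w <= c -> nrm u * nrm v * nrm w <= a * b * c.
Proof. intros; apply Rmult3_le; auto using nrm_pos. Qed.
(** Telescoping over the three arguments of a trilinear map, one replaced at a time. *)
Lemma nrm_tri_diff u v w u' v' w' :
  nrm (vsub (tri u v w) (tri u' v' w')) <=
  nrm (vsub u u') * nrm v * nrm w + nrm u' * nrm (vsub v v') * nrm w + nrm u' * nrm v' * nrm (vsub w w').
Proof.
  replace (vsub (tri u v w) (tri u' v' w')) with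
    (vadd (vadd (tri (vsub u u') v w) (tri u' (vsub v v') w)) (tri u' v' (vsub w w'))) by vring.
  eapply Rle_trans; [apply nrm_add|]. apply Rplus_le_compat; [|apply nrm_tri].
  eapply Rle_trans; [apply nrm_add|]. apply Rplus_le_compat; apply nrm_tri.
Qed.

Definition vseq := nat -> R -> R -> V3.

Definition CauV (rho : R) (k : nat) (G : vseq) : Prop :=
  Cau rho k (fun m x y => c1 (G m x y)) /\ Cau rho k (fun m x y => c2 (G m x y)) /\
  Cau rho k (fun m x y => c3 (G m x y)).

Definition I2V (g : R -> R -> V3) (x y : R) : V3 :=
  (I2 (fun x y => c1 (g x y)) x y, I2 (fun x y => c2 (g x y)) x y, I2 (fun x y => c3 (g x y)) x y).
Definition I1V (g : R -> R -> V3) (x y : R) : V3 :=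
  (I1 (fun x y => c1 (g x y)) x y, I1 (fun x y => c2 (g x y)) x y, I1 (fun x y => c3 (g x y)) x y).

Definition vder (g : R -> V3) (t : R) (l : V3) : Prop :=
  is_derive (fun s => c1 (g s)) t (c1 l) /\ is_derive (fun s => c2 (g s)) t (c2 l) /\
  is_derive (fun s => c3 (g s)) t (c3 l).
Definition dxV (f fx : R -> R -> V3) : Prop := forall x y, vder (fun t => f t y) x (fx x y).
Definition dyV (f fy : R -> R -> V3) : Prop := forall x y, vder (fun t => f x t) y (fy x y).
Definition cont2V (f : R -> R -> V3) : Prop :=
  cont2 (fun x y => c1 (f x y)) /\ cont2 (fun x y => c2 (f x y)) /\ cont2 (fun x y => c3 (f x y)).

Lemma CauV_pred rho k G : CauV rho (S k) G -> CauV rho k G.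
Proof. intros (A & B & C). split; [|split]; now apply Cau_pred. Qed.
Lemma CauV_cont rho k G m : CauV rho k G -> cont2V (G m).
Proof.
  intros (A & B & C). split; [|split].
  exact (Cau_cont _ _ _ A m). exact (Cau_cont _ _ _ B m). exact (Cau_cont _ _ _ C m).
Qed.

Lemma CauV_add rho k F G : CauV rho k F -> CauV rho k G ->
  CauV rho k (fun m x y => vadd (F m x y) (G m x y)).
Proof. intros (A & B & C) (A' & B' & C'). split; [|split]; now apply Cau_plus. Qed.
Lemma Cau_dot rho k F G : CauV rho k F -> CauV rho k G ->
  Cau rho k (fun m x y => dot (F m x y) (G m x y)).
Proof. intros (A & B & C) (A' & B' & C'). unfold dot. repeat apply Cau_plus; now apply Cau_mult. Qed.
Lemma CauV_tri rho k F G H : CauV rho k F -> CauV rho k G -> CauV rho k H ->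
  CauV rho k (fun m x y => tri (F m x y) (G m x y) (H m x y)).
Proof. intros A B (A' & B' & C'). split; [|split]; apply Cau_mult; auto; now apply Cau_opp, Cau_dot. Qed.
Lemma CauV_cross rho k F G : CauV rho k F -> CauV rho k G ->
  CauV rho k (fun m x y => cross (F m x y) (G m x y)).
Proof. intros (A & B & C) (A' & B' & C'). split; [|split]; apply Cau_minus; now apply Cau_mult. Qed.
Lemma CauV_I2 rho k F : 0 < rho -> CauV rho k F -> CauV rho k (fun m => I2V (F m)).
Proof.
  intros Hr (A & B & C). split; [|split].
  exact (Cau_I2 _ _ Hr _ A). exact (Cau_I2 _ _ Hr _ B). exact (Cau_I2 _ _ Hr _ C).
Qed.

Lemma CauV_I1 rho k F : 0 < rho -> CauV rho k F -> CauV rho k (fun m => I1V (F m)).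
Proof.
  intros Hr (A & B & C). split; [|split].
  exact (Cau_I1 _ _ _ Hr A). exact (Cau_I1 _ _ _ Hr B). exact (Cau_I1 _ _ _ Hr C).
Qed.

Lemma CauV_unshift rho k (G : vseq) : (forall x y, G 0%nat x y = v0) -> CauV rho k (fun m => G (S m)) -> CauV rho k G.
Proof.
  intros H0 (A & B & C). split; [|split]; apply Cau_unshift; auto;
  do 2 (apply functional_extensionality; intro); rewrite H0; reflexivity.
Qed.

Lemma vder_eq g t l l' : vder g t l -> l = l' -> vder g t l'.
Proof. intros H <-. exact H. Qed.
Lemma vder_const v t : vder (fun _ => v) t v0.
Proof. split; [|split]; apply der_const. Qed.
Lemma vder_add f g t a b : vder f t a -> vder g t b -> vder (fun s => vadd (f s) (g s)) t (vadd a b).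
Proof. intros (A & B & C) (A' & B' & C'). split; [|split]; now apply der_plus. Qed.
Lemma vder_sub f g t a b : vder f t a -> vder g t b -> vder (fun s => vsub (f s) (g s)) t (vsub a b).
Proof. intros (A & B & C) (A' & B' & C'). split; [|split]; now apply der_minus. Qed.
Lemma der_dot f g t a b : vder f t a -> vder g t b ->
  is_derive (fun s => dot (f s) (g s)) t (dot a (g t) + dot (f t) b).
Proof.
  intros (A & B & C) (A' & B' & C').
  pose proof (der_plus _ _ _ _ _ (der_plus _ _ _ _ _ (der_mult _ _ _ _ _ A A') (der_mult _ _ _ _ _ B B'))
    (der_mult _ _ _ _ _ C C')) as D.
  replace (dot a (g t) + dot (f t) b) with
    (c1 a * c1 (g t) + c1 (f t) * c1 b + (c2 a * c2 (g t) + c2 (f t) * c2 b) +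
     (c3 a * c3 (g t) + c3 (f t) * c3 b)) by (unfold dot; ring).
  exact D.
Qed.

Lemma vder_tri f g h t a b c : vder f t a -> vder g t b -> vder h t c ->
  vder (fun s => tri (f s) (g s) (h s)) t
    (vadd (vadd (tri a (g t) (h t)) (tri (f t) b (h t))) (tri (f t) (g t) c)).
Proof.
  intros A B (P & Q & R'). pose proof (der_opp _ _ _ (der_dot _ _ _ _ _ A B)) as D.
  apply (vder_eq _ _ (vadd (vsc (- (dot a (g t) + dot (f t) b)) (h t)) (vsc (- dot (f t) (g t)) c))).
  exact (conj (der_mult _ _ _ _ _ D P) (conj (der_mult _ _ _ _ _ D Q) (der_mult _ _ _ _ _ D R'))).
  vring.
Qed.

Lemma vder_cross f g t a b : vder f t a -> vder g t b ->
  vder (fun s => cross (f s) (g s)) t (vadd (cross a (g t)) (cross (f t) b)).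
Proof.
  assert (M : forall p q r s p' q' r' s', is_derive p t p' -> is_derive q t q' ->
     is_derive r t r' -> is_derive s t s' ->
     is_derive (fun z => p z * q z - r z * s z) t (p' * q t - r' * s t + (p t * q' - r t * s'))).
  { intros. replace (p' * q t - r' * s t + (p t * q' - r t * s')) with
      ((p' * q t + p t * q') - (r' * s t + r t * s')) by ring.
    apply der_minus; now apply der_mult. }
  intros (A & B & C) (A' & B' & C').
  exact (conj (M _ _ _ _ _ _ _ _ B C' C B') (conj (M _ _ _ _ _ _ _ _ C A' A C') (M _ _ _ _ _ _ _ _ A B' B A'))).
Qed.

Lemma I2V_dx g gx : cont2V g -> cont2V gx -> dxV g gx -> dxV (I2V g) (I2V gx).
Proof.
  intros (A & B & C) (A' & B' & C') D x y.
  split; [|split]; apply I2_dx; auto; intros u v; apply (D u v).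
Qed.

Lemma I2V_dy g : cont2V g -> dyV (I2V g) g.
Proof. intros (A & B & C) x y. split; [|split]; now apply I2_dy. Qed.
Lemma I1V_dy g gy : cont2V g -> cont2V gy -> dyV g gy -> dyV (I1V g) (I1V gy).
Proof.
  intros (A & B & C) (A' & B' & C') D x y.
  split; [|split]; apply I1_dy; auto; intros u v; apply (D u v).
Qed.

Lemma I1V_dx g : cont2V g -> dxV (I1V g) g.
Proof. intros (A & B & C) x y. split; [|split]; now apply I1_dx. Qed.
Lemma cont2V_add f g : cont2V f -> cont2V g -> cont2V (fun x y => vadd (f x y) (g x y)).
Proof. intros (A & B & C) (A' & B' & C'). split; [|split]; now apply cont2_plus. Qed.
Lemma cont2V_tri f g h : cont2V f -> cont2V g -> cont2V h ->
  cont2V (fun x y => tri (f x y) (g x y) (h x y)).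
Proof.
  intros (A & B & C) (A' & B' & C') (P & Q & R').
  assert (D : cont2 (fun x y => - dot (f x y) (g x y))).
  { intros x y. apply continuity_2d_pt_opp. revert x y. unfold dot.
    repeat apply cont2_plus; now apply cont2_mult. }
  split; [|split]; now apply cont2_mult.
Qed.

Lemma cont2V_I2 g : cont2V g -> cont2V (I2V g).
Proof. intros (A & B & C). split; [|split]; now apply cont2_I2. Qed.
Lemma cont2V_I1 g : cont2V g -> cont2V (I1V g).
Proof. intros (A & B & C). split; [|split]; now apply cont2_I1. Qed.
Lemma cont2V_const v : cont2V (fun _ _ => v).
Proof. split; [|split]; apply cont2_const. Qed.

Lemma nrm_I2V_diff g h x y M : cont2V g -> cont2V h ->
  (forall t, Rabs t <= Rabs y -> nrm (vsub (g x t) (h x t)) <= M) ->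
  nrm (vsub (I2V g x y) (I2V h x y)) <= 3 * M * Rabs y.
Proof.
  intros (A & B & C) (A' & B' & C') H.
  unfold nrm. unfold vsub, I2V. unfold c1 at 1, c2 at 1, c3 at 1. simpl.
  pose proof (I2_diff_le _ _ x x y M A A' (fun t Ht => Rle_trans _ _ _ (proj1 (nrm_c _)) (H t Ht))).
  pose proof (I2_diff_le _ _ x x y M B B' (fun t Ht => Rle_trans _ _ _ (proj1 (proj2 (nrm_c _))) (H t Ht))).
  pose proof (I2_diff_le _ _ x x y M C C' (fun t Ht => Rle_trans _ _ _ (proj2 (proj2 (nrm_c _))) (H t Ht))).
  unfold c1, c2, c3 in *. simpl in *. lra.
Qed.

Lemma vsub_v0 v : vsub v v0 = v.
Proof. vring. Qed.
Lemma I2V_v0 x y : I2V (fun _ _ => v0) x y = v0.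
Proof. apply V3_eq; apply I2_zero. Qed.
Lemma nrm_I2V g x y M : cont2V g ->
  (forall t, Rabs t <= Rabs y -> nrm (g x t) <= M) -> nrm (I2V g x y) <= 3 * M * Rabs y.
Proof.
  intros Hg H. rewrite <- (vsub_v0 (I2V g x y)), <- (I2V_v0 x y).
  apply nrm_I2V_diff; auto. apply cont2V_const. intros. rewrite vsub_v0. auto.
Qed.

Definition swapV (g : R -> R -> V3) : R -> R -> V3 := fun x y => g y x.
Lemma cont2V_swap g : cont2V g -> cont2V (swapV g).
Proof. intros (A & B & C). split; [|split]; now apply cont2_swap. Qed.
Lemma I1V_swap g x y : I1V g x y = I2V (swapV g) y x.
Proof. reflexivity. Qed.
Lemma nrm_I1V_diff g h x y M : cont2V g -> cont2V h ->
  (forall t, Rabs t <= Rabs x -> nrm (vsub (g t y) (h t y)) <= M) ->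
  nrm (vsub (I1V g x y) (I1V h x y)) <= 3 * M * Rabs x.
Proof. intros Hg Hh H. rewrite !I1V_swap. apply nrm_I2V_diff; auto using cont2V_swap. Qed.
Lemma nrm_I1V g x y M : cont2V g ->
  (forall t, Rabs t <= Rabs x -> nrm (g t y) <= M) -> nrm (I1V g x y) <= 3 * M * Rabs x.
Proof. intros Hg H. rewrite !I1V_swap. apply nrm_I2V; auto using cont2V_swap. Qed.
Lemma CauV_swap rho k G : CauV rho k G -> CauV rho k (fun m => swapV (G m)).
Proof.
  intros (A & B & C). split; [|split].
  exact (Cau_swap _ _ _ A). exact (Cau_swap _ _ _ B). exact (Cau_swap _ _ _ C).
Qed.

Definition gconvV (rho : R) (G : vseq) : Prop :=
  exists c, forall m x y, box rho x y ->
    nrm (G m x y) <= c /\ nrm (vsub (G (S m) x y) (G m x y)) <= c * (/ 2) ^ m.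

Lemma CauV_gconv rho k G : CauV rho k G -> gconvV rho G.
Proof.
  intros (A & B & C). apply Cau_gconv in A, B, C.
  destruct A as [a A], B as [b B], C as [c C]. exists (a + b + c). intros m x y H.
  specialize (A m x y H). specialize (B m x y H). specialize (C m x y H).
  unfold nrm, vsub. unfold c1, c2, c3 in *. simpl in *. lra.
Qed.

Lemma CauV_0 rho G : (forall m, cont2V (G m)) -> gconvV rho G -> CauV rho 0 G.
Proof.
  intros H [c Hc]. split; [|split]; (split; [intro m; apply (H m)|split; auto]); exists c; intros m x y Hxy;
  destruct (Hc m x y Hxy) as [A B];
  destruct (nrm_c (G m x y)) as (P1 & P2 & P3);
  destruct (nrm_c (vsub (G (S m) x y) (G m x y))) as (Q1 & Q2 & Q3); unfold vsub, c1, c2, c3 in *; simpl in *; lra.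
Qed.

Lemma CauV_dxy rho k G : CauV rho (S k) G -> exists Gx Gy : vseq,
  (forall m, dxV (G m) (Gx m)) /\ (forall m, dyV (G m) (Gy m)) /\ CauV rho k Gx /\ CauV rho k Gy.
Proof.
  intros ((_ & _ & ax & ay & A1 & A2 & A3 & A4) & (_ & _ & bx & by' & B1 & B2 & B3 & B4) &
    (_ & _ & cx & cy & C1 & C2 & C3 & C4)).
  exists (fun m x y => (ax m x y, bx m x y, cx m x y)), (fun m x y => (ay m x y, by' m x y, cy m x y)).
  split; [|split; [|split]].
  - intros m x y. exact (conj (A1 m x y) (conj (B1 m x y) (C1 m x y))).
  - intros m x y. exact (conj (A2 m x y) (conj (B2 m x y) (C2 m x y))).
  - exact (conj A3 (conj B3 C3)).
  - exact (conj A4 (conj B4 C4)).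
Qed.

Lemma CauV_S rho k G Gx Gy : CauV rho k G ->
  (forall m, dxV (G m) (Gx m)) -> (forall m, dyV (G m) (Gy m)) -> CauV rho k Gx -> CauV rho k Gy ->
  CauV rho (S k) G.
Proof.
  intros (A & B & C) X Y (A' & B' & C') (A'' & B'' & C'').
  assert (K : forall c : V3 -> R, Cau rho k (fun m x y => c (G m x y)) ->
    Cau rho k (fun m x y => c (Gx m x y)) -> Cau rho k (fun m x y => c (Gy m x y)) ->
    (forall m, dx (fun x y => c (G m x y)) (fun x y => c (Gx m x y))) ->
    (forall m, dy (fun x y => c (G m x y)) (fun x y => c (Gy m x y))) ->
    Cau rho (S k) (fun m x y => c (G m x y))).
  { intros c H. split; [exact (Cau_cont _ _ _ H)|split; [exact (Cau_gconv _ _ _ H)|]].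
    exists (fun m x y => c (Gx m x y)), (fun m x y => c (Gy m x y)). auto. }
  split; [|split]; (apply K; auto; intros m x y; [apply (X m x y)|apply (Y m x y)]).
Qed.

Lemma CauV_const rho k v : CauV rho k (fun _ _ _ => v).
Proof. split; [|split]; apply Cau_const. Qed.

(** The form taken by the recursion for a derivative of the Picard iterates: the unknown occurs
    linearly and only under an integral, with coefficients [p], [q] and lower-order terms [b]. *)
Fixpoint linrec (p q b : vseq) (m : nat) : R -> R -> V3 :=
  match m with
  | O => fun _ _ => v0
  | S m' => fun x y =>
      vadd (tri (I2V (linrec p q b m') x y) (p m' x y) (q m' x y)) (b m' x y)
  end.

(** The integral gains [3 rho], so the linear part has norm at most [3 rho P^2], which is at most
    1/4. This leaves room for a geometric rate 1/2 although the coefficients themselves vary with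
    the index. *)
Lemma CauV_linrec_0 rho P p q b : 0 < rho -> CauV rho 0 p -> CauV rho 0 q -> CauV rho 0 b ->
  (forall m x y, box rho x y -> nrm (p m x y) <= P /\ nrm (q m x y) <= P) ->
  12 * rho * P * P <= 1 -> CauV rho 0 (linrec p q b).
Proof.
  intros Hr Hp Hq Hb HP Hs.
  assert (HC : forall m, cont2V (linrec p q b m)).
  { induction m; simpl. apply cont2V_const.
    apply cont2V_add. apply cont2V_tri. now apply cont2V_I2.
    now apply (CauV_cont rho 0). now apply (CauV_cont rho 0). now apply (CauV_cont rho 0 b). }
  apply CauV_0. exact HC.
  apply CauV_gconv in Hp, Hq, Hb. destruct Hp as [p' Hp], Hq as [q' Hq], Hb as [b' Hb].
  assert (B0 : box rho 0 0) by (split; rewrite Rabs_R0; lra).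
  assert (0 <= P) by (eapply Rle_trans; [apply nrm_pos|apply (HP 0%nat _ _ B0)]).
  assert (0 <= p') by (eapply Rle_trans; [apply nrm_pos|apply (Hp 0%nat _ _ B0)]).
  assert (0 <= q') by (eapply Rle_trans; [apply nrm_pos|apply (Hq 0%nat _ _ B0)]).
  assert (0 <= b') by (eapply Rle_trans; [apply nrm_pos|apply (Hb 0%nat _ _ B0)]).
  assert (HI : forall g M x y, cont2V g -> (forall x y, box rho x y -> nrm (g x y) <= M) -> box rho x y ->
     nrm (I2V g x y) <= 3 * rho * M).
  { intros g M x y Hg HM Hxy. eapply Rle_trans. apply (nrm_I2V g x y M); auto.
    intros; apply HM. eapply box_sub; eauto.
    assert (0 <= M) by (eapply Rle_trans; [apply nrm_pos|apply (HM _ _ B0)]).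
    replace (3 * rho * M) with (3 * M * rho) by ring. apply Rmult_le_compat_l. lra. apply Hxy. }
  (* The bound [2 * b'] reproduces itself: the linear part returns at most [b' / 2] and the
     inhomogeneity adds [b']. *)
  assert (HB : forall m x y, box rho x y -> nrm (linrec p q b m x y) <= 2 * b').
  { induction m; intros x y Hxy; simpl. rewrite nrm_v0; lra.
    eapply Rle_trans; [apply nrm_add|].
    pose proof (HI _ (2 * b') x y (HC m) IHm Hxy).
    destruct (HP m x y Hxy).
    assert (nrm (tri (I2V (linrec p q b m) x y) (p m x y) (q m x y)) <= (3 * rho * (2 * b')) * P * P).
    { eapply Rle_trans; [apply nrm_tri|]. now apply nrm_prod. }
    destruct (Hb m x y Hxy). nra. }
  (* The part of the increment caused by the changes of [p], [q] and [b] from one index to the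
     next. *)
  set (c := 3 * rho * (2 * b') * p' * P + 3 * rho * (2 * b') * P * q' + b').
  assert (Hc : 0 <= c).
  { unfold c. assert (0 <= 3 * rho * (2 * b')) by nra.
    repeat apply Rplus_le_le_0_compat; auto; repeat apply Rmult_le_pos; lra. }
  (* The linear part passes on a quarter of the previous increment and [c] is at most another
     quarter of the constant, which gives the ratio 1/2; the summand [2 * b'] covers the start. *)
  assert (HD : forall m x y, box rho x y ->
     nrm (vsub (linrec p q b (S m) x y) (linrec p q b m x y)) <= (4 * c + 2 * b') * (/ 2) ^ m).
  { induction m; intros x y Hxy.
    - simpl (linrec p q b 0 x y). rewrite vsub_v0. rewrite pow_O. eapply Rle_trans; [apply HB; auto|]. lra.
    - change (linrec p q b (S (S m)) x y) with
       (vadd (tri (I2V (linrec p q b (S m)) x y) (p (S m) x y) (q (S m) x y)) (b (S m) x y)).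
      change (linrec p q b (S m) x y) with
       (vadd (tri (I2V (linrec p q b m) x y) (p m x y) (q m x y)) (b m x y)).
      set (X' := I2V (linrec p q b (S m)) x y). set (X := I2V (linrec p q b m) x y).
      replace (vsub (vadd (tri X' (p (S m) x y) (q (S m) x y)) (b (S m) x y))
         (vadd (tri X (p m x y) (q m x y)) (b m x y)))
      with (vadd (vsub (tri X' (p (S m) x y) (q (S m) x y)) (tri X (p m x y) (q m x y)))
           (vsub (b (S m) x y) (b m x y))) by vring.
      eapply Rle_trans; [apply nrm_add|].
      pose proof (nrm_tri_diff X' (p (S m) x y) (q (S m) x y) X (p m x y) (q m x y)) as T.
      destruct (Hp m x y Hxy) as [_ Tp]. destruct (Hq m x y Hxy) as [_ Tq]. destruct (Hb m x y Hxy) as [_ Tb].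
      destruct (HP (S m) x y Hxy) as [Sp Sq]. destruct (HP m x y Hxy) as [Sp' Sq'].
      pose proof (HI _ _ x y (HC m) (HB m) Hxy) as SX. fold X in SX.
      pose proof (pow_half_pos m) as Pm. set (e := (/ 2) ^ m) in *.
      assert (DX : nrm (vsub X' X) <= 3 * rho * ((4 * c + 2 * b') * e)).
      { eapply Rle_trans. apply (nrm_I2V_diff _ _ x y ((4 * c + 2 * b') * e)); auto.
        intros t Ht. apply IHm. eapply box_sub; eauto.
        replace (3 * rho * ((4 * c + 2 * b') * e)) with (3 * ((4 * c + 2 * b') * e) * rho) by ring.
        apply Rmult_le_compat_l. nra. apply Hxy. }
      assert (T1 : nrm (vsub X' X) * nrm (p (S m) x y) * nrm (q (S m) x y) <= 3 * rho * ((4 * c + 2 * b') * e) * P * P) by now apply nrm_prod.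
      assert (T2 : nrm X * nrm (vsub (p (S m) x y) (p m x y)) * nrm (q (S m) x y) <= 3 * rho * (2 * b') * (p' * e) * P) by now apply nrm_prod.
      assert (T3 : nrm X * nrm (p m x y) * nrm (vsub (q (S m) x y) (q m x y)) <= 3 * rho * (2 * b') * P * (q' * e)) by now apply nrm_prod.
      replace ((/ 2) ^ S m) with (e / 2) by (unfold e; simpl; field).
      assert (T4 : 3 * rho * ((4 * c + 2 * b') * e) * P * P <= (4 * c + 2 * b') * e / 4).
      { replace (3 * rho * ((4 * c + 2 * b') * e) * P * P) with ((12 * rho * P * P) * ((4 * c + 2 * b') * e / 4)) by field.
        rewrite <- (Rmult_1_l ((4 * c + 2 * b') * e / 4)) at 2. apply Rmult_le_compat_r; nra. }
      assert (T5 : 3 * rho * (2 * b') * (p' * e) * P + 3 * rho * (2 * b') * P * (q' * e) + b' * e = c * e)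
        by (unfold c; ring).
      nra. }
  exists (4 * c + 2 * b'). intros m x y Hxy. split. eapply Rle_trans; [apply HB; auto|]. lra. auto.
Qed.

(** Differentiation in x reproduces the recursion with the same [p] and [q], hence with the same
    smallness condition. The induction on [k] therefore quantifies over [b], while [rho] and [P]
    stay fixed. *)
Lemma CauV_linrec rho P : 0 < rho -> 12 * rho * P * P <= 1 -> forall k p q b,
  CauV rho k p -> CauV rho k q -> CauV rho k b ->
  (forall m x y, box rho x y -> nrm (p m x y) <= P /\ nrm (q m x y) <= P) ->
  CauV rho k (linrec p q b).
Proof.
  intros Hr Hs. induction k; intros p q b Hp Hq Hb HP.
  - now apply (CauV_linrec_0 rho P).
  - pose proof (CauV_pred _ _ _ Hp) as Hp'. pose proof (CauV_pred _ _ _ Hq) as Hq'.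
    pose proof (CauV_pred _ _ _ Hb) as Hb'.
    pose proof (IHk p q b Hp' Hq' Hb' HP) as HX.
    destruct (CauV_dxy _ _ _ Hp) as (px & py & Dpx & Dpy & Cpx & Cpy).
    destruct (CauV_dxy _ _ _ Hq) as (qx & qy & Dqx & Dqy & Cqx & Cqy).
    destruct (CauV_dxy _ _ _ Hb) as (bx & by' & Dbx & Dby & Cbx & Cby).
    set (X := linrec p q b) in *.
    pose proof (CauV_I2 _ _ _ Hr HX) as HI.
    (* All terms in which the derivative does not fall on the unknown. *)
    set (b' := fun m x y => vadd (vadd (tri (I2V (X m) x y) (px m x y) (q m x y))
                       (tri (I2V (X m) x y) (p m x y) (qx m x y))) (bx m x y)).
    assert (Cb' : CauV rho k b').
    { unfold b'. repeat apply CauV_add; auto; apply CauV_tri; auto. }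
    pose proof (IHk p q b' Hp' Hq' Cb' HP) as HX'. set (Xx := linrec p q b') in *.
    assert (Dx : forall m, dxV (X m) (Xx m)).
    { induction m; intros x y. exact (vder_const v0 x).
      assert (DI : dxV (I2V (X m)) (I2V (Xx m))).
      { apply I2V_dx; auto. now apply (CauV_cont rho k). now apply (CauV_cont rho k). }
      eapply vder_eq; [exact (vder_add _ _ _ _ _ (vder_tri _ _ _ _ _ _ _ (DI x y) (Dpx m x y) (Dqx m x y)) (Dbx m x y))|].
      unfold Xx. simpl. fold Xx. unfold b'. vring. }
    (* In y the derivative undoes the integral, so a closed formula replaces a recursion. *)
    set (Xy := fun m x y => vadd (vadd (vadd (tri (X m x y) (p m x y) (q m x y))
                       (tri (I2V (X m) x y) (py m x y) (q m x y)))
                       (tri (I2V (X m) x y) (p m x y) (qy m x y))) (by' m x y)).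
    assert (Cy : CauV rho k Xy).
    { unfold Xy. repeat apply CauV_add; auto; apply CauV_tri; auto. }
    set (Xy' := fun m => match m with O => fun _ _ => v0 | S m' => Xy m' end).
    apply (CauV_S _ _ _ Xx Xy'); auto.
    + intros [|m] x y. exact (vder_const v0 y).
      eapply vder_eq; [exact (vder_add _ _ _ _ _ (vder_tri _ _ _ _ _ _ _
        (I2V_dy _ (CauV_cont rho k X m HX) x y) (Dpy m x y) (Dqy m x y)) (Dby m x y))|].
      unfold Xy', Xy. vring.
    + apply CauV_unshift; auto.
Qed.

(** * Picard iteration for the Goursat problem *)

Definition smoothV (h : R -> V3) : Prop :=
  smooth1 (fun t => c1 (h t)) /\ smooth1 (fun t => c2 (h t)) /\ smooth1 (fun t => c3 (h t)).
Definition dV (h : R -> V3) (t : R) : V3 :=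
  (Derive (fun s => c1 (h s)) t, Derive (fun s => c2 (h s)) t, Derive (fun s => c3 (h s)) t).

Lemma smooth_curve_V h : smooth_curve h -> smoothV h.
Proof. intros H. split; [|split]; intros k t; apply (H k t). Qed.
Lemma smoothV_dV h : smoothV h -> smoothV (dV h).
Proof. intros (A & B & C). split; [|split]; now apply smooth1_Derive. Qed.
Lemma CauV_fun1 rho k h : 0 < rho -> smoothV h -> CauV rho k (fun _ x _ => h x).
Proof.
  intros Hr (A & B & C). split; [|split].
  exact (Cau_fun1 rho k _ Hr A). exact (Cau_fun1 rho k _ Hr B). exact (Cau_fun1 rho k _ Hr C).
Qed.

Lemma CauV_fun2 rho k h : 0 < rho -> smoothV h -> CauV rho k (fun _ _ y => h y).
Proof. intros Hr H. apply (CauV_swap _ _ (fun _ x _ => h x)). now apply CauV_fun1. Qed.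
Lemma smoothV_vder h t : smoothV h -> vder h t (dV h t).
Proof. intros (A & B & C). split; [|split]; now apply smooth1_is_derive. Qed.

Definition picU (n1 : R -> V3) (g : R -> R -> V3) (x y : R) : V3 := vadd (dV n1 x) (I2V g x y).
Definition picV (n2 : R -> V3) (g : R -> R -> V3) (x y : R) : V3 := vadd (dV n2 y) (I1V g x y).
(** The curve [n1] enters only through its derivative in [picU]; its value at 0 comes from [n2].
    Every iterate then satisfies [n_x = u], [n_y = v] and [u_y = v_x = g] exactly, and only the
    equation for [g] is approximate. *)
Definition picN (n1 n2 : R -> V3) (g : R -> R -> V3) (x y : R) : V3 :=
  vadd (n2 y) (I1V (picU n1 g) x y).
Fixpoint picG (n1 n2 : R -> V3) (m : nat) : R -> R -> V3 :=
  match m with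
  | O => fun _ _ => v0
  | S m' => fun x y => tri (picU n1 (picG n1 n2 m') x y) (picV n2 (picG n1 n2 m') x y)
                         (picN n1 n2 (picG n1 n2 m') x y)
  end.

(** The number 18 is 3 for coordinates, times 3 for the arguments of [tri], times 2 for the
    contraction ratio. The slack 1 between data and [U] is the room for the integrals. *)
Definition pic_bound (n1 n2 : R -> V3) (rho U : R) : Prop :=
  0 < rho /\ 1 <= U /\ 18 * rho * U ^ 3 <= 1 /\
  forall t, Rabs t <= rho -> nrm (n1 t) <= U - 1 /\ nrm (n2 t) <= U - 1 /\
    nrm (dV n1 t) <= U - 1 /\ nrm (dV n2 t) <= U - 1.

Section Picard.
Context (n1 n2 : R -> V3) (rho U : R) (S1 : smoothV n1) (S2 : smoothV n2)
  (HB : pic_bound n1 n2 rho U).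

Let Hr : 0 < rho. Proof. apply HB. Qed.
Let HU : 1 <= U. Proof. apply HB. Qed.
Let Hs : 18 * rho * U ^ 3 <= 1. Proof. apply HB. Qed.

Let HU2 : 1 <= U * U /\ U * U <= U ^ 3 /\ U <= U ^ 3.
Proof. split; [nra|split]; simpl; nra. Qed.

Let small1 : 18 * rho <= 1.
Proof. assert (1 <= U ^ 3) by lra. nra. Qed.
Let smallU : 18 * rho * U <= 1.
Proof. nra. Qed.
Let smallU2 : 18 * rho * (U * U) <= 1.
Proof. nra. Qed.

Let G := picG n1 n2.
Let u m := picU n1 (G m).
Let v m := picV n2 (G m).
Let n m := picN n1 n2 (G m).

Lemma cont2V_fun1 h : smoothV h -> cont2V (fun x _ => h x).
Proof. intros H. exact (CauV_cont rho 0 _ 0 (CauV_fun1 rho 0 h Hr H)). Qed.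
Lemma cont2V_fun2 h : smoothV h -> cont2V (fun _ y => h y).
Proof. intros H. exact (CauV_cont rho 0 _ 0 (CauV_fun2 rho 0 h Hr H)). Qed.

Lemma picU_cont g : cont2V g -> cont2V (picU n1 g).
Proof. intros H. apply cont2V_add. apply cont2V_fun1, smoothV_dV, S1. now apply cont2V_I2. Qed.
Lemma picV_cont g : cont2V g -> cont2V (picV n2 g).
Proof. intros H. apply cont2V_add. apply cont2V_fun2, smoothV_dV, S2. now apply cont2V_I1. Qed.
Lemma picN_cont g : cont2V g -> cont2V (picN n1 n2 g).
Proof. intros H. apply cont2V_add. apply cont2V_fun2, S2. now apply cont2V_I1, picU_cont. Qed.
Lemma picG_cont m : cont2V (G m).
Proof.
  induction m; simpl. apply cont2V_const.
  apply cont2V_tri. now apply picU_cont. now apply picV_cont. now apply picN_cont.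
Qed.

Lemma box_sub1 x y t : box rho x y -> Rabs t <= Rabs x -> box rho t y.
Proof. intros [X Y] T; split; lra. Qed.

(** Invariance of the ball of radius [U ^ 3]: an integral of [g] adds at most [3 rho U^3], less than
    the slack 1, and the product of three factors bounded by [U] is again at most [U ^ 3]. *)
Lemma picUV_bound g : cont2V g -> (forall x y, box rho x y -> nrm (g x y) <= U ^ 3) ->
  forall x y, box rho x y -> nrm (picU n1 g x y) <= U /\ nrm (picV n2 g x y) <= U /\ nrm (picN n1 n2 g x y) <= U.
Proof.
  intros Hg HM.
  assert (A : forall x y, box rho x y -> nrm (picU n1 g x y) <= U).
  { intros x y Hxy. eapply Rle_trans; [apply nrm_add|].
    destruct HB as (_ & _ & _ & Hb). destruct (Hb x (proj1 Hxy)) as (_ & _ & Q & _).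
    assert (nrm (I2V g x y) <= 3 * U ^ 3 * Rabs y).
    { apply nrm_I2V; auto. intros; apply HM. eapply box_sub; eauto. }
    assert (3 * U ^ 3 * Rabs y <= 3 * U ^ 3 * rho) by (apply Rmult_le_compat_l; [lra|apply Hxy]). lra. }
  intros x y Hxy. split; [|split]; auto.
  - eapply Rle_trans; [apply nrm_add|].
    destruct HB as (_ & _ & _ & Hb). destruct (Hb y (proj2 Hxy)) as (_ & _ & _ & Q).
    assert (nrm (I1V g x y) <= 3 * U ^ 3 * Rabs x).
    { apply nrm_I1V; auto. intros; apply HM. eapply box_sub1; eauto. }
    assert (3 * U ^ 3 * Rabs x <= 3 * U ^ 3 * rho) by (apply Rmult_le_compat_l; [lra|apply Hxy]). lra.
  - eapply Rle_trans; [apply nrm_add|].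
    destruct HB as (_ & _ & _ & Hb). destruct (Hb y (proj2 Hxy)) as (_ & Q & _).
    assert (nrm (I1V (picU n1 g) x y) <= 3 * U * Rabs x).
    { apply nrm_I1V; auto using picU_cont. intros; apply A. eapply box_sub1; eauto. }
    assert (3 * U * Rabs x <= 3 * U * rho) by (apply Rmult_le_compat_l; [lra|apply Hxy]). lra.
Qed.

Lemma picG_bound m : forall x y, box rho x y -> nrm (G m x y) <= U ^ 3.
Proof.
  induction m; intros x y Hxy. change (G 0 x y) with v0. rewrite nrm_v0. lra.
  destruct (picUV_bound _ (picG_cont m) IHm x y Hxy) as (A & B & C).
  eapply Rle_trans; [apply nrm_tri|].
  replace (U ^ 3) with (U * U * U) by ring.
  now apply nrm_prod.
Qed.

Lemma pic_bounds m x y : box rho x y -> nrm (u m x y) <= U /\ nrm (v m x y) <= U /\ nrm (n m x y) <= U.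
Proof. apply picUV_bound. apply picG_cont. apply picG_bound. Qed.

(** The data cancel in differences. For [picN] two integrations give the square of [3 rho], which is
    below [3 rho]. *)
Lemma pic_diff g h M : cont2V g -> cont2V h ->
  (forall x y, box rho x y -> nrm (vsub (g x y) (h x y)) <= M) ->
  forall x y, box rho x y ->
   nrm (vsub (picU n1 g x y) (picU n1 h x y)) <= 3 * rho * M /\
   nrm (vsub (picV n2 g x y) (picV n2 h x y)) <= 3 * rho * M /\
   nrm (vsub (picN n1 n2 g x y) (picN n1 n2 h x y)) <= 3 * rho * M.
Proof.
  intros Hg Hh HM.
  assert (HM0 : 0 <= M).
  { eapply Rle_trans; [apply nrm_pos|apply (HM 0 0)]. split; rewrite Rabs_R0; lra. }
  assert (K : forall a, Rabs a <= rho -> forall M, 0 <= M -> 3 * M * Rabs a <= 3 * rho * M).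
  { intros a Ha M' HM'. replace (3 * rho * M') with (3 * M' * rho) by ring. apply Rmult_le_compat_l; lra. }
  assert (E : forall a b c, vsub (vadd a b) (vadd a c) = vsub b c) by (intros; vring).
  assert (A : forall x y, box rho x y -> nrm (vsub (picU n1 g x y) (picU n1 h x y)) <= 3 * rho * M).
  { intros x y Hxy. unfold picU. rewrite E. eapply Rle_trans; [apply (nrm_I2V_diff g h x y M)|]; auto.
    intros; apply HM. eapply box_sub; eauto. apply K; auto. apply Hxy. }
  intros x y Hxy. split; [|split]; auto.
  - unfold picV. rewrite E. eapply Rle_trans; [apply (nrm_I1V_diff g h x y M)|]; auto.
    intros; apply HM. eapply box_sub1; eauto. apply K; auto. apply Hxy.
  - unfold picN. rewrite E. eapply Rle_trans; [apply (nrm_I1V_diff _ _ x y (3 * rho * M))|]; auto using picU_cont.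
    intros; apply A. eapply box_sub1; eauto.
    eapply Rle_trans. apply K. apply Hxy. nra.
    rewrite <- (Rmult_1_l (3 * rho * M)) at 2. rewrite <- Rmult_assoc.
    replace (3 * rho * (3 * rho) * M) with ((3 * rho) * (3 * rho * M)) by ring.
    rewrite Rmult_1_l. rewrite <- (Rmult_1_l (3 * rho * M)) at 2. apply Rmult_le_compat_r; nra.
Qed.

(** Each of the three telescoped terms is at most a sixth of the previous increment, so the Picard
    map halves increments. *)
Lemma picG_CauV_0 : CauV rho 0 G.
Proof.
  apply CauV_0. apply picG_cont.
  exists (2 * U ^ 3).
  assert (HD : forall m x y, box rho x y -> nrm (vsub (G (S m) x y) (G m x y)) <= 2 * U ^ 3 * (/ 2) ^ m).
  { induction m; intros x y Hxy.
    - change (G 0 x y) with v0. rewrite vsub_v0, pow_O. pose proof (picG_bound 1 x y Hxy). lra.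
    - destruct (pic_diff _ _ _ (picG_cont (S m)) (picG_cont m) IHm x y Hxy) as (A & B & C).
      destruct (pic_bounds m x y Hxy) as (P & Q & R).
      destruct (pic_bounds (S m) x y Hxy) as (P' & Q' & R').
      change (G (S (S m)) x y) with (tri (u (S m) x y) (v (S m) x y) (n (S m) x y)).
      change (G (S m) x y) with (tri (u m x y) (v m x y) (n m x y)).
      eapply Rle_trans; [apply nrm_tri_diff|].
      fold (u (S m) x y) in *.
      set (D := 2 * U ^ 3 * (/ 2) ^ m) in *.
      assert (HD0 : 0 <= D) by (unfold D; pose proof (pow_half_pos m); nra).
      set (d := 3 * rho * D) in *. assert (Hd : 0 <= d) by (unfold d; nra).
      assert (T1 : nrm (vsub (u (S m) x y) (u m x y)) * nrm (v (S m) x y) * nrm (n (S m) x y) <= d * U * U)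
        by now apply nrm_prod.
      assert (T2 : nrm (u m x y) * nrm (vsub (v (S m) x y) (v m x y)) * nrm (n (S m) x y) <= U * d * U)
        by now apply nrm_prod.
      assert (T3 : nrm (u m x y) * nrm (v m x y) * nrm (vsub (n (S m) x y) (n m x y)) <= U * U * d)
        by now apply nrm_prod.
      replace (2 * U ^ 3 * (/ 2) ^ S m) with (D / 2) by (unfold D; simpl; field).
      assert (d * U * U <= D / 6).
      { unfold d. replace (3 * rho * D * U * U) with ((18 * rho * (U * U)) * (D / 6)) by field.
        rewrite <- (Rmult_1_l (D / 6)) at 2. apply Rmult_le_compat_r; lra. }
      lra. }
  intros m x y Hxy. split; auto. pose proof (picG_bound m x y Hxy). lra.
Qed.

Lemma CauV_u k : CauV rho k G -> CauV rho k u.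
Proof. intros H. apply CauV_add. apply CauV_fun1; auto using smoothV_dV. now apply (CauV_I2 rho k G). Qed.
Lemma CauV_v k : CauV rho k G -> CauV rho k v.
Proof. intros H. apply CauV_add. apply CauV_fun2; auto using smoothV_dV. now apply (CauV_I1 rho k G). Qed.
Lemma CauV_n k : CauV rho k G -> CauV rho k n.
Proof. intros H. apply CauV_add. apply CauV_fun2; auto. apply (CauV_I1 rho k u); auto. now apply CauV_u. Qed.

Lemma u_dy m : dyV (u m) (G m).
Proof.
  intros x y. eapply vder_eq; [exact (vder_add _ _ _ _ _ (vder_const _ _) (I2V_dy _ (picG_cont m) x y))|]. vring.
Qed.

Lemma v_dx m : dxV (v m) (G m).
Proof.
  intros x y. eapply vder_eq; [exact (vder_add _ _ _ _ _ (vder_const _ _) (I1V_dx _ (picG_cont m) x y))|]. vring.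
Qed.

Lemma n_dx m : dxV (n m) (u m).
Proof.
  intros x y.
  eapply vder_eq; [exact (vder_add _ _ _ _ _ (vder_const _ _) (I1V_dx _ (picU_cont _ (picG_cont m)) x y))|].
  fold (u m). vring.
Qed.

Lemma n_dy m : dyV (n m) (v m).
Proof.
  intros x y.
  exact (vder_add _ _ _ _ _ (smoothV_vder _ _ S2) (I1V_dy _ _ (picU_cont _ (picG_cont m)) (picG_cont m) (u_dy m) x y)).
Qed.

(** The derivative of order one is identified with a solution of [linrec] whose coefficients are
    iterates already controlled to order [k]; the relations [v_x = G] and [n_x = u] make the
    remaining terms derivative-free. *)
Lemma picG_CauV k : CauV rho k G.
Proof.
  induction k. apply picG_CauV_0.
  pose proof (CauV_u k IHk) as Cu. pose proof (CauV_v k IHk) as Cv. pose proof (CauV_n k IHk) as Cn.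
  assert (Hlin : 12 * rho * U * U <= 1) by lra.
  pose proof (smoothV_dV _ S1) as S1'. pose proof (smoothV_dV _ S2) as S2'.
  (* Since [u_x] is the second derivative of [n1] plus the integral of [G_x], only the latter
     contains the unknown; the rest is [b]. *)
  set (b := fun m x y => vadd (vadd (tri (dV (dV n1) x) (v m x y) (n m x y))
              (tri (u m x y) (G m x y) (n m x y)))
              (tri (u m x y) (v m x y) (u m x y))).
  assert (Cb : CauV rho k b).
  { unfold b. repeat apply CauV_add; apply CauV_tri; auto.
    apply (CauV_fun1 rho k (dV (dV n1))); auto using smoothV_dV. }
  set (X := linrec v n b).
  assert (CX : CauV rho k X).
  { apply (CauV_linrec rho U); auto. intros m x y Hxy. destruct (pic_bounds m x y Hxy) as (_ & P1 & P2). auto. }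
  assert (DX : forall m, dxV (G m) (X m)).
  { induction m; intros x y. exact (vder_const v0 x).
    assert (Du : vder (fun t => u m t y) x (vadd (dV (dV n1) x) (I2V (X m) x y)))
      by exact (vder_add _ _ _ _ _ (smoothV_vder _ x S1')
        (I2V_dx _ _ (picG_cont m) (CauV_cont rho k X m CX) IHm x y)).
    eapply vder_eq; [exact (vder_tri _ _ _ _ _ _ _ Du (v_dx m x y) (n_dx m x y))|].
    change (X (S m) x y) with (vadd (tri (I2V (X m) x y) (v m x y) (n m x y)) (b m x y)).
    unfold b. cbv beta.
    vring. }
  set (b2 := fun m x y => vadd (vadd (tri (G m x y) (v m x y) (n m x y))
              (tri (u m x y) (dV (dV n2) y) (n m x y)))
              (tri (u m x y) (v m x y) (v m x y))).
  assert (Cb2 : CauV rho k b2).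
  { unfold b2. repeat apply CauV_add; apply CauV_tri; auto.
    apply (CauV_fun2 rho k (dV (dV n2))); auto using smoothV_dV. }
  (* For [G_y] the unknown stands under an integral in x, so the coordinates are exchanged to reuse
     [linrec]. *)
  set (Z := linrec (fun m => swapV (u m)) (fun m => swapV (n m)) (fun m => swapV (b2 m))).
  assert (CZ : CauV rho k Z).
  { apply (CauV_linrec rho U); auto using CauV_swap.
    intros m x y [A B]. destruct (pic_bounds m y x (conj B A)) as (P1 & _ & P2). exact (conj P1 P2). }
  set (Y := fun m => swapV (Z m)).
  assert (CY : CauV rho k Y) by now apply CauV_swap.
  assert (DY : forall m, dyV (G m) (Y m)).
  { induction m; intros x y. exact (vder_const v0 y).
    assert (Dv : vder (fun t => v m x t) y (vadd (dV (dV n2) y) (I1V (Y m) x y)))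
      by exact (vder_add _ _ _ _ _ (smoothV_vder _ y S2')
        (I1V_dy _ _ (picG_cont m) (CauV_cont rho k Y m CY) IHm x y)).
    eapply vder_eq; [exact (vder_tri _ _ _ _ _ _ _ (u_dy m x y) Dv (n_dy m x y))|].
    change (Y (S m) x y) with (vadd (tri (I2V (Z m) y x) (u m x y) (n m x y)) (b2 m x y)).
    unfold b2. cbv beta. change (I1V (Y m) x y) with (I2V (Z m) y x).
    vring. }
  apply (CauV_S _ _ _ X Y); auto.
Qed.
End Picard.

(** * Passage to the limit *)

Definition obox (rho x y : R) : Prop := Rabs x < rho /\ Rabs y < rho.
Lemma obox_box rho x y : obox rho x y -> box rho x y.
Proof. intros [A B]; split; lra. Qed.

Definition limf (g : nat -> R -> R -> R) (x y : R) : R := real (Lim_seq (fun m => g m x y)).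

Lemma half_lt_1 : Rabs (/ 2) < 1.
Proof. rewrite Rabs_pos_eq; lra. Qed.

Lemma gconv_limf rho g : gconv rho g -> exists c, 0 <= c /\ forall x y, box rho x y ->
  is_lim_seq (fun m => g m x y) (limf g x y) /\ Rabs (limf g x y) <= c /\
  forall m, Rabs (g m x y - limf g x y) <= c * (/ 2) ^ m.
Proof.
  intros [c Hc]. exists (2 * Rabs c). split. generalize (Rabs_pos c); lra.
  intros x y Hxy.
  assert (HcR := Rle_abs c). pose proof (Rabs_pos c) as HcP.
  (* The partial geometric sum, with its factor [1 - 2^-p], is what closes the induction on [p]. *)
  assert (T : forall p m, Rabs (g (m + p)%nat x y - g m x y) <= 2 * Rabs c * (/ 2) ^ m * (1 - (/ 2) ^ p)).
  { induction p; intros m.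
    - rewrite Nat.add_0_r, Rminus_diag, Rabs_R0. simpl. lra.
    - replace (m + S p)%nat with (S (m + p)) by lia.
      replace (g (S (m + p)) x y - g m x y) with
        ((g (S (m + p)) x y - g (m + p)%nat x y) + (g (m + p)%nat x y - g m x y)) by ring.
      eapply Rle_trans; [apply Rabs_triang|].
      destruct (Hc (m + p)%nat x y Hxy) as [_ B]. specialize (IHp m).
      rewrite pow_add in B. simpl ((/ 2) ^ S p).
      pose proof (pow_half_pos m). pose proof (pow_half_pos p).
      assert (c * ((/ 2) ^ m * (/ 2) ^ p) <= Rabs c * ((/ 2) ^ m * (/ 2) ^ p)).
      { apply Rmult_le_compat_r; auto. apply Rmult_le_pos; lra. }
      lra. }
  assert (T' : forall p m, Rabs (g (m + p)%nat x y - g m x y) <= 2 * Rabs c * (/ 2) ^ m).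
  { intros. eapply Rle_trans; [apply T|]. pose proof (pow_half_pos m). pose proof (pow_half_pos p).
    assert (0 <= 2 * Rabs c * (/ 2) ^ m) by nra. nra. }
  assert (L : is_lim_seq (fun m => g m x y) (limf g x y)).
  { apply Lim_seq_correct', ex_lim_seq_cauchy_corr. intros eps.
    destruct (proj2 (is_lim_seq_spec _ _) (is_lim_seq_geom (/ 2) half_lt_1)
      (mkposreal (eps / (4 * (Rabs c + 1))) ltac:(apply Rdiv_lt_0_compat; [apply cond_pos|lra]))) as [N HN].
    simpl in HN.
    assert (K : forall n, (N <= n)%nat -> Rabs (g n x y - g N x y) < eps / 2).
    { intros n Hn. replace n with (N + (n - N))%nat by lia. eapply Rle_lt_trans; [apply T'|].
      specialize (HN N ltac:(lia)). rewrite Rminus_0_r, Rabs_pos_eq in HN by (apply Rlt_le, pow_half_pos).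
      assert (2 * (Rabs c + 1) * (/ 2) ^ N < 2 * (Rabs c + 1) * (eps / (4 * (Rabs c + 1)))).
      { apply Rmult_lt_compat_l; lra. }
      replace (2 * (Rabs c + 1) * (eps / (4 * (Rabs c + 1)))) with (eps / 2) in H by (field; lra).
      pose proof (pow_half_pos N). lra. }
    exists N. intros n m Hn Hm.
    replace (g n x y - g m x y) with ((g n x y - g N x y) + - (g m x y - g N x y)) by ring.
    eapply Rle_lt_trans; [apply Rabs_triang|]. rewrite Rabs_Ropp.
    pose proof (K n Hn). pose proof (K m Hm). lra. }
  split; [exact L|split].
  - apply (is_lim_seq_le (fun m => Rabs (g m x y)) (fun _ => 2 * Rabs c) (Rabs (limf g x y)) (2 * Rabs c)).
    intro m. destruct (Hc m x y Hxy). lra.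
    apply (is_lim_seq_abs _ (limf g x y)), L. apply is_lim_seq_const.
  - intros m.
    apply (is_lim_seq_le (fun p => Rabs (g m x y - g (p + m)%nat x y)) (fun _ => 2 * Rabs c * (/ 2) ^ m)
      (Rabs (g m x y - limf g x y)) (2 * Rabs c * (/ 2) ^ m)).
    intro p. rewrite Rabs_minus_sym, Nat.add_comm. apply T'.
    apply (is_lim_seq_abs _ (g m x y - limf g x y)).
    apply is_lim_seq_minus'. apply is_lim_seq_const. now apply -> (is_lim_seq_incr_n (fun p => g p x y)).
    apply is_lim_seq_const.
Qed.

Lemma obox_locally rho x y : obox rho x y -> locally_2d (obox rho) x y.
Proof.
  intros [A B].
  assert (P : 0 < Rmin (rho - Rabs x) (rho - Rabs y)) by (apply Rmin_pos; lra).
  exists (mkposreal _ P). simpl. intros u v Hu Hv.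
  pose proof (Rmin_l (rho - Rabs x) (rho - Rabs y)). pose proof (Rmin_r (rho - Rabs x) (rho - Rabs y)).
  split.
  - replace u with (x + (u - x)) by ring. eapply Rle_lt_trans; [apply Rabs_triang|]. lra.
  - replace v with (y + (v - y)) by ring. eapply Rle_lt_trans; [apply Rabs_triang|]. lra.
Qed.

Lemma half_pow_small c eps : 0 <= c -> 0 < eps -> exists N, forall n, (N <= n)%nat -> c * (/ 2) ^ n < eps.
Proof.
  intros Hc He.
  destruct (proj2 (is_lim_seq_spec _ _) (is_lim_seq_geom (/ 2) half_lt_1)
      (mkposreal (eps / (c + 1)) ltac:(apply Rdiv_lt_0_compat; lra))) as [N HN].
  exists N. intros n Hn. specialize (HN n Hn). simpl in HN.
  pose proof (pow_half_pos n). rewrite Rminus_0_r, Rabs_pos_eq in HN by lra.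
  assert ((c + 1) * (/ 2) ^ n < (c + 1) * (eps / (c + 1))) by (apply Rmult_lt_compat_l; lra).
  replace ((c + 1) * (eps / (c + 1))) with eps in H0 by (field; lra). lra.
Qed.

Lemma limf_cont rho g : (forall m, cont2 (g m)) -> gconv rho g ->
  forall x y, obox rho x y -> continuity_2d_pt (limf g) x y.
Proof.
  intros Hg Hc x y Hxy eps. destruct (gconv_limf _ _ Hc) as (c & Hc0 & H).
  destruct (half_pow_small c (eps / 3) Hc0 ltac:(generalize (cond_pos eps); lra)) as [N HN].
  destruct (Hg N x y (mkposreal (eps / 3) ltac:(generalize (cond_pos eps); lra))) as [d Hd].
  simpl in Hd.
  destruct (obox_locally rho x y Hxy) as [d' Hd'].
  assert (P : 0 < Rmin d d') by (apply Rmin_pos; apply cond_pos).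
  exists (mkposreal _ P). simpl. intros u v Hu Hv.
  pose proof (Rmin_l d d'). pose proof (Rmin_r d d').
  assert (A := Hd u v ltac:(lra) ltac:(lra)).
  assert (B := Hd' u v ltac:(lra) ltac:(lra)).
  destruct (H u v (obox_box _ _ _ B)) as (_ & _ & E1). destruct (H x y (obox_box _ _ _ Hxy)) as (_ & _ & E2).
  specialize (E1 N). specialize (E2 N). specialize (HN N ltac:(lia)).
  replace (limf g u v - limf g x y) with
    (- (g N u v - limf g u v) + ((g N u v - g N x y) + (g N x y - limf g x y))) by ring.
  eapply Rle_lt_trans; [apply Rabs_triang|]. rewrite Rabs_Ropp.
  eapply Rle_lt_trans; [apply Rplus_le_compat_l, Rabs_triang|]. lra.
Qed.

Lemma open_abs_lt rho : open (fun x => Rabs x < rho).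
Proof.
  intros x Hx. destruct (obox_locally rho x x (conj Hx Hx)) as [d Hd]. exists d.
  intros z Hz. apply (Hd z z); exact Hz.
Qed.

(** The estimates hold uniformly on each horizontal line of the box, so derivatives converge
    uniformly and limit and derivative commute. This needs an open interval, whence [obox]. *)
Lemma limf_dx rho g gx : Cau rho 0 g -> Cau rho 0 gx -> (forall m, dx (g m) (gx m)) ->
  forall x y, obox rho x y -> is_derive (fun t => limf g t y) x (limf gx x y).
Proof.
  intros (_ & Hg & _) (Hgx & Hg' & _) D x y [Hx Hy].
  assert (E : forall n t, Derive (fun s => g n s y) t = gx n t y).
  { intros. apply is_derive_unique, D. }
  assert (CV : forall h, gconv rho h -> CVU_dom (fun n t => h n t y) (fun t => Rabs t < rho)).
  { intros h Hh. destruct (gconv_limf _ _ Hh) as (c & Hc0 & H). intros eps.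
    destruct (half_pow_small c eps Hc0 (cond_pos eps)) as [N HN]. exists N. intros n Hn t Ht.
    eapply Rle_lt_trans; [apply H|]. split; lra. auto. }
  unfold limf at 2.
  rewrite <- (Lim_seq_ext (fun m => Derive (fun s => g m s y) x)).
  2: intro; apply E.
  apply (CVU_Derive (fun m t => g m t y) (fun t => Rabs t < rho)); auto.
  - apply open_abs_lt.
  - intros a b t Ha Hb Ht. apply Rabs_lt_between. apply Rabs_lt_between in Ha, Hb. lra.
  - intros n t _. exists (gx n t y). apply D.
  - intros n t _. apply (continuity_pt_ext (fun s => gx n s y)). intro; now rewrite E.
    apply continuity_pt_filterlim. apply (continuity_2d_pt_section1 (gx n)). apply Hgx.
  - intros eps. destruct (CV gx Hg' eps) as [N HN]. exists N. intros n Hn t Ht.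
    rewrite E. rewrite (Lim_seq_ext _ (fun m => gx m t y)). now apply HN. intro; apply E.
Qed.

Lemma limf_dy rho g gy : Cau rho 0 g -> Cau rho 0 gy -> (forall m, dy (g m) (gy m)) ->
  forall x y, obox rho x y -> is_derive (fun t => limf g x t) y (limf gy x y).
Proof.
  intros A B D x y [Hx Hy].
  apply (limf_dx rho (fun m => swap (g m)) (fun m => swap (gy m)) (Cau_swap _ _ _ A) (Cau_swap _ _ _ B)).
  intros m u v; apply D. now split.
Qed.

(** Uniform bounds are recorded with the regularity because they later bound the difference
    quotients on the lattice. *)
Fixpoint Cb (rho : R) (k : nat) (f : R -> R -> R) : Prop :=
  (forall x y, obox rho x y -> continuity_2d_pt f x y) /\
  (exists c, forall x y, obox rho x y -> Rabs (f x y) <= c) /\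
  match k with
  | O => True
  | S k' => exists fx fy : R -> R -> R,
      (forall x y, obox rho x y -> is_derive (fun t => f t y) x (fx x y)) /\
      (forall x y, obox rho x y -> is_derive (fun t => f x t) y (fy x y)) /\
      Cb rho k' fx /\ Cb rho k' fy
  end.

Lemma Cau_0 rho k g : Cau rho k g -> Cau rho 0 g.
Proof. destruct k; intros H; (split; [apply H|split; [apply H|exact I]]). Qed.

Lemma Cau_Cb rho k : forall g, Cau rho k g -> Cb rho k (limf g).
Proof.
  assert (B : forall g, gconv rho g -> exists c, forall x y, obox rho x y -> Rabs (limf g x y) <= c).
  { intros g H. destruct (gconv_limf _ _ H) as (c & _ & Hc). exists c. intros x y Hxy.
    apply Hc. now apply obox_box. }
  induction k; intros g H.
  - destruct H as (H1 & H2 & _). split; [|split]; auto. now apply limf_cont.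
  - destruct H as (H1 & H2 & gx & gy & X & Y & Cx & Cy). split; [|split]; auto. now apply limf_cont.
    exists (limf gx), (limf gy). split; [|split; [|split]]; auto.
    + apply limf_dx; auto. now split. eapply Cau_0; eauto.
    + apply limf_dy; auto. now split. eapply Cau_0; eauto.
Qed.

(** [ex_diff_n] speaks of [Derive], which agrees with the witnesses only inside the box; openness
    makes this agreement local. *)
Lemma Cb_ex_diff_n rho k : forall f x y, Cb rho k f -> obox rho x y -> ex_diff_n f k x y.
Proof.
  induction k; intros f x y H Hxy.
  - split; auto. now apply H.
  - destruct H as (H1 & H2 & fx & fy & X & Y & Cx & Cy). simpl. split; auto.
    split; [|split]; [now exists (fx x y); auto|now exists (fy x y); auto|].
    split.
    + apply (ex_diff_n_ext_loc fx); auto. eapply locally_2d_impl; [|apply obox_locally, Hxy].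
      apply locally_2d_forall. intros u v Huv. symmetry. apply is_derive_unique. auto.
    + apply (ex_diff_n_ext_loc fy); auto. eapply locally_2d_impl; [|apply obox_locally, Hxy].
      apply locally_2d_forall. intros u v Huv. symmetry. apply is_derive_unique. auto.
Qed.

Definition CbV rho k (f : R -> R -> V3) : Prop :=
  Cb rho k (fun x y => c1 (f x y)) /\ Cb rho k (fun x y => c2 (f x y)) /\ Cb rho k (fun x y => c3 (f x y)).
Definition limV (G : vseq) (x y : R) : V3 :=
  (limf (fun m x y => c1 (G m x y)) x y, limf (fun m x y => c2 (G m x y)) x y,
   limf (fun m x y => c3 (G m x y)) x y).

Lemma CauV_CbV rho k G : CauV rho k G -> CbV rho k (limV G).
Proof.
  intros (A & B & C). split; [|split].
  exact (Cau_Cb _ _ _ A). exact (Cau_Cb _ _ _ B). exact (Cau_Cb _ _ _ C).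
Qed.

Lemma limV_dx rho G Gx : CauV rho 0 G -> CauV rho 0 Gx -> (forall m, dxV (G m) (Gx m)) ->
  forall x y, obox rho x y -> vder (fun t => limV G t y) x (limV Gx x y).
Proof.
  intros (A & B & C) (A' & B' & C') D x y Hxy.
  exact (conj (limf_dx _ _ _ A A' (fun m a b => proj1 (D m a b)) x y Hxy)
    (conj (limf_dx _ _ _ B B' (fun m a b => proj1 (proj2 (D m a b))) x y Hxy)
      (limf_dx _ _ _ C C' (fun m a b => proj2 (proj2 (D m a b))) x y Hxy))).
Qed.

Lemma limV_dy rho G Gy : CauV rho 0 G -> CauV rho 0 Gy -> (forall m, dyV (G m) (Gy m)) ->
  forall x y, obox rho x y -> vder (fun t => limV G x t) y (limV Gy x y).
Proof.
  intros (A & B & C) (A' & B' & C') D x y Hxy.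
  exact (conj (limf_dy _ _ _ A A' (fun m a b => proj1 (D m a b)) x y Hxy)
    (conj (limf_dy _ _ _ B B' (fun m a b => proj1 (proj2 (D m a b))) x y Hxy)
      (limf_dy _ _ _ C C' (fun m a b => proj2 (proj2 (D m a b))) x y Hxy))).
Qed.

Definition limat (a : nat -> V3) (l : V3) : Prop :=
  is_lim_seq (fun m => c1 (a m)) (c1 l) /\ is_lim_seq (fun m => c2 (a m)) (c2 l) /\
  is_lim_seq (fun m => c3 (a m)) (c3 l).

Lemma limV_at rho G x y : CauV rho 0 G -> box rho x y -> limat (fun m => G m x y) (limV G x y).
Proof.
  intros (A & B & C) Hxy.
  destruct (gconv_limf _ _ (Cau_gconv _ _ _ A)) as (? & _ & HA).
  destruct (gconv_limf _ _ (Cau_gconv _ _ _ B)) as (? & _ & HB).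
  destruct (gconv_limf _ _ (Cau_gconv _ _ _ C)) as (? & _ & HC).
  split; [apply (HA x y Hxy)|split; [apply (HB x y Hxy)|apply (HC x y Hxy)]].
Qed.

Lemma is_lim_seq_eq (a : nat -> R) (l l' : R) : is_lim_seq a l -> is_lim_seq a l' -> l = l'.
Proof. intros A B. apply is_lim_seq_unique in A. apply is_lim_seq_unique in B. rewrite A in B. now injection B. Qed.
Lemma limat_unique a l l' : limat a l -> limat a l' -> l = l'.
Proof. intros (A & B & C) (A' & B' & C'). apply V3_eq; eapply is_lim_seq_eq; eauto. Qed.
Lemma limat_dot a b l k : limat a l -> limat b k -> is_lim_seq (fun m => dot (a m) (b m)) (dot l k).
Proof.
  intros (A & B & C) (A' & B' & C'). unfold dot.
  apply is_lim_seq_plus'; [apply is_lim_seq_plus'|]; now apply is_lim_seq_mult'.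
Qed.

Lemma limat_tri a b c l k q : limat a l -> limat b k -> limat c q ->
  limat (fun m => tri (a m) (b m) (c m)) (tri l k q).
Proof.
  intros A B (A' & B' & C').
  assert (D : is_lim_seq (fun m => - dot (a m) (b m)) (- dot l k))
    by (apply (is_lim_seq_opp _ (dot l k)); now apply limat_dot).
  split; [|split]; now apply is_lim_seq_mult'.
Qed.

Lemma limat_add a b l k : limat a l -> limat b k -> limat (fun m => vadd (a m) (b m)) (vadd l k).
Proof. intros (A & B & C) (A' & B' & C'). split; [|split]; now apply is_lim_seq_plus'. Qed.
Lemma limat_cross a b l k : limat a l -> limat b k -> limat (fun m => cross (a m) (b m)) (cross l k).
Proof.
  intros (A & B & C) (A' & B' & C'). split; [|split]; apply is_lim_seq_minus'; now apply is_lim_seq_mult'.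
Qed.

Lemma limat_const l : limat (fun _ => l) l.
Proof. split; [|split]; apply is_lim_seq_const. Qed.
Lemma limat_tail a l : limat a l -> limat (fun m => a (S m)) l.
Proof.
  intros (A & B & C). split; [|split]; [now apply -> (is_lim_seq_incr_1 (fun m => c1 (a m)))|
    now apply -> (is_lim_seq_incr_1 (fun m => c2 (a m)))|now apply -> (is_lim_seq_incr_1 (fun m => c3 (a m)))].
Qed.

Lemma limat_nrm a l M : limat a l -> (forall m, nrm (a m) <= M) -> nrm l <= M.
Proof.
  intros (A & B & C) H.
  apply (is_lim_seq_le (fun m => nrm (a m)) (fun _ => M) (nrm l) M); auto.
  unfold nrm. apply is_lim_seq_plus'. apply is_lim_seq_plus'.
  apply (is_lim_seq_abs _ _ A). apply (is_lim_seq_abs _ _ B). apply (is_lim_seq_abs _ _ C).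
  apply is_lim_seq_const.
Qed.

(** * The smooth solution *)

Lemma norm_V3 (w : V3) : norm (w : R * R * R) = sqrt (dot w w).
Proof.
  destruct w as [[a b] c].
  change (sqrt (sqrt (Rabs a ^ 2 + Rabs b ^ 2) ^ 2 + Rabs c ^ 2) = sqrt (a * a + b * b + c * c)).
  rewrite <- (Rsqr_pow2 (sqrt _)), Rsqr_sqrt, !pow2_abs.
  f_equal; ring. pose proof (pow2_ge_0 (Rabs a)). pose proof (pow2_ge_0 (Rabs b)). lra.
Qed.

Lemma on_sphere_dot (w : V3) : on_sphere w <-> dot w w = 1.
Proof.
  unfold on_sphere. rewrite norm_V3. split; intros H.
  - rewrite <- (sqrt_sqrt (dot w w)). rewrite H. ring. unfold dot. nra.
  - rewrite H. apply sqrt_1.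
Qed.

(** Replaces a Gronwall argument: on a small square, an integral inequality with zero data improves
    any bound by the factor 1/2. *)
Lemma halving_zero (D : R -> R -> Prop) (s : R -> R -> R) M0 : 0 <= M0 ->
  (forall x y, D x y -> s x y <= M0) ->
  (forall M, 0 <= M -> (forall x y, D x y -> s x y <= M) -> forall x y, D x y -> s x y <= M / 2) ->
  forall x y, D x y -> s x y <= 0.
Proof.
  intros H0 HM Hs.
  assert (K : forall n x y, D x y -> s x y <= M0 * (/ 2) ^ n).
  { induction n; intros x y Hxy. rewrite pow_O, Rmult_1_r. auto.
    replace (M0 * (/ 2) ^ S n) with (M0 * (/ 2) ^ n / 2) by (simpl; field).
    apply Hs; auto. pose proof (pow_half_pos n). nra. }
  intros x y Hxy. destruct (Rle_or_lt (s x y) 0) as [|N]; auto.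
  destruct (half_pow_small M0 _ H0 N) as [n Hn]. specialize (Hn n (le_n _)).
  specialize (K n x y Hxy). lra.
Qed.

(* The factor 3 comes from applying the mean value theorem componentwise. *)
Lemma vmvt (f df : R -> V3) a b M :
  (forall t, Rmin a b <= t <= Rmax a b -> vder f t (df t) /\ nrm (df t) <= M) ->
  nrm (vsub (f b) (f a)) <= 3 * M * Rabs (b - a).
Proof.
  intros H.
  destruct (mvt (fun t => c1 (f t)) (fun t => c1 (df t)) a b) as [p [Hp Ep]]. intros; apply H; auto.
  destruct (mvt (fun t => c2 (f t)) (fun t => c2 (df t)) a b) as [q [Hq Eq]]. intros; apply H; auto.
  destruct (mvt (fun t => c3 (f t)) (fun t => c3 (df t)) a b) as [r [Hr' Er]]. intros; apply H; auto.
  change (nrm (vsub (f b) (f a))) with (Rabs (c1 (f b) - c1 (f a)) + Rabs (c2 (f b) - c2 (f a)) +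
    Rabs (c3 (f b) - c3 (f a))).
  rewrite Ep, Eq, Er, !Rabs_mult.
  destruct (H p Hp) as [_ P], (H q Hq) as [_ Q], (H r Hr') as [_ R'].
  destruct (nrm_c (df p)) as (P1 & _ & _), (nrm_c (df q)) as (_ & Q1 & _), (nrm_c (df r)) as (_ & _ & R1).
  assert (K : forall z, z <= M -> z * Rabs (b - a) <= M * Rabs (b - a))
    by (intros; apply Rmult_le_compat_r; [apply Rabs_pos|assumption]).
  pose proof (K _ (Rle_trans _ _ _ P1 P)). pose proof (K _ (Rle_trans _ _ _ Q1 Q)).
  pose proof (K _ (Rle_trans _ _ _ R1 R')). lra.
Qed.

Lemma vder_zero (f df : R -> V3) a b :
  (forall t, Rmin a b <= t <= Rmax a b -> vder f t (df t) /\ df t = v0) -> f b = f a.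
Proof.
  intros H. apply nrm_0_eq. apply Rle_trans with (3 * 0 * Rabs (b - a)); [|lra].
  apply (vmvt f df). intros t Ht. destruct (H t Ht) as [A B]. split; auto. rewrite B, nrm_v0. lra.
Qed.

Lemma vsub_eq0 v w : vsub v w = v0 -> v = w.
Proof. intros H. apply nrm_0_eq. rewrite H, nrm_v0. lra. Qed.

Lemma I2V_0 g x : I2V g x 0 = v0.
Proof. unfold I2V, v0. now rewrite !I2_0. Qed.
Lemma I1V_0 g y : I1V g 0 y = v0.
Proof. unfold I1V, v0. now rewrite !I1_0. Qed.

(** Interface to the Picard construction: later arguments use only these properties. [P], [Q], [F]
    are the derivatives of the Gauss map [N] and the surface. *)
Record goursat (n1 n2 : R -> V3) (rho U : R) (f0 : V3) (N P Q F : R -> R -> V3) : Prop := {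
  gN : forall k, CbV rho k N;
  gP : forall k, CbV rho k P;
  gQ : forall k, CbV rho k Q;
  gF : forall k, CbV rho k F;
  gNx : forall x y, obox rho x y -> vder (fun t => N t y) x (P x y);
  gNy : forall x y, obox rho x y -> vder (fun t => N x t) y (Q x y);
  gPy : forall x y, obox rho x y -> vder (fun t => P x t) y (tri (P x y) (Q x y) (N x y));
  gQx : forall x y, obox rho x y -> vder (fun t => Q t y) x (tri (P x y) (Q x y) (N x y));
  gFx : forall x y, obox rho x y -> vder (fun t => F t y) x (cross (P x y) (N x y));
  gFy : forall x y, obox rho x y -> vder (fun t => F x t) y (cross (N x y) (Q x y));
  gN1 : forall x, Rabs x < rho -> N x 0 = n1 x;
  gN2 : forall y, Rabs y < rho -> N 0 y = n2 y;
  gsph : forall x y, obox rho x y -> dot (N x y) (N x y) = 1;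
  gbd : forall x y, obox rho x y -> nrm (N x y) <= U /\ nrm (P x y) <= U /\ nrm (Q x y) <= U;
  gF0 : F 0 0 = f0
}.
Arguments gN {n1 n2 rho U f0 N P Q F}.
Arguments gP {n1 n2 rho U f0 N P Q F}.
Arguments gQ {n1 n2 rho U f0 N P Q F}.
Arguments gF {n1 n2 rho U f0 N P Q F}.
Arguments gNx {n1 n2 rho U f0 N P Q F}.
Arguments gNy {n1 n2 rho U f0 N P Q F}.
Arguments gPy {n1 n2 rho U f0 N P Q F}.
Arguments gQx {n1 n2 rho U f0 N P Q F}.
Arguments gFx {n1 n2 rho U f0 N P Q F}.
Arguments gFy {n1 n2 rho U f0 N P Q F}.
Arguments gN1 {n1 n2 rho U f0 N P Q F}.
Arguments gN2 {n1 n2 rho U f0 N P Q F}.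
Arguments gsph {n1 n2 rho U f0 N P Q F}.
Arguments gbd {n1 n2 rho U f0 N P Q F}.
Arguments gF0 {n1 n2 rho U f0 N P Q F}.

Lemma obox_y0 rho x y t : obox rho x y -> Rmin 0 y <= t <= Rmax 0 y -> obox rho x t.
Proof. intros [A B] H. apply Rmin_Rmax_0 in H. split; lra. Qed.
Lemma obox_x0 rho x y t : obox rho x y -> Rmin 0 x <= t <= Rmax 0 x -> obox rho t y.
Proof. intros [A B] H. apply Rmin_Rmax_0 in H. split; lra. Qed.

Lemma goursat_exists n1 n2 rho U f0 : smoothV n1 -> smoothV n2 -> pic_bound n1 n2 rho U ->
  n1 0 = n2 0 -> (forall t, dot (n1 t) (n1 t) = 1) -> (forall t, dot (n2 t) (n2 t) = 1) ->
  exists N P Q F, goursat n1 n2 rho U f0 N P Q F.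
Proof.
  intros S1 S2 HB E0 Sp1 Sp2.
  pose proof HB as (Hr & HU & Hs & Hb).
  set (G := picG n1 n2). set (u := fun m => picU n1 (G m)). set (v := fun m => picV n2 (G m)).
  set (n := fun m => picN n1 n2 (G m)).
  assert (CG : forall k, CauV rho k G) by exact (picG_CauV n1 n2 rho U S1 S2 HB).
  assert (Cu : forall k, CauV rho k u) by exact (fun k => CauV_u n1 n2 rho U S1 HB k (CG k)).
  assert (Cv : forall k, CauV rho k v) by exact (fun k => CauV_v n1 n2 rho U S2 HB k (CG k)).
  assert (Cn : forall k, CauV rho k n) by exact (fun k => CauV_n n1 n2 rho U S1 S2 HB k (CG k)).
  assert (Du : forall m, dyV (u m) (G m)) by exact (u_dy n1 n2 rho U S1 S2 HB).
  assert (Dv : forall m, dxV (v m) (G m)) by exact (v_dx n1 n2 rho U S1 S2 HB).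
  assert (Dnx : forall m, dxV (n m) (u m)) by exact (n_dx n1 n2 rho U S1 S2 HB).
  assert (Dny : forall m, dyV (n m) (v m)) by exact (n_dy n1 n2 rho U S1 S2 HB).
  assert (Bm : forall m x y, box rho x y -> nrm (u m x y) <= U /\ nrm (v m x y) <= U /\ nrm (n m x y) <= U)
    by exact (pic_bounds n1 n2 rho U S1 S2 HB).
  assert (HGS : forall m x y, G (S m) x y = tri (u m x y) (v m x y) (n m x y)) by reflexivity.
  assert (Hu0 : forall x, (fun m => u m x 0) = (fun _ => dV n1 x)).
  { intro x. apply functional_extensionality; intro m. unfold u, picU. rewrite I2V_0.
    vring. }
  assert (Hn0 : forall y, (fun m => n m 0 y) = (fun _ => n2 y)).
  { intro y. apply functional_extensionality; intro m. unfold n, picN. rewrite I1V_0.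
    vring. }
  clearbody n u v G.
  set (w := fun m x y => cross (n m x y) (v m x y)).
  set (w' := fun m x y => vadd (cross (u m x y) (v m x y)) (cross (n m x y) (G m x y))).
  assert (Cw : forall k, CauV rho k w) by (intro; now apply CauV_cross).
  assert (Cw' : forall k, CauV rho k w') by (intro; apply CauV_add; now apply CauV_cross).
  (* The value that [f_x] must have on the first axis. *)
  set (h := fun (m : nat) (x y : R) => cross (dV n1 x) (n1 x)).
  assert (Ch : forall k, CauV rho k h).
  { intro k. apply CauV_cross; apply CauV_fun1; auto using smoothV_dV. }
  (* The surface is integrated along the first axis and then vertically, so [f_y] is correct by
     construction and [f_x] has to be checked. *)
  set (F := fun m x y => vadd f0 (vadd (I1V (h m) x y) (I2V (w m) x y))).
  set (Fx := fun m x y => vadd (h m x y) (I2V (w' m) x y)).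
  assert (CF : forall k, CauV rho k F).
  { intro k. apply CauV_add. apply CauV_const. apply CauV_add. now apply (CauV_I1 rho k h). now apply (CauV_I2 rho k w). }
  assert (CFx : forall k, CauV rho k Fx).
  { intro k. apply CauV_add; auto. now apply (CauV_I2 rho k w'). }
  assert (Dw : forall m, dxV (w m) (w' m)).
  { intros m x y. exact (vder_cross _ _ _ _ _ (Dnx m x y) (Dv m x y)). }
  assert (DFy : forall m, dyV (F m) (w m)).
  { intros m x y.
    assert (Dh : dyV (I1V (h m)) (I1V (fun _ _ => v0))).
    { apply I1V_dy. apply (CauV_cont rho 0 h), Ch. apply cont2V_const.
      intros a b. exact (vder_const (cross (dV n1 a) (n1 a)) b). }
    eapply vder_eq; [exact (vder_add _ _ _ _ _ (vder_const f0 y)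
      (vder_add _ _ _ _ _ (Dh x y) (I2V_dy _ (CauV_cont rho 0 w m (Cw 0%nat)) x y)))|].
    rewrite I1V_swap. unfold swapV. rewrite I2V_v0. vring. }
  assert (DFx : forall m, dxV (F m) (Fx m)).
  { intros m x y.
    eapply vder_eq; [exact (vder_add _ _ _ _ _ (vder_const f0 x)
      (vder_add _ _ _ _ _ (I1V_dx _ (CauV_cont rho 0 h m (Ch 0%nat)) x y)
        (I2V_dx _ _ (CauV_cont rho 0 w m (Cw 0%nat)) (CauV_cont rho 0 w' m (Cw' 0%nat)) (Dw m) x y)))|].
    unfold Fx. vring. }
  assert (HG : forall x y, box rho x y -> limV G x y = tri (limV u x y) (limV v x y) (limV n x y)).
  { intros x y Hxy. apply (limat_unique (fun m => G (S m) x y)). apply (limat_tail (fun m => G m x y)). now apply (limV_at rho).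
    replace (fun m => G (S m) x y) with (fun m => tri (u m x y) (v m x y) (n m x y))
      by (apply functional_extensionality; intro; now rewrite HGS).
    apply limat_tri; now apply (limV_at rho). }
  assert (Hb0 : forall x, Rabs x < rho -> box rho x 0 /\ box rho 0 x).
  { intros x Hx. unfold box. rewrite Rabs_R0. repeat split; lra. }
  assert (Ho0 : forall x y, obox rho x y -> obox rho x 0).
  { intros x y [A B]. unfold obox. rewrite Rabs_R0. split; lra. }
  assert (dot_der : forall h t, smoothV h -> (forall s, dot (h s) (h s) = 1) -> dot (h t) (dV h t) = 0).
  { intros g t Sg Hg.
    pose proof (smoothV_vder g t Sg) as V.
    pose proof (der_dot g g t _ _ V V) as D. apply is_derive_unique in D.
    rewrite (Derive_ext _ (fun _ => 1)) in D by exact Hg. rewrite Derive_const in D.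
    revert D. generalize (g t) (dV g t). intros. unfold dot in *. lra. }
  assert (P0 : forall x, Rabs x < rho -> limV u x 0 = dV n1 x).
  { intros x Hx. apply (limat_unique (fun m => u m x 0)). apply (limV_at rho); auto. now apply Hb0.
    rewrite Hu0. apply limat_const. }
  assert (N0y : forall y, Rabs y < rho -> limV n 0 y = n2 y).
  { intros y Hy. apply (limat_unique (fun m => n m 0 y)). apply (limV_at rho); auto. now apply Hb0.
    rewrite Hn0. apply limat_const. }
  assert (Nx : forall x y, obox rho x y -> vder (fun t => limV n t y) x (limV u x y)) by (apply limV_dx; auto).
  assert (Ny : forall x y, obox rho x y -> vder (fun t => limV n x t) y (limV v x y)) by (apply limV_dy; auto).
  assert (Py : forall x y, obox rho x y -> vder (fun t => limV u x t) y (tri (limV u x y) (limV v x y) (limV n x y))).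
  { intros x y Hxy. rewrite <- HG by now apply obox_box. revert x y Hxy. apply limV_dy; auto. }
  assert (Qx : forall x y, obox rho x y -> vder (fun t => limV v t y) x (tri (limV u x y) (limV v x y) (limV n x y))).
  { intros x y Hxy. rewrite <- HG by now apply obox_box. revert x y Hxy. apply limV_dx; auto. }
  (* On the first axis both curves have the derivative [dV n1]; they agree at 0 by the common point
     of the data. *)
  assert (N0x : forall x, Rabs x < rho -> limV n x 0 = n1 x).
  { intros x Hx. apply vsub_eq0.
    rewrite (vder_zero (fun t => vsub (limV n t 0) (n1 t)) (fun t => vsub (limV u t 0) (dV n1 t)) 0 x).
    - rewrite E0, N0y by (rewrite Rabs_R0; lra). vring.
    - intros t Ht. assert (Ht' : Rabs t < rho) by (apply Rmin_Rmax_0 in Ht; lra).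
      split.
      + apply (vder_sub (fun t => limV n t 0) n1). apply Nx. split; auto. rewrite Rabs_R0; lra.
        now apply smoothV_vder.
      + rewrite P0 by auto. vring. }
  assert (Bd : forall x y, obox rho x y -> nrm (limV n x y) <= U /\ nrm (limV u x y) <= U /\ nrm (limV v x y) <= U).
  { intros x y Hxy. apply obox_box in Hxy.
    pose proof (fun m => Bm m x y Hxy) as B.
    split; [|split]; eapply limat_nrm; try (apply (limV_at rho); eauto); intro m; apply (B m). }
  assert (HU2 : 1 <= U * U /\ U * U <= U ^ 3) by (simpl; nra).
  assert (smallU2 : 18 * rho * (U * U) <= 1) by nra.
  assert (small1 : 18 * rho <= 1) by nra.
  assert (Sph : forall x y, obox rho x y -> dot (limV n x y) (limV n x y) = 1).
  (* The homogeneous problem for [s] is the pair [s_x = 2 <n, n_x>] and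
     [<n, n_x>_y = - <n_x, n_y> s], with [s = 0] on the second axis and [<n, n_x> = 0] on the
     first. *)
  { set (s := fun x y => dot (limV n x y) (limV n x y) - 1).
    assert (K : forall x y, obox rho x y -> Rabs (s x y) <= 0).
    { apply (halving_zero _ _ (U * U + 1)). nra.
      - intros x y Hxy. unfold s. eapply Rle_trans; [apply Rabs_triang|].
        rewrite Rabs_Ropp, Rabs_R1. apply Rplus_le_compat_r. eapply Rle_trans; [apply nrm_dot|].
        destruct (Bd x y Hxy) as [A _]. apply Rmult_le_compat; auto using nrm_pos.
      - intros M HM0 HM.
        assert (Sx : forall x y, obox rho x y -> Rabs (dot (limV n x y) (limV u x y)) <= rho * (U * U) * M).
        { intros x y Hxy.
          destruct (mvt (fun t => dot (limV n x t) (limV u x t))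
            (fun t => dot (limV v x t) (limV u x t) + dot (limV n x t) (tri (limV u x t) (limV v x t) (limV n x t))) 0 y)
            as [c [Hc Ec]].
          { intros t Ht. apply (der_dot (fun t => limV n x t) (fun t => limV u x t)).
            apply Ny. eapply obox_y0; eauto. apply Py. eapply obox_y0; eauto. }
          assert (Hxc : obox rho x c) by (eapply obox_y0; eauto).
          rewrite P0, N0x in Ec by apply Hxy. rewrite (dot_der n1) in Ec by auto.
          replace (dot (limV n x y) (limV u x y)) with
             (- dot (limV u x c) (limV v x c) * s x c * y).
          2:{ rewrite Rminus_0_r in Ec. rewrite Ec. unfold s.
              vunfold; ring. }
          rewrite !Rabs_mult, Rabs_Ropp. destruct (Bd x c Hxc) as (_ & B1 & B2).
          pose proof (nrm_dot (limV u x c) (limV v x c)) as B3. pose proof (HM x c Hxc) as B4.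
          assert (B5 : nrm (limV u x c) * nrm (limV v x c) <= U * U) by (apply Rmult_le_compat; auto using nrm_pos).
          replace (rho * (U * U) * M) with (U * U * M * rho) by ring.
          apply Rmult_le_compat; [|apply Rabs_pos| |destruct Hxy; lra].
          apply Rmult_le_pos; apply Rabs_pos.
          apply Rmult_le_compat; try apply Rabs_pos; lra. }
        intros x y Hxy.
        destruct (mvt (fun t => s t y) (fun t => 2 * dot (limV n t y) (limV u t y)) 0 x) as [c [Hc Ec]].
        { intros t Ht. unfold s.
          pose proof (Nx t y ltac:(eapply obox_x0; eauto)) as V.
          pose proof (der_dot (fun t => limV n t y) (fun t => limV n t y) t _ _ V V) as D.
          replace (2 * dot (limV n t y) (limV u t y)) with
            ((dot (limV u t y) (limV n t y) + dot (limV n t y) (limV u t y)) - 0)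
            by (generalize (limV n t y) (limV u t y); intros; unfold dot; ring).
          apply (is_derive_minus (fun t => dot (limV n t y) (limV n t y)) (fun _ => 1)). exact D.
          apply (is_derive_const (K := R_AbsRing) 1). }
        assert (s 0 y = 0) by (unfold s; rewrite N0y, Sp2 by apply Hxy; ring).
        rewrite H, !Rminus_0_r in Ec. rewrite Ec, !Rabs_mult, (Rabs_pos_eq 2) by lra.
        pose proof (Sx c y ltac:(eapply obox_x0; eauto)) as B1.
        assert (B2 : Rabs x <= rho) by (destruct Hxy; lra).
        assert (B3 : rho * (U * U) * M <= M / 18).
        { replace (rho * (U * U) * M) with ((18 * rho * (U * U)) * (M / 18)) by field.
          rewrite <- (Rmult_1_l (M / 18)) at 2. apply Rmult_le_compat_r; lra. }
        assert (2 * Rabs (dot (limV n c y) (limV u c y)) * Rabs x <= (2 * (M / 18)) * rho).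
        { apply Rmult_le_compat; try lra. pose proof (Rabs_pos (dot (limV n c y) (limV u c y))). lra. apply Rabs_pos. }
        nra. }
    intros x y Hxy. specialize (K x y Hxy). unfold s in K.
    pose proof (Rabs_pos (dot (limV n x y) (limV n x y) - 1)).
    destruct (Req_dec (dot (limV n x y) (limV n x y) - 1) 0) as [|B]. lra. apply Rabs_pos_lt in B. lra. }
  exists (limV n), (limV u), (limV v), (limV F).
  constructor; auto; try (intro; now apply CauV_CbV).
  - intros x y Hxy.
    (* Compatibility of the two representation formulas: both sides agree on the first axis and have
       y-derivative [n_x] cross [n_y], because [n_xy] is parallel to [n]. *)
    assert (E : limV Fx x y = cross (limV u x y) (limV n x y)).
    { apply vsub_eq0.
      assert (Fy : forall x y, obox rho x y -> vder (fun t => limV Fx x t) y (limV w' x y)).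
      { apply limV_dy; auto. intros m a b.
        eapply vder_eq; [exact (vder_add _ _ _ _ _ (vder_const (cross (dV n1 a) (n1 a)) b)
          (I2V_dy _ (CauV_cont rho 0 w' m (Cw' 0%nat)) a b))|].
        vring. }
      assert (Ew : forall x y, box rho x y -> limV w' x y = cross (limV u x y) (limV v x y)).
      { intros a b Hab. apply (limat_unique (fun m => w' m a b)). now apply (limV_at rho).
        replace (cross (limV u a b) (limV v a b)) with (vadd (cross (limV u a b) (limV v a b)) (cross (limV n a b) (limV G a b))).
        apply limat_add; apply limat_cross; now apply (limV_at rho).
        rewrite HG by auto. vring. }
      assert (E1 : vsub (limV Fx x 0) (cross (limV u x 0) (limV n x 0)) = v0).
      { rewrite P0, N0x by apply Hxy.
        assert (L : limV Fx x 0 = cross (dV n1 x) (n1 x)).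
        { apply (limat_unique (fun m => Fx m x 0)). apply (limV_at rho); auto. apply Hb0, Hxy.
          assert (E2 : (fun m => Fx m x 0) = (fun _ => cross (dV n1 x) (n1 x))).
          { apply functional_extensionality; intro m. unfold Fx, h. rewrite I2V_0.
            vring. }
          rewrite E2. apply limat_const. }
        rewrite L. vring. }
      rewrite <- E1.
      apply (vder_zero (fun t => vsub (limV Fx x t) (cross (limV u x t) (limV n x t)))
        (fun t => vsub (limV w' x t) (vadd (cross (tri (limV u x t) (limV v x t) (limV n x t)) (limV n x t)) (cross (limV u x t) (limV v x t))))).
      intros t Ht. assert (Ht' : obox rho x t) by (eapply obox_y0; eauto).
      split. apply (vder_sub (fun t => limV Fx x t) (fun t => cross (limV u x t) (limV n x t))); auto. apply (vder_cross (fun t => limV u x t) (fun t => limV n x t)); auto.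
      rewrite Ew by now apply obox_box.
      vring. }
    rewrite <- E. revert x y Hxy E. intros x y Hxy _. revert x y Hxy. apply limV_dx; auto.
  - intros x y Hxy.
    assert (E : limV w x y = cross (limV n x y) (limV v x y)).
    { apply (limat_unique (fun m => w m x y)). apply (limV_at rho); auto. now apply obox_box.
      apply limat_cross; apply (limV_at rho); auto; now apply obox_box. }
    rewrite <- E. revert x y Hxy E. intros x y Hxy _. revert x y Hxy. apply limV_dy; auto.
  - apply (limat_unique (fun m => F m 0 0)). apply (limV_at rho); auto. apply Hb0. rewrite Rabs_R0; lra.
    assert (E : (fun m => F m 0 0) = (fun _ => f0)).
    { apply functional_extensionality; intro m. unfold F. rewrite I2V_0, I1V_0. vring. }
    rewrite E. apply limat_const.
Qed.

(** * Smooth K-surfaces: existence and uniqueness *)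

Lemma vder_ext_loc f g t l : locally t (fun s => f s = g s) -> vder g t l -> vder f t l.
Proof.
  intros H.
  assert (K : forall (c : V3 -> R) a, is_derive (fun s => c (g s)) t a -> is_derive (fun s => c (f s)) t a).
  { intros c a. apply is_derive_ext_loc. destruct H as [d Hd]. exists d. intros s Hs. now rewrite (Hd s Hs). }
  intros (A & B & C). exact (conj (K _ _ A) (conj (K _ _ B) (K _ _ C))).
Qed.

Lemma vder_D1 f x y l : vder (fun t => f t y) x l -> D1 f x y = l.
Proof.
  intros (A & B & C). apply is_derive_unique in A, B, C.
  apply V3_eq; [exact A|exact B|exact C].
Qed.

Lemma vder_D2 f x y l : vder (fun t => f x t) y l -> D2 f x y = l.
Proof.
  intros (A & B & C). apply is_derive_unique in A, B, C.
  apply V3_eq; [exact A|exact B|exact C].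
Qed.

Lemma obox_loc1 rho x y : obox rho x y -> locally x (fun t => obox rho t y).
Proof.
  intros H. destruct (open_abs_lt rho x (proj1 H)) as [d Hd]. exists d. intros t Ht.
  split. now apply Hd. apply H.
Qed.

Lemma obox_loc2 rho x y : obox rho x y -> locally y (fun t => obox rho x t).
Proof.
  intros H. destruct (open_abs_lt rho y (proj2 H)) as [d Hd]. exists d. intros t Ht.
  split. apply H. now apply Hd.
Qed.

Lemma locally_mono (P Q : R -> Prop) x : (forall t, P t -> Q t) -> locally x P -> locally x Q.
Proof. intros H [d Hd]. exists d. intros t Ht. auto. Qed.

Lemma CbV_vder rho f : CbV rho 1 f -> exists fx fy, forall x y, obox rho x y ->
  vder (fun t => f t y) x (fx x y) /\ vder (fun t => f x t) y (fy x y).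
Proof.
  intros ((_ & _ & ax & ay & A1 & A2 & _) & (_ & _ & bx & by' & B1 & B2 & _) & (_ & _ & cx & cy & C1 & C2 & _)).
  exists (fun x y => (ax x y, bx x y, cx x y)), (fun x y => (ay x y, by' x y, cy x y)).
  intros x y H. split.
  exact (conj (A1 x y H) (conj (B1 x y H) (C1 x y H))).
  exact (conj (A2 x y H) (conj (B2 x y H) (C2 x y H))).
Qed.

Lemma in_square_obox r rho x y : r < rho -> in_square r x y -> obox rho x y.
Proof. intros H [A B]. split; rewrite Rabs_pos_eq; lra. Qed.

Lemma CbV_smooth rho r f : 0 <= r < rho -> (forall k, CbV rho k f) -> smooth_on_square r f.
Proof.
  intros Hr H. exists (rho - r). split. lra. intros k x y Hx Hy.
  assert (Hxy : obox rho x y) by (split; apply Rabs_lt_between; lra).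
  destruct (H k) as (A & B & C). split; [|split]; eapply Cb_ex_diff_n; eauto.
Qed.

(** A Lagrange identity: the determinant of the first fundamental form is the square of the mixed
    coefficient of the second. With vanishing diagonal coefficients this is curvature -1. *)
Lemma gram_det (N P Q : V3) : dot N N = 1 -> dot N P = 0 -> dot N Q = 0 ->
  dot (cross P N) (cross P N) * dot (cross N Q) (cross N Q) - dot (cross P N) (cross N Q) * dot (cross P N) (cross N Q)
  = dot (cross P Q) N * dot (cross P Q) N.
Proof.
  intros H1 H2 H3.
  assert (E1 : dot (cross P N) (cross P N) = dot P P * dot N N - dot N P * dot N P)
    by (vunfold; ring).
  assert (E2 : dot (cross N Q) (cross N Q) = dot Q Q * dot N N - dot N Q * dot N Q)
    by (vunfold; ring).
  assert (E3 : dot (cross P N) (cross N Q) = dot N P * dot N Q - dot P Q * dot N N)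
    by (vunfold; ring).
  assert (E4 : dot (cross P Q) N * dot (cross P Q) N = dot N N * (dot P P * dot Q Q - dot P Q * dot P Q)
     - dot N P * (dot N P * dot Q Q - dot P Q * dot N Q) + dot N Q * (dot N P * dot P Q - dot P P * dot N Q))
    by (vunfold; ring).
  rewrite E1, E2, E3, E4, H1, H2, H3. ring.
Qed.

Lemma scal_vsc a (v : V3) : scal a v = vsc a v.
Proof. reflexivity. Qed.

(** * Uniqueness of the Gauss map on a closed square *)

Lemma dot_le_nrm v M : 0 <= M -> dot v v <= M * M -> nrm v <= 3 * M.
Proof.
  intros HM H. unfold dot in H. unfold nrm.
  assert (K : forall a, a * a <= M * M -> Rabs a <= M).
  { intros a Ha. apply Rsqr_incr_0; auto using Rabs_pos. unfold Rsqr. rewrite <- Rabs_mult, Rabs_pos_eq by nra. auto. }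
  assert (Rabs (c1 v) <= M) by (apply K; nra).
  assert (Rabs (c2 v) <= M) by (apply K; nra).
  assert (Rabs (c3 v) <= M) by (apply K; nra). lra.
Qed.

Lemma dot_self_nrm v M : nrm v <= M -> dot v v <= M * M.
Proof.
  intros H. pose proof (nrm_dot v v). pose proof (Rle_abs (dot v v)). pose proof (nrm_pos v).
  assert (nrm v * nrm v <= M * M) by (apply Rmult_le_compat; auto). lra.
Qed.

(** The geometric conditions hold only on the closed square, whereas derivatives are two-sided. At
    an end point the quotients taken towards the interior already determine the derivative. *)
Lemma is_derive_const_segment (h : R -> R) r x l c : 0 < r -> 0 <= x <= r -> is_derive h x l ->
  (forall t, 0 <= t <= r -> h t = c) -> l = 0.
Proof.
  intros Hr Hx D Hc. apply is_derive_Reals in D.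
  destruct (Req_dec l 0) as [|Nl]; auto. exfalso.
  destruct (D (Rabs l) (Rabs_pos_lt _ Nl)) as [d Hd].
  pose proof (cond_pos d) as Pd.
  set (k := Rmin d r / 2). assert (Hk : 0 < k /\ k < d /\ k <= r / 2).
  { unfold k. pose proof (Rmin_l d r). pose proof (Rmin_r d r). assert (0 < Rmin d r) by now apply Rmin_pos. lra. }
  assert (T : forall s, s <> 0 -> Rabs s < d -> 0 <= x + s <= r -> False).
  { intros s Hs Hsd Hxs. specialize (Hd s Hs Hsd). rewrite !Hc in Hd by lra.
    replace ((c - c) / s - l) with (- l) in Hd by (field; auto). rewrite Rabs_Ropp in Hd. lra. }
  (* The increment points to the farther end, so that [x + s] stays in the segment. *)
  destruct (Rle_or_lt x (r / 2)).
  - apply (T k). lra. rewrite Rabs_pos_eq; lra. lra.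
  - apply (T (- k)). lra. rewrite Rabs_Ropp, Rabs_pos_eq; lra. lra.
Qed.

Lemma vder_const_segment (h : R -> V3) r x l c : 0 < r -> 0 <= x <= r -> vder h x l ->
  (forall t, 0 <= t <= r -> h t = c) -> l = v0.
Proof.
  intros Hr Hx (A & B & C) H. apply V3_eq.
  - apply (is_derive_const_segment _ r x _ (c1 c) Hr Hx A). intros; now rewrite H.
  - apply (is_derive_const_segment _ r x _ (c2 c) Hr Hx B). intros; now rewrite H.
  - apply (is_derive_const_segment _ r x _ (c3 c) Hr Hx C). intros; now rewrite H.
Qed.

(** Common form of an arbitrary competitor and of the constructed solution, invariant under
    exchanging the coordinates. *)
Record gauss_square (r : R) (n a b : R -> R -> V3) : Prop := {
  gs_unit : forall x y, in_square r x y -> dot (n x y) (n x y) = 1;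
  gs_nx : forall x y, in_square r x y -> vder (fun t => n t y) x (a x y);
  gs_ny : forall x y, in_square r x y -> vder (fun t => n x t) y (b x y);
  gs_ay : forall x y, in_square r x y -> vder (fun t => a x t) y (tri (a x y) (b x y) (n x y));
  gs_bx : forall x y, in_square r x y -> vder (fun t => b t y) x (tri (a x y) (b x y) (n x y))
}.

Lemma tri_comm w p m : tri w p m = tri p w m.
Proof. unfold tri. now rewrite dot_comm. Qed.

Lemma gauss_square_swap r n a b : gauss_square r n a b -> gauss_square r (swapV n) (swapV b) (swapV a).
Proof.
  intros [A B C D E].
  constructor; intros x y [Hx Hy]; pose proof (conj Hy Hx : in_square r y x) as H; unfold swapV; try rewrite tri_comm.
  exact (A y x H). exact (C y x H). exact (B y x H). exact (E y x H). exact (D y x H).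
Qed.

Lemma in_square_seg r x y t : in_square r x y -> Rmin 0 y <= t <= Rmax 0 y -> in_square r x t.
Proof. intros [A B]. rewrite Rmin_left, Rmax_right by lra. unfold in_square. lra. Qed.
Lemma in_square_0 r x y : in_square r x y -> in_square r x 0.
Proof. unfold in_square. lra. Qed.

Lemma gauss_square_orth r n a b : 0 < r -> gauss_square r n a b ->
  forall x y, in_square r x y -> dot (n x y) (a x y) = 0.
Proof.
  intros Hr G x y H. pose proof (gs_nx _ _ _ _ G x y H) as A.
  pose proof (is_derive_const_segment _ r x _ 1 Hr (proj1 H) (der_dot _ _ _ _ _ A A)
    (fun t Ht => gs_unit _ _ _ _ G t y (conj Ht (proj2 H)))) as E.
  cbv beta in E. revert E. generalize (a x y) (n x y). intros; unfold dot in *; lra.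
Qed.

(* The length of [a] is constant in the second direction. *)
Lemma gauss_square_bound r n a b U : 0 < r -> gauss_square r n a b -> 0 <= U ->
  (forall x, 0 <= x <= r -> nrm (a x 0) <= U) -> forall x y, in_square r x y -> nrm (a x y) <= 3 * U.
Proof.
  intros Hr G HU H x y Hxy. apply dot_le_nrm; auto.
  destruct (mvt (fun t => dot (a x t) (a x t)) (fun _ => 0) 0 y) as [c [_ Ec]].
  { intros t Ht. pose proof (in_square_seg _ _ _ _ Hxy Ht) as St.
    pose proof (gs_ay _ _ _ _ G x t St) as A. pose proof (der_dot _ _ _ _ _ A A) as D. cbv beta in D.
    match type of D with is_derive _ _ ?l => replace l with 0 in D; [exact D|] end.
    pose proof (gauss_square_orth _ _ _ _ Hr G x t St) as O. revert O.
    generalize (a x t) (b x t) (n x t). intros p q m O.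
    transitivity (-2 * dot p q * dot m p). rewrite O; ring. vunfold; ring. }
  pose proof (dot_self_nrm _ _ (H x (proj1 Hxy))). lra.
Qed.

Lemma gauss_square_boundary r n a b n' a' b' : 0 < r -> gauss_square r n a b -> gauss_square r n' a' b' ->
  (forall x, 0 <= x <= r -> n x 0 = n' x 0) -> forall x, 0 <= x <= r -> a x 0 = a' x 0.
Proof.
  intros Hr G G' H x Hx. apply vsub_eq0. assert (Sx : in_square r x 0) by (unfold in_square; lra).
  apply (vder_const_segment (fun t => vsub (n t 0) (n' t 0)) r x _ v0 Hr Hx).
  exact (vder_sub _ _ _ _ _ (gs_nx _ _ _ _ G x 0 Sx) (gs_nx _ _ _ _ G' x 0 Sx)).
  intros t Ht. rewrite H by auto. vring.
Qed.

(** Half of the contraction: integrates the equation for [a_y] from the axis. The estimate for [b]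
    is the same after exchanging coordinates. *)
Lemma gauss_square_diff r n a b n' a' b' B M : 0 <= B -> 0 <= M ->
  gauss_square r n a b -> gauss_square r n' a' b' -> (forall x, 0 <= x <= r -> a x 0 = a' x 0) ->
  (forall x y, in_square r x y -> nrm (b x y) <= B /\ nrm (n x y) <= B /\ nrm (a' x y) <= B /\ nrm (b' x y) <= B) ->
  (forall x y, in_square r x y ->
    nrm (vsub (a x y) (a' x y)) + nrm (vsub (b x y) (b' x y)) + nrm (vsub (n x y) (n' x y)) <= M) ->
  forall x y, in_square r x y -> nrm (vsub (a x y) (a' x y)) <= 3 * (B * B * M) * r.
Proof.
  intros HB HM0 G G' H0 HBd HM x y Hxy.
  rewrite <- (vsub_v0 (vsub (a x y) (a' x y))).
  replace v0 with (vsub (a x 0) (a' x 0)) by (rewrite H0 by apply Hxy; vring).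
  apply Rle_trans with (3 * (B * B * M) * Rabs (y - 0)).
  - apply (vmvt (fun t => vsub (a x t) (a' x t)) (fun t => vsub (tri (a x t) (b x t) (n x t)) (tri (a' x t) (b' x t) (n' x t)))).
    intros t Ht. pose proof (in_square_seg _ _ _ _ Hxy Ht) as St.
    split. exact (vder_sub _ _ _ _ _ (gs_ay _ _ _ _ G x t St) (gs_ay _ _ _ _ G' x t St)).
    destruct (HBd x t St) as (B1 & B2 & B3 & B4). specialize (HM x t St).
    eapply Rle_trans; [apply nrm_tri_diff|].
    set (da := nrm (vsub (a x t) (a' x t))) in *. set (db := nrm (vsub (b x t) (b' x t))) in *.
    set (dn := nrm (vsub (n x t) (n' x t))) in *.
    assert (T1 : da * nrm (b x t) * nrm (n x t) <= da * B * B) by (apply nrm_prod; auto; apply Rle_refl).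
    assert (T2 : nrm (a' x t) * db * nrm (n x t) <= B * db * B) by (apply nrm_prod; auto; apply Rle_refl).
    assert (T3 : nrm (a' x t) * nrm (b' x t) * dn <= B * B * dn) by (apply nrm_prod; auto; apply Rle_refl).
    assert (B * B * (da + db + dn) <= B * B * M) by (apply Rmult_le_compat_l; [nra|auto]). lra.
  - destruct Hxy as [_ Hy]. rewrite Rminus_0_r, Rabs_pos_eq by lra. apply Rmult_le_compat_l; [|lra].
    assert (0 <= B * B) by nra. nra.
Qed.

(** With [B = 3 U], the differences of [a] and [b] contribute [27 r U^2 M] each and that of [n] at
    most [3 r U^2 M]. Their sum [57 r U^2 M] must not exceed [M / 2], hence 114. Bounds on the axes
    are required of one solution only; the other inherits them through the common data. *)
Lemma gauss_square_unique r U n a b n' a' b' : 1 <= U -> 0 < r -> 114 * r * (U * U) <= 1 ->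
  gauss_square r n a b -> gauss_square r n' a' b' ->
  (forall x, 0 <= x <= r -> n x 0 = n' x 0 /\ n 0 x = n' 0 x /\ nrm (a' x 0) <= U /\ nrm (b' 0 x) <= U) ->
  forall x y, in_square r x y -> a x y = a' x y /\ b x y = b' x y /\ n x y = n' x y.
Proof.
  intros HU Hr Hs G G' Hbd.
  pose proof (gauss_square_swap _ _ _ _ G) as Gs. pose proof (gauss_square_swap _ _ _ _ G') as Gs'.
  assert (Ha : forall x, 0 <= x <= r -> a x 0 = a' x 0)
    by (apply (gauss_square_boundary r n a b n' a' b'); auto; intros; now apply Hbd).
  assert (Hb : forall y, 0 <= y <= r -> b 0 y = b' 0 y)
    by (apply (gauss_square_boundary r _ (swapV b) _ _ (swapV b') _ Hr Gs Gs'); intros; now apply Hbd).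
  assert (Bd : forall x y, in_square r x y -> nrm (a x y) <= 3 * U /\ nrm (b x y) <= 3 * U /\ nrm (n x y) <= 3 * U /\
    nrm (a' x y) <= 3 * U /\ nrm (b' x y) <= 3 * U /\ nrm (n' x y) <= 3 * U).
  { intros x y H. assert (H' : in_square r y x) by (destruct H; now split).
    assert (N1 : forall m, dot m m = 1 -> nrm m <= 3 * U) by (intros m E; apply dot_le_nrm; [lra|rewrite E; nra]).
    split; [|split; [|split; [|split; [|split]]]].
    - apply (gauss_square_bound r n a b); auto; try lra. intros z Hz. rewrite Ha by auto. now apply Hbd.
    - apply (gauss_square_bound r _ (swapV b) (swapV a) U Hr Gs) with (x := y) (y := x); auto; try lra.
      intros z Hz. unfold swapV. rewrite Hb by auto. now apply Hbd.
    - now apply N1, (gs_unit _ _ _ _ G).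
    - apply (gauss_square_bound r n' a' b'); auto; try lra. intros z Hz. now apply Hbd.
    - apply (gauss_square_bound r _ (swapV b') (swapV a') U Hr Gs') with (x := y) (y := x); auto; try lra.
      intros z Hz. now apply Hbd.
    - now apply N1, (gs_unit _ _ _ _ G'). }
  set (s := fun x y => nrm (vsub (a x y) (a' x y)) + nrm (vsub (b x y) (b' x y)) + nrm (vsub (n x y) (n' x y))).
  assert (Hz : forall x y, in_square r x y -> s x y <= 0).
  (* The a priori bound adds six norms, each at most [3 * U]. *)
  { apply (halving_zero _ _ (18 * U)). lra.
    - intros x y H. destruct (Bd x y H) as (B1 & B2 & B3 & B4 & B5 & B6). unfold s.
      pose proof (nrm_sub (a x y) (a' x y)). pose proof (nrm_sub (b x y) (b' x y)). pose proof (nrm_sub (n x y) (n' x y)). lra.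
    - intros M HM0 HM x y H. assert (H' : in_square r y x) by (destruct H; now split).
      pose proof (gauss_square_diff r n a b n' a' b' (3 * U) M ltac:(lra) HM0 G G' Ha
        (fun x y H => let (_, P) := Bd x y H in ltac:(tauto)) HM x y H) as B1.
      assert (B2 : nrm (vsub (swapV b y x) (swapV b' y x)) <= 3 * (3 * U * (3 * U) * M) * r).
      { apply (gauss_square_diff r _ _ _ _ _ _ (3 * U) M ltac:(lra) HM0 Gs Gs' Hb); auto.
        - intros p q [Hp Hq]. pose proof (Bd q p (conj Hq Hp)). unfold swapV. tauto.
        - intros p q [Hp Hq]. pose proof (HM q p (conj Hq Hp)). unfold swapV, s in *. lra. }
      assert (B3 : nrm (vsub (n x y) (n' x y)) <= 3 * M * r).
      { rewrite <- (vsub_v0 (vsub (n x y) (n' x y))).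
        replace v0 with (vsub (n x 0) (n' x 0))
          by (rewrite (proj1 (Hbd x (proj1 H))); vring).
        apply Rle_trans with (3 * M * Rabs (y - 0)).
        - apply (vmvt (fun t => vsub (n x t) (n' x t)) (fun t => vsub (b x t) (b' x t))). intros t Ht.
          pose proof (in_square_seg _ _ _ _ H Ht) as St.
          split. exact (vder_sub _ _ _ _ _ (gs_ny _ _ _ _ G x t St) (gs_ny _ _ _ _ G' x t St)).
          specialize (HM x t St). unfold s in HM. pose proof (nrm_pos (vsub (a x t) (a' x t))).
          pose proof (nrm_pos (vsub (n x t) (n' x t))). lra.
        - destruct H as [_ Hy]. rewrite Rminus_0_r, Rabs_pos_eq by lra. nra. }
      unfold swapV in B2. unfold s.
      assert (r <= r * (U * U)) by (assert (1 <= U * U) by nra; nra).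
      assert (57 * (r * (U * U)) * M <= M / 2) by nra. nra. }
  intros x y H. specialize (Hz x y H). unfold s in Hz. pose proof (nrm_pos (vsub (a x y) (a' x y))).
  pose proof (nrm_pos (vsub (b x y) (b' x y))). pose proof (nrm_pos (vsub (n x y) (n' x y))).
  split; [|split]; apply nrm_0_eq; lra.
Qed.

(** * The Goursat solution is the unique K-surface with its data *)

Section Goursat_K.
Context (n1 n2 : R -> V3) (rho U : R) (f0 : V3) (N P Q F : R -> R -> V3)
  (HG : goursat n1 n2 rho U f0 N P Q F).

Lemma goursat_gauss_square r : 0 <= r < rho -> gauss_square r N P Q.
Proof.
  intros Hr. assert (Hin : forall x y, in_square r x y -> obox rho x y) by (intros x y; apply in_square_obox; lra).
  constructor; intros x y H; apply Hin in H.
  now apply (gsph HG). now apply (gNx HG). now apply (gNy HG). now apply (gPy HG). now apply (gQx HG).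
Qed.

Lemma goursat_D x y : obox rho x y -> D1 N x y = P x y /\ D2 N x y = Q x y /\
  D1 F x y = cross (P x y) (N x y) /\ D2 F x y = cross (N x y) (Q x y).
Proof.
  intros H. split; [|split; [|split]].
  apply vder_D1, (gNx HG); auto. apply vder_D2, (gNy HG); auto.
  apply vder_D1, (gFx HG); auto. apply vder_D2, (gFy HG); auto.
Qed.

Lemma goursat_K_surface r : 0 < r < rho -> K_surface_with_data n1 n2 r F N.
Proof.
  intros Hr.
  assert (Hin : forall x y, in_square r x y -> obox rho x y) by (intros x y; apply in_square_obox; lra).
  destruct (CbV_vder rho P (gP HG 1%nat)) as (Px & Py & HP).
  destruct (CbV_vder rho Q (gQ HG 1%nat)) as (Qx & Qy & HQ).
  assert (H12 : forall x y, obox rho x y -> D1 (D2 N) x y = vsc (- dot (P x y) (Q x y)) (N x y)).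
  { intros x y H. apply vder_D1. apply (vder_ext_loc _ (fun t => Q t y)); [|now apply (gQx HG)].
    eapply locally_mono; [|apply obox_loc1, H]. intros t Ht. now apply goursat_D. }
  assert (HL : forall x y, obox rho x y -> fundL F N x y = 0).
  { intros x y H. unfold fundL.
    rewrite (vder_D1 (D1 F) x y (vadd (cross (Px x y) (N x y)) (cross (P x y) (P x y)))).
    vunfold; ring.
    apply (vder_ext_loc _ (fun t => cross (P t y) (N t y))).
    eapply locally_mono; [|apply obox_loc1, H]. intros t Ht. now apply goursat_D.
    apply (vder_cross (fun t => P t y) (fun t => N t y)). now apply HP. now apply (gNx HG). }
  assert (HN : forall x y, obox rho x y -> fundN F N x y = 0).
  { intros x y H. unfold fundN.
    rewrite (vder_D2 (D2 F) x y (vadd (cross (Q x y) (Q x y)) (cross (N x y) (Qy x y)))).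
    vunfold; ring.
    apply (vder_ext_loc _ (fun t => cross (N x t) (Q x t))).
    eapply locally_mono; [|apply obox_loc2, H]. intros t Ht. now apply goursat_D.
    apply (vder_cross (fun t => N x t) (fun t => Q x t)). now apply (gNy HG). now apply HQ. }
  (* Differentiating [f_y] in x, the term with [N_xy] vanishes since [N_xy] is a multiple of [N]. *)
  assert (HM : forall x y, obox rho x y -> fundM F N x y = dot (cross (P x y) (Q x y)) (N x y)).
  { intros x y H. unfold fundM.
    rewrite (vder_D1 (D2 F) x y (vadd (cross (P x y) (Q x y)) (cross (N x y) (vsc (- dot (P x y) (Q x y)) (N x y))))).
    vunfold; ring.
    apply (vder_ext_loc _ (fun t => cross (N t y) (Q t y))).
    eapply locally_mono; [|apply obox_loc1, H]. intros t Ht. now apply goursat_D.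
    apply (vder_cross (fun t => N t y) (fun t => Q t y)). now apply (gNx HG).
    now apply (gQx HG). }
  split; [constructor|split].
  - apply (CbV_smooth rho); [lra|]. apply (gF HG).
  - apply (CbV_smooth rho); [lra|]. apply (gN HG).
  - intros x y H. apply on_sphere_dot. apply (gsph HG); auto.
  - intros x y H. destruct (goursat_D x y (Hin x y H)) as (_ & _ & -> & ->).
    vunfold; split; ring.
  - intros x y H. split; auto.
  - intros x y H Hd. unfold gauss_curvature. rewrite HL, HN, HM by auto. unfold det_I, fundE, fundF, fundG in *.
    destruct (goursat_D x y (Hin x y H)) as (_ & _ & E1 & E2). rewrite E1, E2 in *.
    pose proof (goursat_gauss_square r ltac:(lra)) as GS.
    pose proof (gauss_square_orth _ _ _ _ (proj1 Hr) GS x y H) as O1.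
    pose proof (gauss_square_orth _ _ _ _ (proj1 Hr) (gauss_square_swap _ _ _ _ GS) y x (conj (proj2 H) (proj1 H))) as O2.
    unfold swapV in O2.
    rewrite (gram_det _ _ _ (gsph HG x y (Hin x y H)) O1 O2) in *.
    (* By [gram_det] numerator and denominator are opposite; a zero of the mixed coefficient would
       make the first form degenerate. *)
    field. intros E. apply Hd. rewrite E. ring.
  - intros x y H. rewrite H12 by auto. unfold q12. destruct (goursat_D x y (Hin x y H)) as (-> & -> & _ & _).
    reflexivity.
  - intros x y H. destruct (goursat_D x y (Hin x y H)) as (-> & -> & -> & ->). auto.
  - intros x Hx. apply (gN1 HG). rewrite Rabs_pos_eq; lra.
  - intros y Hy. apply (gN2 HG). rewrite Rabs_pos_eq; lra.
Qed.
End Goursat_K.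

(** Schwarz's theorem identifies the mixed derivatives, so that [D1 (D2 f)] is also the y-derivative
    of [D1 f], as the equation for the Gauss map requires. *)
Lemma smooth_vder r f : smooth_on_square r f -> exists d, 0 < d /\
  forall x y, - d < x < r + d -> - d < y < r + d ->
   vder (fun t => f t y) x (D1 f x y) /\ vder (fun t => f x t) y (D2 f x y) /\
   vder (fun t => D1 f x t) y (D1 (D2 f) x y) /\ vder (fun t => D2 f t y) x (D1 (D2 f) x y).
Proof.
  intros [d [Hd H]]. exists d. split; auto. intros x y Hx Hy.
  assert (K : forall g : R -> R -> R, (forall (k : nat) (x y : R), - d < x < r + d -> - d < y < r + d -> ex_diff_n g k x y) ->
    is_derive (fun t => g t y) x (Derive (fun t => g t y) x) /\
    is_derive (fun t => g x t) y (Derive (fun t => g x t) y) /\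
    is_derive (fun t => Derive (fun s => g s t) x) y (Derive (fun t => Derive (fun s => g t s) y) x) /\
    is_derive (fun t => Derive (fun s => g t s) y) x (Derive (fun t => Derive (fun s => g t s) y) x)).
  { intros g Hg. pose proof (Hg 2%nat x y Hx Hy) as H2. simpl in H2.
    destruct H2 as (_ & E1 & E2 & (_ & _ & E3 & _ & (C3 & _)) & (_ & E4 & _ & (C4 & _) & _)).
    assert (Sw : Derive (fun z => Derive (fun t => g z t) y) x = Derive (fun z => Derive (fun t => g t z) x) y).
    { apply (Schwarz g x y).
      - assert (P0 : 0 < Rmin (Rmin (x + d) (r + d - x)) (Rmin (y + d) (r + d - y)))
          by (repeat apply Rmin_pos; lra).
        exists (mkposreal _ P0). simpl. intros u v Hu Hv.
        pose proof (Rmin_l (Rmin (x + d) (r + d - x)) (Rmin (y + d) (r + d - y))).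
        pose proof (Rmin_r (Rmin (x + d) (r + d - x)) (Rmin (y + d) (r + d - y))).
        pose proof (Rmin_l (x + d) (r + d - x)). pose proof (Rmin_r (x + d) (r + d - x)).
        pose proof (Rmin_l (y + d) (r + d - y)). pose proof (Rmin_r (y + d) (r + d - y)).
        apply Rabs_lt_between in Hu, Hv.
        pose proof (Hg 2%nat u v ltac:(lra) ltac:(lra)) as HH. simpl in HH.
        destruct HH as (_ & ? & ? & (_ & _ & ? & _) & (_ & ? & _)). auto.
      - exact C4.
      - exact C3. }
    split; [|split; [|split]].
    - now apply Derive_correct.
    - now apply Derive_correct.
    - rewrite Sw. now apply Derive_correct.
    - now apply Derive_correct. }
  destruct (K (fun x y => c1 (f x y))) as (A1 & A2 & A3 & A4). intros; now apply H.
  destruct (K (fun x y => c2 (f x y))) as (B1 & B2 & B3 & B4). intros; now apply H.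
  destruct (K (fun x y => c3 (f x y))) as (C1 & C2 & C3 & C4). intros; now apply H.
  split; [|split; [|split]].
  exact (conj A1 (conj B1 C1)). exact (conj A2 (conj B2 C2)).
  exact (conj A3 (conj B3 C3)). exact (conj A4 (conj B4 C4)).
Qed.

Lemma K_gauss_square r f n : K_surface r f n -> gauss_square r n (D1 n) (D2 n).
Proof.
  intros HK. destruct (smooth_vder r n (K_gauss_smooth _ _ _ HK)) as (d & Hd & HV).
  assert (E : forall x y, in_square r x y -> D1 (D2 n) x y = tri (D1 n x y) (D2 n x y) (n x y))
    by (intros x y H; rewrite (K_gauss_equation _ _ _ HK) by auto; reflexivity).
  constructor; intros x y H; try (rewrite <- E by auto); destruct (H) as [Hx Hy];
    destruct (HV x y ltac:(lra) ltac:(lra)) as (A & B & C & D); auto.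
  now apply on_sphere_dot, (K_gauss_unit _ _ _ HK).
Qed.

(** Once the Gauss maps agree, the representation formulas make both first derivatives of the
    difference of the surfaces vanish; it is followed from the origin along the axis and then
    upward. *)
Lemma goursat_unique n1 n2 rho U f0 N P Q F r f' n' : goursat n1 n2 rho U f0 N P Q F ->
  1 <= U -> 0 < r < rho -> 114 * r * (U * U) <= 1 ->
  K_surface_with_data n1 n2 r f' n' -> f' 0 0 = f0 ->
  forall x y, in_square r x y -> f' x y = F x y /\ n' x y = N x y.
Proof.
  intros HG HU Hr Hs (HK & Hd1 & Hd2) Hf0.
  destruct (smooth_vder r f' (K_smooth _ _ _ HK)) as (d & Hd & HVf).
  assert (Hin : forall x y, in_square r x y -> obox rho x y) by (intros x y; apply in_square_obox; lra).
  assert (EqN : forall x y, in_square r x y -> D1 n' x y = P x y /\ D2 n' x y = Q x y /\ n' x y = N x y).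
  { apply (gauss_square_unique r U n' _ _ N P Q HU (proj1 Hr) Hs (K_gauss_square _ _ _ HK)
      (goursat_gauss_square _ _ _ _ _ _ _ _ _ HG r ltac:(lra))).
    intros x Hx.
    assert (A : obox rho x 0 /\ obox rho 0 x) by (unfold obox; rewrite Rabs_R0, Rabs_pos_eq; lra).
    rewrite Hd1, Hd2, (gN1 HG), (gN2 HG) by (auto; apply A).
    pose proof (gbd HG x 0 (proj1 A)). pose proof (gbd HG 0 x (proj2 A)). tauto. }
  assert (HF : forall x y, in_square r x y ->
     vder (fun t => vsub (f' t y) (F t y)) x v0 /\ vder (fun t => vsub (f' x t) (F x t)) y v0).
  { intros x y H. destruct (EqN x y H) as (E1 & E2 & E3).
    destruct (K_representation _ _ _ HK x y H) as [R1 R2].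
    pose proof (Hin x y H) as Ho. destruct H as [Hx Hy]. destruct (HVf x y ltac:(lra) ltac:(lra)) as (V1 & V2 & _).
    rewrite R1, E1, E3 in V1. rewrite R2, E2, E3 in V2.
    split; (eapply vder_eq; [eapply vder_sub; [eassumption|]|]).
    exact (gFx HG x y Ho). vring.
    exact (gFy HG x y Ho). vring. }
  intros x y H. split; [|now apply EqN]. apply vsub_eq0.
  rewrite (vder_zero (fun t => vsub (f' x t) (F x t)) (fun _ => v0) 0 y).
  rewrite (vder_zero (fun t => vsub (f' t 0) (F t 0)) (fun _ => v0) 0 x).
  - rewrite Hf0, (gF0 HG). vring.
  - intros t Ht. split; [|reflexivity]. apply in_square_0 in H. destruct H as [Hx Hy].
    destruct (in_square_seg r 0 x t (conj Hy Hx) Ht) as [Hy' Ht'].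
    exact (proj1 (HF t 0 (conj Ht' Hy'))).
  - intros t Ht. split; [|reflexivity]. exact (proj2 (HF x t (in_square_seg r x y t H Ht))).
Qed.

(** * Discrete K-surfaces: existence and uniqueness *)

Definition kstep (n na nb : V3) : V3 :=
  vsub (vsc (dot n (vadd na nb) / (1 + dot na nb)) (vadd na nb)) n.

(** The inner recursion runs along one line of the lattice, the outer one from line to line. The
    corner takes its value from [n2], so agreement with [n1] there uses the common point. *)
Fixpoint dN (n1 n2 : R -> V3) (eps : R) (i : nat) : nat -> V3 :=
  match i with
  | O => fun j => n2 (eps * INR j)
  | S i' => fix row (j : nat) : V3 :=
      match j with
      | O => n1 (eps * INR (S i'))
      | S j' => kstep (dN n1 n2 eps i' j') (row j') (dN n1 n2 eps i' (S j'))
      end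
  end.

Fixpoint dF0 (n1 n2 : R -> V3) (eps : R) (f0 : V3) (i : nat) : V3 :=
  match i with
  | O => f0
  | S i' => vadd (dF0 n1 n2 eps f0 i') (cross (dN n1 n2 eps (S i') 0) (dN n1 n2 eps i' 0))
  end.
(** Summation along the first axis and then upward; the remaining equation in the first direction is
    path independence. *)
Fixpoint dF (n1 n2 : R -> V3) (eps : R) (f0 : V3) (i j : nat) : V3 :=
  match j with
  | O => dF0 n1 n2 eps f0 i
  | S j' => vadd (dF n1 n2 eps f0 i j') (cross (dN n1 n2 eps i j') (dN n1 n2 eps i (S j')))
  end.

Definition dist2 (v w : V3) : R := dot (vsub v w) (vsub v w).

Lemma dist2_sphere v w : dot v v = 1 -> dot w w = 1 -> dist2 v w = 2 - 2 * dot v w.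
Proof.
  intros A B. unfold dist2. replace (dot (vsub v w) (vsub v w)) with (dot v v + dot w w - 2 * dot v w)
    by (vunfold; ring). lra.
Qed.

(** Bounds the diagonal of a lattice square by its two edges at a common vertex; a short diagonal
    keeps the denominator of [kstep] away from zero. *)
Lemma dist2_tri u v w : dist2 u w <= 2 * dist2 u v + 2 * dist2 w v.
Proof.
  unfold dist2, dot, vsub, c1, c2, c3; simpl.
  assert (K : forall a b c : R, (a - c) * (a - c) <= 2 * ((a - b) * (a - b)) + 2 * ((c - b) * (c - b)))
    by (intros a b c; pose proof (Rle_0_sqr ((a - b) + (c - b))); unfold Rsqr in *; nra).
  pose proof (K (fst (fst u)) (fst (fst v)) (fst (fst w))).
  pose proof (K (snd (fst u)) (snd (fst v)) (snd (fst w))).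
  pose proof (K (snd u) (snd v) (snd w)). lra.
Qed.

Lemma dot_add_l a b c : dot (vadd a b) c = dot a c + dot b c.
Proof. vunfold; ring. Qed.
Lemma dot_sub_l a b c : dot (vsub a b) c = dot a c - dot b c.
Proof. vunfold; ring. Qed.
Lemma dot_sc_l a b c : dot (vsc a b) c = a * dot b c.
Proof. vunfold; ring. Qed.

(* The step is the half-turn about [na + nb], which swaps [na] and [nb]: this
   is why the edges of a lattice square keep their lengths. *)
Lemma kstep_props n na nb : dot n n = 1 -> dot na na = 1 -> dot nb nb = 1 -> 1 + dot na nb <> 0 ->
  dot (kstep n na nb) (kstep n na nb) = 1 /\ dot (kstep n na nb) na = dot n nb /\
  dot (kstep n na nb) nb = dot n na.
Proof.
  intros A B C D. unfold kstep.
  assert (Es : dot n (vadd na nb) = dot n na + dot n nb) by (rewrite dot_comm, dot_add_l, (dot_comm na), (dot_comm nb); ring).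
  assert (E1 : forall v, dot (vsub (vsc (dot n (vadd na nb) / (1 + dot na nb)) (vadd na nb)) n) v =
     (dot n na + dot n nb) / (1 + dot na nb) * (dot na v + dot nb v) - dot n v)
    by (intro; rewrite dot_sub_l, dot_sc_l, dot_add_l, Es; ring).
  set (m := vsub _ n) in *.
  assert (Ea : dot m na = dot n nb) by (rewrite E1, B, (dot_comm nb na); field; auto).
  assert (Eb : dot m nb = dot n na) by (rewrite E1, C; field; auto).
  split; [|split]; auto.
  rewrite E1, (dot_comm na m), (dot_comm nb m), (dot_comm n m), Ea, Eb, E1, A, (dot_comm na n), (dot_comm nb n).
  ring.
Qed.

Section Lattice.
Context (n1 n2 : R -> V3) (eps : R) (He : 0 < eps).
Let N := dN n1 n2 eps.

Lemma dN_SS i j : N (S i) (S j) = kstep (N i j) (N (S i) j) (N i (S j)).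
Proof. reflexivity. Qed.
Lemma dN_i0 i : n1 0 = n2 0 -> N i 0 = n1 (eps * INR i).
Proof. intros H. destruct i; [|reflexivity]. unfold N; simpl. rewrite Rmult_0_r; auto. Qed.
Lemma dN_0j j : N 0 j = n2 (eps * INR j).
Proof. reflexivity. Qed.

Lemma kstep_add i j : vadd (N (S i) (S j)) (N i j) =
  vsc (dot (N i j) (vadd (N (S i) j) (N i (S j))) / (1 + dot (N (S i) j) (N i (S j)))) (vadd (N (S i) j) (N i (S j))).
Proof.
  rewrite dN_SS. unfold kstep. generalize (N i j) (N (S i) j) (N i (S j)). intros a b c.
  vring.
Qed.

Lemma Rmult_INR_S_le (i : nat) R0 : eps * INR (S i) <= R0 -> eps * INR i <= R0.
Proof. rewrite S_INR. nra. Qed.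

(** A new vertex lies on the sphere only if the denominator is nonzero, which in turn needs short
    edges between points of the sphere; so both are carried along together. Opposite edges have
    equal length, so the bound does not deteriorate with the number of steps. *)
Lemma dN_invariant R0 L : n1 0 = n2 0 -> 2 * (L * eps) * (L * eps) <= 1 ->
  (forall t, dot (n1 t) (n1 t) = 1) -> (forall t, dot (n2 t) (n2 t) = 1) ->
  (forall k, eps * INR (S k) <= R0 -> dist2 (n1 (eps * INR (S k))) (n1 (eps * INR k)) <= (L * eps) * (L * eps)) ->
  (forall k, eps * INR (S k) <= R0 -> dist2 (n2 (eps * INR (S k))) (n2 (eps * INR k)) <= (L * eps) * (L * eps)) ->
  forall i j, eps * INR i <= R0 -> eps * INR j <= R0 ->
   dot (N i j) (N i j) = 1 /\
   (eps * INR (S i) <= R0 -> dist2 (N (S i) j) (N i j) <= (L * eps) * (L * eps)) /\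
   (eps * INR (S j) <= R0 -> dist2 (N i (S j)) (N i j) <= (L * eps) * (L * eps)).
Proof.
  intros H0 HL Sp1 Sp2 H1 H2.
  set (A := fun i => forall j, eps * INR j <= R0 -> dot (N i j) (N i j) = 1 /\
      (eps * INR (S j) <= R0 -> dist2 (N i (S j)) (N i j) <= (L * eps) * (L * eps))).
  (* [A i] controls the vertices and edges within line [i]; this handles the edges from there to the
     next line. *)
  assert (B : forall i, eps * INR (S i) <= R0 -> A i ->
     forall j, eps * INR j <= R0 -> dot (N (S i) j) (N (S i) j) = 1 /\
       dist2 (N (S i) j) (N i j) <= (L * eps) * (L * eps)).
  { intros i Hi HA. induction j; intros Hj.
    - rewrite !dN_i0 by auto. split; auto.
    - pose proof (Rmult_INR_S_le _ _ Hj) as Hj'. destruct (IHj Hj') as [S1 D1].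
      destruct (HA j Hj') as [S2 D2]. specialize (D2 Hj). destruct (HA (S j) Hj) as [S3 _].
      pose proof (dist2_tri (N (S i) j) (N i j) (N i (S j))) as T.
      rewrite (dist2_sphere (N (S i) j) (N i (S j))) in T by auto.
      destruct (kstep_props (N i j) (N (S i) j) (N i (S j)) S2 S1 S3 ltac:(lra)) as (P1 & P2 & P3).
      rewrite dN_SS. split; auto.
      rewrite dist2_sphere by auto. rewrite P3. rewrite dist2_sphere in D1 by auto.
      rewrite (dot_comm (N i j)). auto. }
  assert (C : forall i, eps * INR i <= R0 -> A i).
  { induction i; intros Hi.
    - intros j Hj. rewrite !dN_0j. split; auto.
    - pose proof (Rmult_INR_S_le _ _ Hi) as Hi'. specialize (IHi Hi').
      intros j Hj. split. now apply B.
      intros Hj'.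
      destruct (B i Hi IHi j Hj) as [S1 D1]. destruct (IHi j Hj) as [S2 D2]. specialize (D2 Hj').
      destruct (IHi (S j) Hj') as [S3 _].
      pose proof (dist2_tri (N (S i) j) (N i j) (N i (S j))) as T.
      rewrite (dist2_sphere (N (S i) j) (N i (S j))) in T by auto.
      destruct (kstep_props (N i j) (N (S i) j) (N i (S j)) S2 S1 S3 ltac:(lra)) as (P1 & P2 & P3).
      rewrite dN_SS.
      rewrite dist2_sphere by auto. rewrite P2. rewrite dist2_sphere in D2 by auto.
      rewrite (dot_comm (N i j)). auto. }
  intros i j Hi Hj. split; [|split].
  - now apply C.
  - intros Hi'. apply B; auto.
  - now apply C.
Qed.

(** The sum around a lattice square closes because [tau_1 tau_2 n + n] is parallel to
    [tau_1 n + tau_2 n], so their cross product vanishes. *)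
Lemma dF_step1 f0 i j : n1 0 = n2 0 ->
  dF n1 n2 eps f0 (S i) j = vadd (dF n1 n2 eps f0 i j) (cross (N (S i) j) (N i j)).
Proof.
  intros H0. induction j. reflexivity.
  change (dF n1 n2 eps f0 (S i) (S j)) with (vadd (dF n1 n2 eps f0 (S i) j) (cross (N (S i) j) (N (S i) (S j)))).
  change (dF n1 n2 eps f0 i (S j)) with (vadd (dF n1 n2 eps f0 i j) (cross (N i j) (N i (S j)))).
  rewrite IHj. pose proof (kstep_add i j) as E.
  set (a := _ / _) in E. clearbody a. revert E.
  generalize (N (S i) (S j)) (N i j) (N (S i) j) (N i (S j)) (dF n1 n2 eps f0 i j).
  intros m n na nb f E.
  assert (Em : m = vsub (vsc a (vadd na nb)) n) by (rewrite <- E; vring).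
  rewrite Em. vring.
Qed.

Lemma in_grid_S1 r i j : in_grid eps r (S i) j -> in_grid eps r i j.
Proof.
  intros [[A B] C]. split; auto. pose proof (pos_INR i). split. nra. now apply Rmult_INR_S_le.
Qed.

Lemma in_grid_S2 r i j : in_grid eps r i (S j) -> in_grid eps r i j.
Proof.
  intros [C [A B]]. split; auto. pose proof (pos_INR j). split. nra. now apply Rmult_INR_S_le.
Qed.

Lemma difference_quotient_iff (u v w : V3) : scal (/ eps) (minus u v) = vsc (/ eps) w <-> u = vadd v w.
Proof.
  assert (E : scal (/ eps) (minus u v) = vsc (/ eps) (vsub u v)) by reflexivity.
  assert (K : forall z, vsc eps (vsc (/ eps) z) = z)
    by (intro; vfield; lra).
  rewrite E. split; intros H.
  - apply (f_equal (vsc eps)) in H. rewrite !K in H. rewrite <- H. vring.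
  - rewrite H. vring.
Qed.

Lemma delta_cross1 (f n : lattice_fun) i j :
  delta1 eps f i j = cross (delta1 eps n i j) (n i j) <->
  f (S i) j = vadd (f i j) (cross (n (S i) j) (n i j)).
Proof.
  rewrite <- difference_quotient_iff. unfold delta1, tau1.
  change (scal (/ eps) (minus (n (S i) j) (n i j))) with (vsc (/ eps) (vsub (n (S i) j) (n i j))).
  replace (vsc (/ eps) (cross (n (S i) j) (n i j))) with (cross (vsc (/ eps) (vsub (n (S i) j) (n i j))) (n i j)).
  reflexivity. vring.
Qed.

Lemma delta_cross2 (f n : lattice_fun) i j :
  delta2 eps f i j = cross (n i j) (delta2 eps n i j) <->
  f i (S j) = vadd (f i j) (cross (n i j) (n i (S j))).
Proof.
  rewrite <- difference_quotient_iff. unfold delta2, tau2.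
  change (scal (/ eps) (minus (n i (S j)) (n i j))) with (vsc (/ eps) (vsub (n i (S j)) (n i j))).
  replace (vsc (/ eps) (cross (n i j) (n i (S j)))) with (cross (n i j) (vsc (/ eps) (vsub (n i (S j)) (n i j)))).
  reflexivity. vring.
Qed.

Lemma plus_vadd (v w : V3) : plus v w = vadd v w.
Proof. reflexivity. Qed.

Lemma canonical_exists r R0 L f0 : r <= R0 -> n1 0 = n2 0 -> 2 * (L * eps) * (L * eps) <= 1 ->
  (forall t, dot (n1 t) (n1 t) = 1) -> (forall t, dot (n2 t) (n2 t) = 1) ->
  (forall k, eps * INR (S k) <= R0 -> dist2 (n1 (eps * INR (S k))) (n1 (eps * INR k)) <= (L * eps) * (L * eps)) ->
  (forall k, eps * INR (S k) <= R0 -> dist2 (n2 (eps * INR (S k))) (n2 (eps * INR k)) <= (L * eps) * (L * eps)) ->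
  canonical_discrete_K_surface n1 n2 eps r (dF n1 n2 eps f0) N.
Proof.
  intros Hr H0 HL Sp1 Sp2 H1 H2.
  pose proof (dN_invariant R0 L H0 HL Sp1 Sp2 H1 H2) as Inv.
  constructor.
  - intros i j [Hi Hj]. apply on_sphere_dot. apply Inv; lra.
  - intros i _. now apply dN_i0.
  - reflexivity.
  - intros i j [Hi Hj]. split.
    + pose proof (Rmult_INR_S_le i R0 ltac:(lra)) as Hi'. pose proof (Rmult_INR_S_le j R0 ltac:(lra)) as Hj'.
      destruct (Inv i j Hi' Hj') as (_ & D1 & D2). specialize (D1 ltac:(lra)). specialize (D2 ltac:(lra)).
      pose proof (dist2_tri (N (S i) j) (N i j) (N i (S j))) as T.
      rewrite dist2_sphere in T; [|apply Inv; lra|apply Inv; lra].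
      unfold tau1, tau2. lra.
    + unfold a12, tau1, tau2. rewrite !plus_vadd. apply kstep_add.
  - intros i j _. apply delta_cross1. now apply dF_step1.
  - intros i j _. apply delta_cross2. reflexivity.
Qed.

Lemma canonical_unique r f0 f' n' : n1 0 = n2 0 ->
  canonical_discrete_K_surface n1 n2 eps r f' n' -> f' 0%nat 0%nat = f0 ->
  forall i j, in_grid eps r i j -> f' i j = dF n1 n2 eps f0 i j /\ n' i j = N i j.
Proof.
  intros H0 HC Hf.
  assert (HN : forall i j, in_grid eps r i j -> n' i j = N i j).
  { induction i; intros j.
    - intros H. rewrite (dks_data2 _ _ _ _ _ _ HC) by auto. reflexivity.
    - induction j; intros H.
      + rewrite (dks_data1 _ _ _ _ _ _ HC) by auto. reflexivity.
      + destruct (dks_equation _ _ _ _ _ _ HC i j H) as [_ E]. unfold a12, tau1, tau2 in E.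
        rewrite !plus_vadd in E.
        pose proof (in_grid_S1 _ _ _ H) as Hi. pose proof (in_grid_S2 _ _ _ H) as Hj.
        rewrite (IHi j (in_grid_S2 _ _ _ Hi)), (IHi (S j) Hi), (IHj Hj) in E.
        rewrite scal_vsc, <- kstep_add in E.
        apply (f_equal (fun v => vsub v (N i j))) in E.
        replace (n' (S i) (S j)) with (vsub (vadd (n' (S i) (S j)) (N i j)) (N i j)) by vring.
        transitivity (vsub (vadd (N (S i) (S j)) (N i j)) (N i j)). exact E. vring. }
  intros i j H. split; [|now apply HN]. revert H. induction j; intros H.
  - induction i. exact Hf.
    pose proof (proj1 (delta_cross1 _ _ _ _) (dks_surface1 _ _ _ _ _ _ HC i 0%nat H)) as E.
    pose proof (in_grid_S1 _ _ _ H) as H'. rewrite E, (HN _ _ H), (HN _ _ H'), (IHi H'). reflexivity.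
  - pose proof (proj1 (delta_cross2 _ _ _ _) (dks_surface2 _ _ _ _ _ _ HC i j H)) as E.
    pose proof (in_grid_S2 _ _ _ H) as H'. rewrite E, (HN _ _ H), (HN _ _ H'), (IHj H'). reflexivity.
Qed.
End Lattice.

(** * Lattice families with bounded difference quotients *)

Definition fam := R -> nat -> nat -> R.
Definition dq1 (g : fam) : fam := fun e i j => / e * (g e (S i) j - g e i j).
Definition dq2 (g : fam) : fam := fun e i j => / e * (g e i (S j) - g e i j).
Definition t1 (g : fam) : fam := fun e i j => g e (S i) j.
Definition t2 (g : fam) : fam := fun e i j => g e i (S j).

(** The threshold for [e] may depend on [r]. This makes the notion stable under shifts by one step,
    which fit between [r] and [R0] for small [e]. *)
Definition ev (R0 : R) (P : R -> nat -> nat -> Prop) : Prop :=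
  forall r, r < R0 -> exists e1, 0 < e1 /\ forall e, 0 < e < e1 ->
    forall i j, e * INR i <= r -> e * INR j <= r -> P e i j.

Lemma ev_mono R0 (P Q : R -> nat -> nat -> Prop) :
  (forall e i j, 0 < e -> P e i j -> Q e i j) -> ev R0 P -> ev R0 Q.
Proof.
  intros H HP r Hr. destruct (HP r Hr) as (e1 & H1 & H2). exists e1. split; auto.
  intros e He i j Hi Hj. apply H. lra. auto.
Qed.

Lemma ev_and R0 P Q : ev R0 P -> ev R0 Q -> ev R0 (fun e i j => P e i j /\ Q e i j).
Proof.
  intros HP HQ r Hr. destruct (HP r Hr) as (e1 & H1 & H2). destruct (HQ r Hr) as (e2 & H3 & H4).
  exists (Rmin e1 e2). split. now apply Rmin_pos. intros e He i j Hi Hj.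
  pose proof (Rmin_l e1 e2). pose proof (Rmin_r e1 e2). split; [apply H2|apply H4]; auto; lra.
Qed.

Lemma ev_small R0 e0 : 0 < e0 -> ev R0 (fun e _ _ => e < e0).
Proof. intros H r Hr. exists e0. split; auto. intros; lra. Qed.
Lemma ev_dom R0 : ev R0 (fun e i j => e * INR i <= R0 /\ e * INR j <= R0).
Proof. intros r Hr. exists 1. split. lra. intros; lra. Qed.
Lemma ev_all R0 (P : R -> nat -> nat -> Prop) : (forall e i j, 0 < e -> P e i j) -> ev R0 P.
Proof. intros H r Hr. exists 1. split. lra. intros; apply H; lra. Qed.
Lemma ev_shift R0 P : ev R0 P -> ev R0 (fun e i j => P e (S i) j /\ P e i (S j)).
Proof.
  intros HP r Hr. destruct (HP ((r + R0) / 2)) as (e1 & H1 & H2). lra.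
  exists (Rmin e1 ((R0 - r) / 2)). split. apply Rmin_pos; lra. intros e He i j Hi Hj.
  pose proof (Rmin_l e1 ((R0 - r) / 2)). pose proof (Rmin_r e1 ((R0 - r) / 2)).
  split; apply H2; try lra; rewrite S_INR; lra.
Qed.

Lemma ev_S1 R0 P : ev R0 P -> ev R0 (fun e i j => P e (S i) j).
Proof. intros H. apply ev_shift in H. revert H. apply ev_mono. tauto. Qed.
Lemma ev_S2 R0 P : ev R0 P -> ev R0 (fun e i j => P e i (S j)).
Proof. intros H. apply ev_shift in H. revert H. apply ev_mono. tauto. Qed.

(** The exponent is 0 for bounded quantities and 1 for errors; exponents add under
    multiplication. *)
Definition bdd (R0 : R) (s : nat) (g : fam) : Prop :=
  exists c, ev R0 (fun e i j => Rabs (g e i j) <= c * e ^ s).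

(* [b = true] bounds all difference quotients up to order [k], [b = false] only
   those in the first direction. *)
Fixpoint Bd (b : bool) (R0 : R) (s k : nat) (g : fam) : Prop :=
  bdd R0 s g /\
  match k with
  | O => True
  | S k' => Bd b R0 s k' (dq1 g) /\ (b = true -> Bd b R0 s k' (dq2 g))
  end.

Lemma Bd_bdd b R0 s k g : Bd b R0 s k g -> bdd R0 s g.
Proof. destruct k; intros H; apply H. Qed.
Lemma Bd_pred b R0 s k : forall g, Bd b R0 s (S k) g -> Bd b R0 s k g.
Proof.
  induction k; intros g H. split; [apply H|exact I].
  destruct H as (A & B & C). split; [exact A|split; auto].
Qed.

Lemma Bd_false R0 s k : forall g, Bd true R0 s k g -> Bd false R0 s k g.
Proof.
  induction k; intros g H. split; [apply H|exact I].
  destruct H as (A & B & C). split; [exact A|split; auto].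
Qed.

Lemma Bd_ext b R0 s k : forall f g, ev R0 (fun e i j => f e i j = g e i j) -> Bd b R0 s k f -> Bd b R0 s k g.
Proof.
  assert (B0 : forall f g, ev R0 (fun e i j => f e i j = g e i j) -> bdd R0 s f -> bdd R0 s g).
  { intros f g E [c H]. exists c. generalize (ev_and _ _ _ E H). apply ev_mono.
    intros e i j _ [<- K]. exact K. }
  induction k; intros f g E H.
  - split; [|exact I]. apply (B0 f g E), H.
  - destruct H as (A & B & C). split; [exact (B0 f g E A)|split].
    + apply (IHk (dq1 f)); auto. generalize (ev_and _ _ _ E (ev_S1 _ _ E)). apply ev_mono.
      intros e i j _ [E1 E2]. unfold dq1. now rewrite E1, E2.
    + intros Hb. apply (IHk (dq2 f)); auto. generalize (ev_and _ _ _ E (ev_S2 _ _ E)). apply ev_mono.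
      intros e i j _ [E1 E2]. unfold dq2. now rewrite E1, E2.
Qed.

Lemma Bd_ext_all b R0 s k f g : (forall e i j, f e i j = g e i j) -> Bd b R0 s k f -> Bd b R0 s k g.
Proof. intros E. apply Bd_ext, ev_all. auto. Qed.
Lemma Bd_t1 b R0 s k : forall g, Bd b R0 s k g -> Bd b R0 s k (t1 g).
Proof.
  induction k; intros g H; (split; [destruct (Bd_bdd _ _ _ _ _ H) as [c Hc]; exists c; exact (ev_S1 _ _ Hc)|]); auto.
  destruct H as (A & B & C). split. exact (IHk _ B). intros Hb. exact (IHk _ (C Hb)).
Qed.

Lemma Bd_t2 b R0 s k : forall g, Bd b R0 s k g -> Bd b R0 s k (t2 g).
Proof.
  induction k; intros g H; (split; [destruct (Bd_bdd _ _ _ _ _ H) as [c Hc]; exists c; exact (ev_S2 _ _ Hc)|]); auto.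
  destruct H as (A & B & C). split. exact (IHk _ B). intros Hb. exact (IHk _ (C Hb)).
Qed.

Lemma Bd_plus b R0 s k : forall f g, Bd b R0 s k f -> Bd b R0 s k g -> Bd b R0 s k (fun e i j => f e i j + g e i j).
Proof.
  assert (B0 : forall f g, bdd R0 s f -> bdd R0 s g -> bdd R0 s (fun e i j => f e i j + g e i j)).
  { intros f g [c F] [c' G]. exists (c + c'). generalize (ev_and _ _ _ F G). apply ev_mono.
    intros e i j _ [A B]. eapply Rle_trans; [apply Rabs_triang|]. lra. }
  induction k; intros f g F G.
  - split; [|exact I]. apply B0; [apply F|apply G].
  - destruct F as (A & B & C), G as (A' & B' & C'). split; [now apply B0|split].
    + eapply Bd_ext_all; [|exact (IHk _ _ B B')]. intros; unfold dq1; ring.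
    + intros Hb. eapply Bd_ext_all; [|exact (IHk _ _ (C Hb) (C' Hb))]. intros; unfold dq2; ring.
Qed.

(** The discrete Leibniz rule leaves one factor shifted, which is why closure under [t1] and [t2]
    comes first. *)
Lemma Bd_mult b R0 s s' k : forall f g, Bd b R0 s k f -> Bd b R0 s' k g ->
  Bd b R0 (s + s') k (fun e i j => f e i j * g e i j).
Proof.
  assert (B0 : forall f g, bdd R0 s f -> bdd R0 s' g -> bdd R0 (s + s') (fun e i j => f e i j * g e i j)).
  { intros f g [c F] [c' G]. exists (c * c'). generalize (ev_and _ _ _ F G). apply ev_mono.
    intros e i j _ [A B]. rewrite Rabs_mult, pow_add.
    replace (c * c' * (e ^ s * e ^ s')) with ((c * e ^ s) * (c' * e ^ s')) by ring.
    apply Rmult_le_compat; auto using Rabs_pos. }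
  induction k; intros f g F G.
  - split; [|exact I]. apply B0; [apply F|apply G].
  - pose proof (Bd_pred _ _ _ _ _ (Bd_t1 _ _ _ _ _ F)) as F1. pose proof (Bd_pred _ _ _ _ _ G) as G1.
    pose proof (Bd_pred _ _ _ _ _ (Bd_t2 _ _ _ _ _ F)) as F2.
    destruct F as (A & B & C), G as (A' & B' & C'). split; [now apply B0|split].
    + eapply Bd_ext_all; [|exact (Bd_plus _ _ _ _ _ _ (IHk _ _ B G1) (IHk _ _ F1 B'))].
      intros; unfold dq1, t1; ring.
    + intros Hb. eapply Bd_ext_all; [|exact (Bd_plus _ _ _ _ _ _ (IHk _ _ (C Hb) G1) (IHk _ _ F2 (C' Hb)))].
      intros; unfold dq2, t2; ring.
Qed.

Lemma Bd_const b R0 k c : Bd b R0 0 k (fun _ _ _ => c).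
Proof.
  revert c; induction k; intros c;
  (split; [exists (Rabs c); apply ev_all; intros; simpl; lra|]); auto.
  split; [|intros _]; (eapply Bd_ext_all; [|exact (IHk 0)]); intros; unfold dq1, dq2; ring.
Qed.

Lemma Bd_zero b R0 s k : Bd b R0 s k (fun _ _ _ => 0).
Proof.
  induction k; (split; [exists 0; apply ev_all; intros; rewrite Rabs_R0; lra|]); auto.
  split; [|intros _]; (eapply Bd_ext_all; [|exact IHk]); intros; unfold dq1, dq2; ring.
Qed.

Lemma Bd_eps b R0 k : Bd b R0 1 k (fun e _ _ => e).
Proof.
  destruct k; (split; [exists 1; apply ev_all; intros; rewrite pow_1, Rabs_pos_eq; lra|]); auto.
  split; [|intros _]; (eapply Bd_ext_all; [|exact (Bd_zero _ _ _ _)]); intros; unfold dq1, dq2; ring.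
Qed.

Lemma Bd_scal b R0 s k c g : Bd b R0 s k g -> Bd b R0 s k (fun e i j => c * g e i j).
Proof. intros H. exact (Bd_mult _ _ 0 s _ _ _ (Bd_const _ _ _ c) H). Qed.
Lemma Bd_opp b R0 s k g : Bd b R0 s k g -> Bd b R0 s k (fun e i j => - g e i j).
Proof. intros H. eapply Bd_ext_all; [|exact (Bd_scal _ _ _ _ (-1) _ H)]. intros; simpl; ring. Qed.
Lemma Bd_minus b R0 s k f g : Bd b R0 s k f -> Bd b R0 s k g -> Bd b R0 s k (fun e i j => f e i j - g e i j).
Proof. intros F G. apply Bd_plus; auto. now apply Bd_opp. Qed.
Lemma Bd_weaken b R0 s k : forall g, Bd b R0 (S s) k g -> Bd b R0 s k g.
Proof.
  assert (B0 : forall g, bdd R0 (S s) g -> bdd R0 s g).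
  { intros g [c G]. exists (Rabs c). generalize (ev_and _ _ _ G (ev_small R0 1 Rlt_0_1)). apply ev_mono.
    intros e i j He [A B]. eapply Rle_trans; [exact A|]. simpl.
    pose proof (Rle_abs c). assert (0 < e ^ s) by now apply pow_lt. pose proof (Rabs_pos c).
    assert (c * (e * e ^ s) <= Rabs c * (e * e ^ s)) by (apply Rmult_le_compat_r; nra).
    assert (Rabs c * (e * e ^ s) <= Rabs c * (1 * e ^ s)).
    { apply Rmult_le_compat_l; auto. apply Rmult_le_compat_r; lra. } lra. }
  induction k; intros g H. split; [apply B0, H|exact I].
  destruct H as (A & B & C). split; [now apply B0|split; auto].
Qed.

(** The difference quotient of [1 / g] is minus that of [g] times the reciprocals of [g] and of its
    shift. *)
Lemma Bd_inv b R0 k : forall g, Bd b R0 0 k g -> ev R0 (fun e i j => 1 <= g e i j) ->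
  Bd b R0 0 k (fun e i j => / g e i j).
Proof.
  assert (B0 : forall g, ev R0 (fun e i j => 1 <= g e i j) -> bdd R0 0 (fun e i j => / g e i j)).
  { intros g H. exists 1. revert H. apply ev_mono. intros e i j _ H. simpl. rewrite Rmult_1_r.
    rewrite Rabs_pos_eq. rewrite <- Rinv_1. apply Rinv_le_contravar; lra.
    apply Rlt_le, Rinv_0_lt_compat; lra. }
  induction k; intros g G H; (split; [now apply B0|]); auto.
  pose proof (Bd_pred _ _ _ _ _ G) as Gp. pose proof (IHk _ Gp H) as V.
  destruct G as (A & B & C). split; [|intros Hb].
  - pose proof (IHk _ (Bd_t1 _ _ _ _ _ Gp) (ev_S1 _ _ H)) as V1.
    eapply Bd_ext; [|exact (Bd_opp _ _ _ _ _ (Bd_mult _ _ 0 0 _ _ _ (Bd_mult _ _ 0 0 _ _ _ B V) V1))].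
    generalize (ev_and _ _ _ H (ev_S1 _ _ H)). apply ev_mono. intros e i j He [E1 E2].
    unfold dq1, t1. field. lra.
  - pose proof (IHk _ (Bd_t2 _ _ _ _ _ Gp) (ev_S2 _ _ H)) as V1.
    eapply Bd_ext; [|exact (Bd_opp _ _ _ _ _ (Bd_mult _ _ 0 0 _ _ _ (Bd_mult _ _ 0 0 _ _ _ (C Hb) V) V1))].
    generalize (ev_and _ _ _ H (ev_S2 _ _ H)). apply ev_mono. intros e i j He [E1 E2].
    unfold dq2, t2. field. lra.
Qed.

(** Difference quotients commute, so any of them that is not purely in the first direction can be
    taken of [dq2 w]. *)
Lemma Bd_iso R0 s k : forall w, Bd false R0 s (S k) w -> Bd true R0 s k (dq2 w) -> Bd true R0 s (S k) w.
Proof.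
  induction k; intros w (A & B & _) H.
  - split; [exact A|split; [split; [apply B|exact I]|intros _; exact H]].
  - split; [exact A|split; [|intros _; exact H]]. apply IHk. exact B.
    destruct H as (_ & H & _). eapply Bd_ext_all; [|exact H]. intros; unfold dq1, dq2; ring.
Qed.

Definition sw (g : fam) : fam := fun e i j => g e j i.
Lemma ev_sw R0 P : ev R0 P -> ev R0 (fun e i j => P e j i).
Proof.
  intros H r Hr. destruct (H r Hr) as (e1 & H1 & H2). exists e1. split; auto.
Qed.

Lemma Bd_sw R0 s k : forall g, Bd true R0 s k g -> Bd true R0 s k (sw g).
Proof.
  induction k; intros g H; (split; [destruct (Bd_bdd _ _ _ _ _ H) as [c Hc]; exists c; exact (ev_sw _ _ Hc)|]); auto.
  destruct H as (A & B & C). split. exact (IHk _ (C eq_refl)). intros _. exact (IHk _ B).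
Qed.

(** * Vector-valued families and linear lattice equations *)

Definition vfam := R -> nat -> nat -> V3.
Definition VBd b R0 s k (g : vfam) : Prop :=
  Bd b R0 s k (fun e i j => c1 (g e i j)) /\ Bd b R0 s k (fun e i j => c2 (g e i j)) /\
  Bd b R0 s k (fun e i j => c3 (g e i j)).
Definition D_1 (g : vfam) : vfam := fun e i j => vsc (/ e) (vsub (g e (S i) j) (g e i j)).
Definition D_2 (g : vfam) : vfam := fun e i j => vsc (/ e) (vsub (g e i (S j)) (g e i j)).
Definition T_1 (g : vfam) : vfam := fun e i j => g e (S i) j.
Definition T_2 (g : vfam) : vfam := fun e i j => g e i (S j).
Definition vsw (g : vfam) : vfam := fun e i j => g e j i.

Lemma VBd_S b R0 s k g : VBd b R0 s (S k) g <->
  VBd b R0 s 0 g /\ VBd b R0 s k (D_1 g) /\ (b = true -> VBd b R0 s k (D_2 g)).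
Proof.
  split.
  - intros ((A & A1 & A2) & (B & B1 & B2) & (C & C1 & C2)). split; [|split].
    + exact (conj (conj A I) (conj (conj B I) (conj C I))).
    + exact (conj A1 (conj B1 C1)).
    + intros Hb. exact (conj (A2 Hb) (conj (B2 Hb) (C2 Hb))).
  - intros (((A & _) & (B & _) & (C & _)) & (A1 & B1 & C1) & H).
    split; [|split].
    + split; [exact A|split; [exact A1|intros Hb; apply (H Hb)]].
    + split; [exact B|split; [exact B1|intros Hb; apply (H Hb)]].
    + split; [exact C|split; [exact C1|intros Hb; apply (H Hb)]].
Qed.

Lemma VBd_D1 b R0 s k g : VBd b R0 s (S k) g -> VBd b R0 s k (D_1 g).
Proof. intros H. apply VBd_S in H. apply H. Qed.
Lemma VBd_D2 R0 s k g : VBd true R0 s (S k) g -> VBd true R0 s k (D_2 g).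
Proof. intros H. apply VBd_S in H. now apply H. Qed.
Lemma VBd_pred b R0 s k g : VBd b R0 s (S k) g -> VBd b R0 s k g.
Proof. intros (A & B & C). split; [|split]; now apply Bd_pred. Qed.
Lemma VBd_false R0 s k g : VBd true R0 s k g -> VBd false R0 s k g.
Proof. intros (A & B & C). split; [|split]; now apply Bd_false. Qed.
Lemma VBd_ext b R0 s k f g : ev R0 (fun e i j => f e i j = g e i j) -> VBd b R0 s k f -> VBd b R0 s k g.
Proof.
  intros E (A & B & C). split; [|split].
  - eapply Bd_ext; [|exact A]. revert E; apply ev_mono. intros e i j _ ->; auto.
  - eapply Bd_ext; [|exact B]. revert E; apply ev_mono. intros e i j _ ->; auto.
  - eapply Bd_ext; [|exact C]. revert E; apply ev_mono. intros e i j _ ->; auto.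
Qed.

Lemma VBd_ext_all b R0 s k f g : (forall e i j, f e i j = g e i j) -> VBd b R0 s k f -> VBd b R0 s k g.
Proof. intros E. apply VBd_ext, ev_all. auto. Qed.
Lemma VBd_t1 b R0 s k g : VBd b R0 s k g -> VBd b R0 s k (T_1 g).
Proof.
  intros (A & B & C). split; [|split].
  exact (Bd_t1 _ _ _ _ _ A). exact (Bd_t1 _ _ _ _ _ B). exact (Bd_t1 _ _ _ _ _ C).
Qed.

Lemma VBd_t2 b R0 s k g : VBd b R0 s k g -> VBd b R0 s k (T_2 g).
Proof.
  intros (A & B & C). split; [|split].
  exact (Bd_t2 _ _ _ _ _ A). exact (Bd_t2 _ _ _ _ _ B). exact (Bd_t2 _ _ _ _ _ C).
Qed.

Lemma VBd_add b R0 s k f g : VBd b R0 s k f -> VBd b R0 s k g -> VBd b R0 s k (fun e i j => vadd (f e i j) (g e i j)).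
Proof. intros (A & B & C) (A' & B' & C'). split; [|split]; now apply Bd_plus. Qed.
Lemma VBd_sub b R0 s k f g : VBd b R0 s k f -> VBd b R0 s k g -> VBd b R0 s k (fun e i j => vsub (f e i j) (g e i j)).
Proof. intros (A & B & C) (A' & B' & C'). split; [|split]; now apply Bd_minus. Qed.
Lemma VBd_sc b R0 s s' k f g : Bd b R0 s k f -> VBd b R0 s' k g -> VBd b R0 (s + s') k (fun e i j => vsc (f e i j) (g e i j)).
Proof. intros A (A' & B' & C'). split; [|split]; now apply Bd_mult. Qed.
Lemma Bd_dot b R0 s s' k f g : VBd b R0 s k f -> VBd b R0 s' k g -> Bd b R0 (s + s') k (fun e i j => dot (f e i j) (g e i j)).
Proof. intros (A & B & C) (A' & B' & C'). unfold dot. repeat apply Bd_plus; now apply Bd_mult. Qed.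
Lemma VBd_cross b R0 s s' k f g : VBd b R0 s k f -> VBd b R0 s' k g -> VBd b R0 (s + s') k (fun e i j => cross (f e i j) (g e i j)).
Proof. intros (A & B & C) (A' & B' & C'). split; [|split]; apply Bd_minus; now apply Bd_mult. Qed.
Lemma VBd_weaken b R0 s k g : VBd b R0 (S s) k g -> VBd b R0 s k g.
Proof. intros (A & B & C). split; [|split]; now apply Bd_weaken. Qed.
Lemma VBd_sw R0 s k g : VBd true R0 s k g -> VBd true R0 s k (vsw g).
Proof.
  intros (A & B & C). split; [|split].
  exact (Bd_sw _ _ _ _ A). exact (Bd_sw _ _ _ _ B). exact (Bd_sw _ _ _ _ C).
Qed.

Lemma VBd_iso R0 s k w : VBd false R0 s (S k) w -> VBd true R0 s k (D_2 w) -> VBd true R0 s (S k) w.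
Proof.
  intros (A & B & C) (A' & B' & C'). split; [|split].
  exact (Bd_iso _ _ _ _ A A'). exact (Bd_iso _ _ _ _ B B'). exact (Bd_iso _ _ _ _ C C').
Qed.

Lemma D12_comm g e i j : D_1 (D_2 g) e i j = D_2 (D_1 g) e i j.
Proof. unfold D_1, D_2. vring. Qed.

Definition vbdd R0 s (g : vfam) : Prop := exists c, 0 <= c /\ ev R0 (fun e i j => nrm (g e i j) <= c * e ^ s).
Lemma VBd_vbdd b R0 s k g : VBd b R0 s k g -> vbdd R0 s g.
Proof.
  intros (A & B & C). apply Bd_bdd in A, B, C. destruct A as [a A], B as [b' B], C as [c C].
  exists (Rabs (a + b' + c)). split. apply Rabs_pos.
  generalize (ev_and _ _ _ A (ev_and _ _ _ B C)). apply ev_mono. intros e i j He (P & Q & S).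
  assert (0 < e ^ s) by now apply pow_lt. pose proof (Rle_abs (a + b' + c)). unfold nrm. nra.
Qed.

Lemma vbdd_VBd b R0 s g : vbdd R0 s g -> VBd b R0 s 0 g.
Proof.
  intros (c & _ & H). split; [|split]; (split; [|exact I]); exists c; revert H; apply ev_mono; intros e i j _ H;
    destruct (nrm_c (g e i j)) as (A & B & C); lra.
Qed.

Lemma VBd_tri b R0 s s' s'' k w p m : VBd b R0 s k w -> VBd b R0 s' k p -> VBd b R0 s'' k m ->
  VBd b R0 (s + s' + s'') k (fun e i j => tri (w e i j) (p e i j) (m e i j)).
Proof. intros A B C. apply (VBd_sc _ _ (s + s')); auto. apply Bd_opp. now apply Bd_dot. Qed.

(** Discrete counterpart of [linrec]: an equation in the second direction with zero initial values,
    differenced in the first. The principal part is unchanged up to a shift of its coefficients, so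
    the smallness condition is the same for every [k]. *)
Lemma lattice_linear R0 K k : 0 <= K -> 2 * (K * K) * R0 <= 1 -> forall w p m b : vfam,
  VBd false R0 0 k p -> VBd false R0 0 k m -> VBd false R0 1 k b ->
  ev R0 (fun e i j => nrm (p e i j) <= K /\ nrm (m e i j) <= K) ->
  ev R0 (fun e i j => D_2 w e i j = vadd (tri (w e i j) (p e i j) (m e i j)) (b e i j)) ->
  ev R0 (fun e i _ => w e i 0%nat = v0) ->
  VBd false R0 1 k w.
Proof.
  intros HK0 HK. induction k; intros w p m b Hp Hm Hb Bnd E W0.
  - apply vbdd_VBd. destruct (VBd_vbdd _ _ _ _ _ Hb) as (c & Hc & Hb').
    exists (2 * c * Rabs R0). split. apply Rmult_le_pos; [lra|apply Rabs_pos].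
    intros r Hr. destruct (ev_and _ _ _ W0 (ev_and _ _ _ E (ev_and _ _ _ Bnd Hb')) r Hr) as (e1 & He1 & H).
    exists e1. split; auto. intros e He i j Hi Hj.
    (* Linear growth in the height: by smallness the linear term is at most [c * e], as is the
       inhomogeneity, so each step adds at most [2 * c * e * e]. *)
    assert (G : nrm (w e i j) <= 2 * c * e * (e * INR j)).
    { revert Hj. induction j; intros Hj.
      - rewrite (proj1 (H e He i 0%nat Hi Hj)), nrm_v0. simpl. lra.
      - pose proof (Rmult_INR_S_le e (proj1 He) _ _ Hj) as Hj'. specialize (IHj Hj').
        destruct (H e He i j Hi Hj') as (_ & Q1 & (Q2 & Q3) & Q4).
        assert (Es : w e i (S j) = vadd (w e i j) (vsc e (D_2 w e i j))).
        { unfold D_2. vfield; lra. }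
        rewrite Es, Q1. eapply Rle_trans; [apply nrm_add|]. rewrite nrm_sc, Rabs_pos_eq by lra.
        assert (T1 : nrm (tri (w e i j) (p e i j) (m e i j)) <= c * e).
        { eapply Rle_trans; [apply nrm_tri|].
          apply Rle_trans with ((2 * c * e * (e * INR j)) * K * K).
          - now apply nrm_prod.
          - replace ((2 * c * e * (e * INR j)) * K * K) with (c * e * (2 * (K * K) * (e * INR j))) by ring.
            rewrite <- (Rmult_1_r (c * e)) at 2. apply Rmult_le_compat_l. nra.
            eapply Rle_trans; [|exact HK]. apply Rmult_le_compat_l; [nra|lra]. }
        pose proof (nrm_add (tri (w e i j) (p e i j) (m e i j)) (b e i j)) as T2.
        rewrite pow_1 in Q4. rewrite S_INR.
        assert (e * nrm (vadd (tri (w e i j) (p e i j) (m e i j)) (b e i j)) <= e * (c * e + c * e))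
          by (apply Rmult_le_compat_l; lra). nra. }
    eapply Rle_trans; [exact G|]. rewrite pow_1.
    assert (e * INR j <= Rabs R0) by (pose proof (Rle_abs R0); lra).
    assert (0 <= 2 * c * e) by nra. nra.
  - pose proof (VBd_pred _ _ _ _ _ Hp) as Hp'. pose proof (VBd_pred _ _ _ _ _ Hm) as Hm'.
    pose proof (VBd_pred _ _ _ _ _ Hb) as Hb'.
    pose proof (IHk w p m b Hp' Hm' Hb' Bnd E W0) as Hw.
    apply VBd_S. split; [|split].
    + apply vbdd_VBd. exact (VBd_vbdd _ _ _ _ _ Hw).
    (* Differences of the coefficients multiply [w] itself, already bounded to order [k], and join
       the inhomogeneity. *)
    + apply (IHk (D_1 w) (T_1 p) (T_1 m)
        (fun e i j => vadd (vadd (tri (w e i j) (D_1 p e i j) (T_1 m e i j)) (tri (w e i j) (p e i j) (D_1 m e i j))) (D_1 b e i j))).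
      * now apply VBd_t1.
      * now apply VBd_t1.
      * repeat apply VBd_add.
        -- apply (VBd_tri _ _ 1 0 0); auto. now apply VBd_D1. now apply VBd_t1.
        -- apply (VBd_tri _ _ 1 0 0); auto. now apply VBd_D1.
        -- now apply VBd_D1.
      * exact (ev_S1 _ _ Bnd).
      * generalize (ev_and _ _ _ E (ev_S1 _ _ E)). apply ev_mono. intros e i j He [E1 E2].
        rewrite <- D12_comm. unfold D_1 at 1. rewrite E1, E2. unfold T_1, D_1, tri.
        vring.
      * generalize (ev_and _ _ _ W0 (ev_S1 _ _ W0)). apply ev_mono. intros e i j _ [E1 E2].
        unfold D_1. rewrite E1, E2. vring.
    + discriminate.
Qed.

(** * Restriction of smooth functions to the lattice *)

Definition evx (R0 : R) (P : R -> R -> R -> Prop) : Prop :=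
  forall r, r < R0 -> exists e1, 0 < e1 /\ forall e, 0 < e < e1 ->
    forall x y, 0 <= x <= r -> 0 <= y <= r -> P e x y.

Lemma evx_mono R0 (P Q : R -> R -> R -> Prop) :
  (forall e x y, 0 < e -> P e x y -> Q e x y) -> evx R0 P -> evx R0 Q.
Proof.
  intros H HP r Hr. destruct (HP r Hr) as (e1 & H1 & H2). exists e1. split; auto.
  intros e He i j Hi Hj. apply H. lra. auto.
Qed.

Lemma evx_and R0 P Q : evx R0 P -> evx R0 Q -> evx R0 (fun e x y => P e x y /\ Q e x y).
Proof.
  intros HP HQ r Hr. destruct (HP r Hr) as (e1 & H1 & H2). destruct (HQ r Hr) as (e2 & H3 & H4).
  exists (Rmin e1 e2). split. now apply Rmin_pos. intros e He i j Hi Hj.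
  pose proof (Rmin_l e1 e2). pose proof (Rmin_r e1 e2). split; [apply H2|apply H4]; auto; lra.
Qed.

Lemma evx_shift R0 P : evx R0 P ->
  evx R0 (fun e x y => forall t, 0 <= t <= e -> P e (x + t) y /\ P e x (y + t)).
Proof.
  intros HP r Hr. destruct (HP ((r + R0) / 2)) as (e1 & H1 & H2). lra.
  exists (Rmin e1 ((R0 - r) / 2)). split. apply Rmin_pos; lra. intros e He x y Hx Hy t Ht.
  pose proof (Rmin_l e1 ((R0 - r) / 2)). pose proof (Rmin_r e1 ((R0 - r) / 2)).
  split; apply H2; lra.
Qed.

Lemma evx_shift1 R0 P : evx R0 P -> evx R0 (fun e x y => forall t, 0 <= t <= e -> P e (x + t) y).
Proof. intros H. apply evx_shift in H. revert H. apply evx_mono. intros e x y He H t Ht. now apply H. Qed.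
Lemma evx_sw R0 P : evx R0 P -> evx R0 (fun e x y => P e y x).
Proof. intros H r Hr. destruct (H r Hr) as (e1 & H1 & H2). exists e1. split; auto. Qed.

(** Functions may depend on [e], because difference quotients of smooth functions do and the
    inductions are applied to them again. *)
Definition efun := R -> R -> R -> R.
Definition Dx1 (h : efun) : efun := fun e x y => / e * (h e (x + e) y - h e x y).
Definition Dx2 (h : efun) : efun := fun e x y => / e * (h e x (y + e) - h e x y).
Definition esw (h : efun) : efun := fun e x y => h e y x.
Definition edx R0 (h hx : efun) : Prop := evx R0 (fun e x y => is_derive (fun t => h e t y) x (hx e x y)).
Definition edy R0 (h hy : efun) : Prop := evx R0 (fun e x y => is_derive (fun t => h e x t) y (hy e x y)).

Fixpoint FB (R0 : R) (k : nat) (h : efun) : Prop :=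
  (exists c, evx R0 (fun e x y => Rabs (h e x y) <= c)) /\
  match k with
  | O => True
  | S k' => exists hx hy, edx R0 h hx /\ edy R0 h hy /\ FB R0 k' hx /\ FB R0 k' hy
  end.

Lemma FB_pred R0 k : forall h, FB R0 (S k) h -> FB R0 k h.
Proof.
  induction k; intros h H. split; [apply H|exact I].
  destruct H as (A & hx & hy & B & C & D & E). split; auto. exists hx, hy. auto.
Qed.

Lemma FB_sw R0 k : forall h, FB R0 k h -> FB R0 k (esw h).
Proof.
  induction k; intros h H.
  - destruct H as ((c & A) & _). split; [|exact I]. exists c. exact (evx_sw _ _ A).
  - destruct H as ((c & A) & hx & hy & B & C & D & E). split. exists c. exact (evx_sw _ _ A).
    exists (esw hy), (esw hx). split; [exact (evx_sw _ _ C)|split; [exact (evx_sw _ _ B)|auto]].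
Qed.

Lemma is_derive_shift (f : R -> R) x t l : is_derive f (x + t) l -> is_derive (fun s => f (s + t)) x l.
Proof.
  intros H. replace l with (1 * l) by ring.
  apply (is_derive_comp f (fun s => s + t)). exact H.
  replace 1 with (1 + 0) by ring. exact (der_plus _ _ _ _ _ (is_derive_id (K := R_AbsRing) x) (der_const t x)).
Qed.

Lemma edx_Dx1 R0 h hx : edx R0 h hx -> edx R0 (Dx1 h) (Dx1 hx).
Proof.
  intros H. generalize (evx_shift1 _ _ H). apply evx_mono. intros e x y He K. unfold Dx1.
  apply (is_derive_scal (fun t => h e (t + e) y - h e t y)).
  apply der_minus.
  - apply (is_derive_shift (fun t => h e t y)). apply K. lra.
  - specialize (K 0 ltac:(lra)). now rewrite Rplus_0_r in K.
Qed.

Lemma edy_Dx1 R0 h hy : edy R0 h hy -> edy R0 (Dx1 h) (Dx1 hy).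
Proof.
  intros H. generalize (evx_shift1 _ _ H). apply evx_mono. intros e x y He K. unfold Dx1.
  apply (is_derive_scal (fun t => h e (x + e) t - h e x t)).
  apply der_minus.
  - apply K. lra.
  - specialize (K 0 ltac:(lra)). now rewrite Rplus_0_r in K.
Qed.

Lemma edx_mvt R0 h hx : edx R0 h hx ->
  evx R0 (fun e x y => forall s, 0 <= s <= e -> exists c, 0 <= c <= s /\ h e (x + s) y - h e x y = hx e (x + c) y * s).
Proof.
  intros H. generalize (evx_shift1 _ _ H). apply evx_mono. intros e x y He K s Hs.
  destruct (mvt (fun t => h e t y) (fun t => hx e t y) x (x + s)) as [c [Hc Ec]].
  - intros t Ht. rewrite Rmin_left, Rmax_right in Ht by lra.
    replace t with (x + (t - x)) by ring. apply K. lra.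
  - rewrite Rmin_left, Rmax_right in Hc by lra. exists (c - x). split. lra.
    rewrite Ec. replace (x + (c - x)) with c by ring. ring.
Qed.

Lemma FB_Dx1 R0 k : forall h, FB R0 (S k) h -> FB R0 k (Dx1 h).
Proof.
  assert (B0 : forall h hx, edx R0 h hx -> (exists c, evx R0 (fun e x y => Rabs (hx e x y) <= c)) ->
     exists c, evx R0 (fun e x y => Rabs (Dx1 h e x y) <= c)).
  { intros h hx D [c H]. exists c. generalize (evx_and _ _ _ (evx_shift1 _ _ H) (edx_mvt _ _ _ D)). apply evx_mono.
    intros e x y He [A B]. destruct (B e ltac:(lra)) as (t & Ht & E). unfold Dx1. rewrite E.
    replace (/ e * (hx e (x + t) y * e)) with (hx e (x + t) y) by (field; lra). apply A. lra. }
  induction k; intros h (A & hx & hy & B & C & D & E).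
  - split; [|exact I]. eapply B0; eauto. apply D.
  - split. eapply B0; eauto. apply D.
    exists (Dx1 hx), (Dx1 hy). split; [now apply edx_Dx1|split; [now apply edy_Dx1|auto]].
Qed.

Lemma FB_Dx2 R0 k h : FB R0 (S k) h -> FB R0 k (Dx2 h).
Proof. intros H. apply (FB_sw _ _ (Dx1 (esw h))). now apply FB_Dx1, FB_sw. Qed.

Definition restr (h : efun) : fam := fun e i j => h e (e * INR i) (e * INR j).
Lemma ev_evx R0 P : evx R0 P -> ev R0 (fun e i j => P e (e * INR i) (e * INR j)).
Proof.
  intros H r Hr. destruct (H r Hr) as (e1 & H1 & H2). exists e1. split; auto.
  intros e He i j Hi Hj. pose proof (pos_INR i). pose proof (pos_INR j). apply H2; auto; split; auto; nra.
Qed.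

Lemma restr_d1 h e i j : dq1 (restr h) e i j = restr (Dx1 h) e i j.
Proof. unfold dq1, restr, Dx1. rewrite S_INR. now replace (e * (INR i + 1)) with (e * INR i + e) by ring. Qed.
Lemma restr_d2 h e i j : dq2 (restr h) e i j = restr (Dx2 h) e i j.
Proof. unfold dq2, restr, Dx2. rewrite S_INR. now replace (e * (INR j + 1)) with (e * INR j + e) by ring. Qed.

Lemma FB_Bd R0 k : forall h, FB R0 k h -> Bd true R0 0 k (restr h).
Proof.
  assert (B0 : forall h, (exists c, evx R0 (fun e x y => Rabs (h e x y) <= c)) -> bdd R0 0 (restr h)).
  { intros h [c H]. exists c. apply ev_evx in H. revert H. apply ev_mono. intros e i j _ H. simpl. rewrite Rmult_1_r. exact H. }
  induction k; intros h H.
  - split; [apply B0, H|exact I].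
  - split; [apply B0, H|split; [|intros _]].
    + eapply Bd_ext_all; [|exact (IHk _ (FB_Dx1 _ _ _ H))]. intros; now rewrite restr_d1.
    + eapply Bd_ext_all; [|exact (IHk _ (FB_Dx2 _ _ _ H))]. intros; now rewrite restr_d2.
Qed.

(** Two mean value steps write the error as a second derivative times a length at most [e], which
    costs two orders. Higher quotients of the error are errors of the same kind for [Dx1 h] or
    [Dx2 h], as quotients commute with derivatives. *)
Lemma FB_consistent1 R0 k : forall h hx, FB R0 (S (S k)) h -> edx R0 h hx ->
  Bd true R0 1 k (fun e i j => restr (Dx1 h) e i j - restr hx e i j).
Proof.
  assert (B0 : forall h hx, FB R0 2 h -> edx R0 h hx -> bdd R0 1 (fun e i j => restr (Dx1 h) e i j - restr hx e i j)).
  { intros h hx (_ & gx & gy & Dx & _ & (_ & gxx & _ & Dxx & _ & ((c & Hc) & _) & _) & _) D.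
    exists c.
    generalize (ev_evx _ _ (evx_and _ _ _ (evx_and _ _ _ Dx D) (evx_and _ _ _ (edx_mvt _ _ _ Dx) (evx_and _ _ _ (edx_mvt _ _ _ Dxx) (evx_shift1 _ _ Hc))))).
    apply ev_mono. intros e i j He ((E1 & E2) & M1 & M2 & Hb). unfold restr.
    apply is_derive_unique in E1, E2. rewrite <- E2, E1.
    set (x := e * INR i) in *. set (y := e * INR j) in *.
    destruct (M1 e ltac:(lra)) as (t & Ht & Et). destruct (M2 t ltac:(lra)) as (u & Hu & Eu).
    unfold Dx1. rewrite Et. replace (/ e * (gx e (x + t) y * e)) with (gx e (x + t) y) by (field; lra).
    rewrite Eu, Rabs_mult, pow_1, (Rabs_pos_eq t) by lra. specialize (Hb u ltac:(lra)).
    pose proof (Rabs_pos (gxx e (x + u) y)). apply Rmult_le_compat; lra. }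
  assert (K : forall n h, FB R0 (S (S n)) h -> FB R0 2 h).
  { induction n; intros h H; auto. apply IHn, FB_pred, H. }
  induction k; intros h hx H D.
  - split; [now apply B0|exact I].
  - split; [|split; [|intros _]].
    + apply B0; auto. eapply K; eauto.
    + eapply Bd_ext_all; [|exact (IHk (Dx1 h) (Dx1 hx) (FB_Dx1 _ _ _ H) (edx_Dx1 _ _ _ D))].
      intros e i j. unfold dq1, restr, Dx1. rewrite S_INR. replace (e * (INR i + 1)) with (e * INR i + e) by ring. ring.
    + assert (D' : edx R0 (Dx2 h) (Dx2 hx)).
      { apply evx_sw in D. apply edy_Dx1 in D. apply evx_sw in D. exact D. }
      eapply Bd_ext_all; [|exact (IHk (Dx2 h) (Dx2 hx) (FB_Dx2 _ _ _ H) D')].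
      intros e i j. unfold dq2, restr, Dx1, Dx2. rewrite S_INR. replace (e * (INR j + 1)) with (e * INR j + e) by ring. ring.
Qed.

Lemma FB_consistent2 R0 k h hy : FB R0 (S (S k)) h -> edy R0 h hy ->
  Bd true R0 1 k (fun e i j => restr (Dx2 h) e i j - restr hy e i j).
Proof.
  intros H D. pose proof (FB_consistent1 R0 k (esw h) (esw hy) (FB_sw _ _ _ H) (evx_sw _ _ D)) as B.
  exact (Bd_sw _ _ _ _ B).
Qed.

Lemma evx_obox R0 rho (P : R -> R -> Prop) : R0 <= rho -> (forall x y, obox rho x y -> P x y) -> evx R0 (fun _ => P).
Proof.
  intros Hr H r Hr'. exists 1. split. lra. intros e _ x y Hx Hy. apply H.
  split; rewrite Rabs_pos_eq; lra.
Qed.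

Lemma Cb_FB R0 rho k : R0 <= rho -> forall f, Cb rho k f -> FB R0 k (fun _ => f).
Proof.
  intros Hr. induction k; intros f H.
  - destruct H as (_ & (c & Hc) & _). split; [|exact I]. exists c. now apply (evx_obox _ rho).
  - destruct H as (_ & (c & Hc) & fx & fy & A & B & C & D). split.
    exists c. now apply (evx_obox _ rho).
    exists (fun _ => fx), (fun _ => fy). split; [|split; [|auto]]; red; now apply (evx_obox _ rho).
Qed.

Definition vrestr (f : R -> R -> V3) : vfam := fun e i j => f (e * INR i) (e * INR j).
Lemma CbV_VBd R0 rho k f : R0 <= rho -> CbV rho k f -> VBd true R0 0 k (vrestr f).
Proof.
  intros Hr (A & B & C). split; [|split].
  exact (FB_Bd _ _ _ (Cb_FB _ _ _ Hr _ A)). exact (FB_Bd _ _ _ (Cb_FB _ _ _ Hr _ B)). exact (FB_Bd _ _ _ (Cb_FB _ _ _ Hr _ C)).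
Qed.

Lemma Cb_consistent1 R0 rho k f fx : R0 <= rho -> (forall k, Cb rho k f) ->
  (forall x y, obox rho x y -> is_derive (fun t => f t y) x (fx x y)) ->
  Bd true R0 1 k (fun e i j => dq1 (restr (fun _ => f)) e i j - restr (fun _ => fx) e i j).
Proof.
  intros Hr Hf D. eapply Bd_ext_all; [|apply (FB_consistent1 R0 k (fun _ => f) (fun _ => fx))].
  intros e i j. cbv beta. now rewrite restr_d1.
  apply (Cb_FB _ rho); auto. red. exact (evx_obox _ _ _ Hr D).
Qed.

Lemma Cb_consistent2 R0 rho k f fy : R0 <= rho -> (forall k, Cb rho k f) ->
  (forall x y, obox rho x y -> is_derive (fun t => f x t) y (fy x y)) ->
  Bd true R0 1 k (fun e i j => dq2 (restr (fun _ => f)) e i j - restr (fun _ => fy) e i j).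
Proof.
  intros Hr Hf D. eapply Bd_ext_all; [|apply (FB_consistent2 R0 k (fun _ => f) (fun _ => fy))].
  intros e i j. cbv beta. now rewrite restr_d2.
  apply (Cb_FB _ rho); auto. red. exact (evx_obox _ _ _ Hr D).
Qed.

Lemma CbV_consistent1 R0 rho k f fx : R0 <= rho -> (forall k, CbV rho k f) ->
  (forall x y, obox rho x y -> vder (fun t => f t y) x (fx x y)) ->
  VBd true R0 1 k (fun e i j => vsub (D_1 (vrestr f) e i j) (vrestr fx e i j)).
Proof.
  intros Hr Hf D.
  exact (conj (Cb_consistent1 R0 rho k _ _ Hr (fun k => proj1 (Hf k)) (fun x y H => proj1 (D x y H)))
   (conj (Cb_consistent1 R0 rho k _ _ Hr (fun k => proj1 (proj2 (Hf k))) (fun x y H => proj1 (proj2 (D x y H))))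
    (Cb_consistent1 R0 rho k _ _ Hr (fun k => proj2 (proj2 (Hf k))) (fun x y H => proj2 (proj2 (D x y H)))))).
Qed.

Lemma CbV_consistent2 R0 rho k f fy : R0 <= rho -> (forall k, CbV rho k f) ->
  (forall x y, obox rho x y -> vder (fun t => f x t) y (fy x y)) ->
  VBd true R0 1 k (fun e i j => vsub (D_2 (vrestr f) e i j) (vrestr fy e i j)).
Proof.
  intros Hr Hf D.
  exact (conj (Cb_consistent2 R0 rho k _ _ Hr (fun k => proj1 (Hf k)) (fun x y H => proj1 (D x y H)))
   (conj (Cb_consistent2 R0 rho k _ _ Hr (fun k => proj1 (proj2 (Hf k))) (fun x y H => proj1 (proj2 (D x y H))))
    (Cb_consistent2 R0 rho k _ _ Hr (fun k => proj2 (proj2 (Hf k))) (fun x y H => proj2 (proj2 (D x y H)))))).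
Qed.

(** * Stability of the discrete Gauss equation *)

Definition den (N : vfam) : fam := fun e i j => 1 + dot (T_1 N e i j) (T_2 N e i j).
Definition mm (N : vfam) : vfam := fun e i j => vsc (/ den N e i j) (vadd (T_1 N e i j) (T_2 N e i j)).

(** [N] solves the discrete Gauss equation exactly, the comparison family [n] up to a residual of
    order [e], and both have the same values on the axes. Smoothness is required of [n] alone. *)
Record stab (R0 K : R) (N n rest : vfam) : Prop := {
  sE1 : ev R0 (fun e i j => D_1 (D_2 N) e i j = tri (D_1 N e i j) (D_2 N e i j) (mm N e i j));
  sE2 : ev R0 (fun e i j => D_1 (D_2 n) e i j =
          vadd (tri (D_1 n e i j) (D_2 n e i j) (mm n e i j)) (rest e i j));
  sn : forall k, VBd true R0 0 k n;
  srest : forall k, VBd true R0 1 k rest;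
  sden : ev R0 (fun e i j => 1 <= den N e i j /\ 1 <= den n e i j);
  sbd : ev R0 (fun e i j => nrm (N e i j) <= 3 /\ nrm (n e i j) <= 3);
  sbdD : ev R0 (fun e i j => nrm (D_1 N e i j) <= K /\ nrm (D_2 N e i j) <= K /\
                nrm (D_1 n e i j) <= K /\ nrm (D_2 n e i j) <= K);
  s01 : ev R0 (fun e i _ => N e i 0%nat = n e i 0%nat);
  s02 : ev R0 (fun e _ j => N e 0%nat j = n e 0%nat j)
}.
Arguments sE1 {R0 K N n rest}.
Arguments sE2 {R0 K N n rest}.
Arguments sn {R0 K N n rest}.
Arguments srest {R0 K N n rest}.
Arguments sden {R0 K N n rest}.
Arguments sbd {R0 K N n rest}.
Arguments sbdD {R0 K N n rest}.
Arguments s01 {R0 K N n rest}.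
Arguments s02 {R0 K N n rest}.

Lemma mm_sw N e i j : mm (vsw N) e i j = mm N e j i.
Proof.
  unfold mm, den. change (T_1 (vsw N) e i j) with (T_2 N e j i). change (T_2 (vsw N) e i j) with (T_1 N e j i).
  rewrite dot_comm. f_equal. vring.
Qed.

Lemma stab_sw R0 K N n rest : stab R0 K N n rest -> stab R0 K (vsw N) (vsw n) (vsw rest).
Proof.
  intros H. destruct H. constructor.
  - apply ev_sw in sE3. revert sE3. apply ev_mono. intros e i j _ E.
    rewrite mm_sw, tri_comm. rewrite D12_comm. exact E.
  - apply ev_sw in sE4. revert sE4. apply ev_mono. intros e i j _ E.
    rewrite mm_sw, tri_comm. rewrite D12_comm. exact E.
  - intro k. now apply VBd_sw.
  - intro k. now apply VBd_sw.
  - apply ev_sw in sden0. revert sden0. apply ev_mono. intros e i j _ [A B].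
    unfold den. rewrite dot_comm, (dot_comm (T_1 (vsw n) e i j)). split; assumption.
  - exact (ev_sw _ _ sbd0).
  - apply ev_sw in sbdD0. revert sbdD0. apply ev_mono. intros e i j _ (A & B & C & D). auto.
  - exact (ev_sw _ _ s04).
  - exact (ev_sw _ _ s03).
Qed.

Lemma inv_ge1 x : 1 <= x -> 0 < / x <= 1.
Proof.
  intros H. split. apply Rinv_0_lt_compat; lra. rewrite <- Rinv_1. apply Rinv_le_contravar; lra.
Qed.

Lemma mm_le a b : 1 <= 1 + dot a b -> nrm a <= 3 -> nrm b <= 3 -> nrm (vsc (/ (1 + dot a b)) (vadd a b)) <= 6.
Proof.
  intros H A B. destruct (inv_ge1 _ H). rewrite nrm_sc, Rabs_pos_eq by lra. pose proof (nrm_add a b).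
  pose proof (nrm_pos (vadd a b)). nra.
Qed.

(** The numerators contribute 1. The reciprocals differ by at most 3 times the sum of the
    differences and multiply a vector of norm at most 6, contributing 18. *)
Lemma mm_diff a b a' b' : 1 <= 1 + dot a b -> 1 <= 1 + dot a' b' -> nrm a <= 3 -> nrm b <= 3 ->
  nrm a' <= 3 -> nrm b' <= 3 ->
  nrm (vsub (vsc (/ (1 + dot a b)) (vadd a b)) (vsc (/ (1 + dot a' b')) (vadd a' b'))) <=
  19 * (nrm (vsub a a') + nrm (vsub b b')).
Proof.
  intros H H' A B A' B'.
  set (x := 1 + dot a b) in *. set (x' := 1 + dot a' b') in *.
  replace (vsub (vsc (/ x) (vadd a b)) (vsc (/ x') (vadd a' b'))) with
    (vadd (vsc (/ x) (vadd (vsub a a') (vsub b b'))) (vsc (/ x - / x') (vadd a' b')))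
    by (vring).
  destruct (inv_ge1 _ H) as [I1 I2]. destruct (inv_ge1 _ H') as [I3 I4].
  set (S := nrm (vsub a a') + nrm (vsub b b')).
  eapply Rle_trans; [apply nrm_add|]. rewrite !nrm_sc, (Rabs_pos_eq (/ x)) by lra.
  assert (P1 : nrm (vadd (vsub a a') (vsub b b')) <= S) by apply nrm_add.
  assert (P2 : nrm (vadd a' b') <= 6) by (pose proof (nrm_add a' b'); lra).
  assert (P3 : Rabs (/ x - / x') <= 3 * S).
  { replace (/ x - / x') with ((x' - x) * (/ x * / x')) by (field; lra).
    rewrite Rabs_mult, (Rabs_pos_eq (/ x * / x')) by nra.
    assert (Rabs (x' - x) <= 3 * S).
    { replace (x' - x) with (- (dot (vsub a a') b + dot a' (vsub b b')))
        by (unfold x, x', dot, vsub, c1, c2, c3; simpl; ring).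
      rewrite Rabs_Ropp. eapply Rle_trans; [apply Rabs_triang|].
      pose proof (nrm_dot (vsub a a') b). pose proof (nrm_dot a' (vsub b b')).
      pose proof (nrm_pos (vsub a a')). pose proof (nrm_pos (vsub b b')). unfold S. nra. }
    pose proof (Rabs_pos (x' - x)). assert (/ x * / x' <= 1) by nra. assert (0 <= / x * / x') by nra. nra. }
  pose proof (nrm_pos (vadd (vsub a a') (vsub b b'))). pose proof (nrm_pos (vadd a' b')).
  pose proof (Rabs_pos (/ x - / x')). nra.
Qed.

Lemma telescope (f : nat -> V3) B i : f 0%nat = v0 ->
  (forall k, (k < i)%nat -> nrm (vsub (f (S k)) (f k)) <= B) -> nrm (f i) <= INR i * B.
Proof.
  intros H0 H. assert (G : forall k, (k <= i)%nat -> nrm (f k) <= INR k * B).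
  { induction k; intros Hk. rewrite H0, nrm_v0. simpl. lra.
    rewrite S_INR. replace (f (S k)) with (vadd (f k) (vsub (f (S k)) (f k))) by vring.
    eapply Rle_trans; [apply nrm_add|]. specialize (IHk ltac:(lia)). specialize (H k ltac:(lia)). lra. }
  apply G. auto.
Qed.

Definition vdiff (N n : vfam) : vfam := fun e i j => vsub (N e i j) (n e i j).

Lemma D_1_diff N n e i j : D_1 (vdiff N n) e i j = vsub (D_1 N e i j) (D_1 n e i j).
Proof. unfold D_1, vdiff. vring. Qed.
Lemma D_2_diff N n e i j : D_2 (vdiff N n) e i j = vsub (D_2 N e i j) (D_2 n e i j).
Proof. unfold D_2, vdiff. vring. Qed.
Lemma D_12_diff N n e i j : D_1 (D_2 (vdiff N n)) e i j = vsub (D_1 (D_2 N) e i j) (D_1 (D_2 n) e i j).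
Proof. unfold D_1, D_2, vdiff. vring. Qed.

Lemma D_2_inc g e i j : e <> 0 -> vsub (g e i (S j)) (g e i j) = vsc e (D_2 g e i j).
Proof. intros He. unfold D_2. vfield; auto. Qed.
Lemma D_1_inc g e i j : e <> 0 -> vsub (g e (S i) j) (g e i j) = vsc e (D_1 g e i j).
Proof. intros He. unfold D_1. vfield; auto. Qed.

(** The error and its two first quotients determine one another by summation, so they are bounded
    simultaneously. In the constant 156, twice 78, the factor 2 comes from [M = 2 * c]. *)
Lemma stab_base R0 K N n rest : stab R0 K N n rest -> 6 <= K -> 156 * (K * K) * R0 <= 1 -> 0 <= R0 <= 1 ->
  vbdd R0 1 (vdiff N n) /\ vbdd R0 1 (D_1 (vdiff N n)) /\ vbdd R0 1 (D_2 (vdiff N n)).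
Proof.
  intros H HK Hs HR0.
  destruct (VBd_vbdd _ _ _ _ _ (srest H 0%nat)) as (c & Hc & Hrest).
  set (M := 2 * c). set (w := vdiff N n).
  assert (Main : ev R0 (fun e i j => nrm (w e i j) <= M * e /\ nrm (D_1 w e i j) <= M * e /\ nrm (D_2 w e i j) <= M * e)).
  { intros r Hr.
    pose proof (sbd H) as Hb.
    destruct (ev_and _ _ _ (ev_and _ _ _ (sE1 H) (sE2 H))
       (ev_and _ _ _ (ev_and _ _ _ Hrest (sden H))
        (ev_and _ _ _ (ev_and _ _ _ (ev_shift _ _ Hb) (sbdD H))
         (ev_and _ _ _ (ev_and _ _ _ (s01 H) (ev_S1 _ _ (s01 H)))
          (ev_and _ _ _ (ev_and _ _ _ (s02 H) (ev_S2 _ _ (s02 H))) (ev_small R0 1 Rlt_0_1))))) r Hr)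
      as (e1 & He1 & Q).
    exists e1. split; auto. intros e He.
    assert (He0 : e <> 0) by lra. assert (He' : 0 < e) by lra.
    assert (HM : 0 <= M) by (unfold M; lra).
    (* The number 78 is 1 + 1 + 76: two terms with differences of first quotients, and 19 times 4
       for [mm], whose two shifted arguments differ by at most [2 * M * e] each since [e < 1]. *)
    assert (BT : forall i j, e * INR i <= r -> e * INR j <= r ->
       nrm (w e i j) <= M * e -> nrm (D_1 w e i j) <= M * e -> nrm (D_2 w e i j) <= M * e ->
       nrm (D_1 (D_2 w) e i j) <= (78 * (K * K) * M + c) * e).
    { intros i j Hi Hj W0 W1 W2.
      destruct (Q e He i j Hi Hj) as ((E1 & E2) & (Er & Ed1 & Ed2) & (((B1 & B2) & (B3 & B4)) & (B5 & B6 & B7 & B8)) & _ & _ & Esm).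
      unfold w. rewrite D_12_diff, E1, E2.
      set (a := tri (D_1 N e i j) (D_2 N e i j) (mm N e i j)). set (b := tri (D_1 n e i j) (D_2 n e i j) (mm n e i j)).
      replace (vsub a (vadd b (rest e i j))) with (vsub (vsub a b) (rest e i j)) by (vring).
      eapply Rle_trans; [apply nrm_sub|]. rewrite pow_1 in Er.
      pose proof (nrm_tri_diff (D_1 N e i j) (D_2 N e i j) (mm N e i j) (D_1 n e i j) (D_2 n e i j) (mm n e i j)) as T.
      fold (tri (D_1 N e i j) (D_2 N e i j) (mm N e i j)) (tri (D_1 n e i j) (D_2 n e i j) (mm n e i j)) in T. fold a b in T.
      unfold w in W1, W2. rewrite D_1_diff in W1. rewrite D_2_diff in W2. unfold w, vdiff in W0.
      assert (Bm : nrm (mm N e i j) <= K).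
      { apply Rle_trans with 6; [|lra]. apply mm_le; auto. }
      assert (Dm : nrm (vsub (mm N e i j) (mm n e i j)) <= 76 * M * e).
      { eapply Rle_trans; [apply mm_diff; auto|].
        assert (X1 : nrm (vsub (T_1 N e i j) (T_1 n e i j)) <= M * e + e * (M * e)).
        { replace (vsub (T_1 N e i j) (T_1 n e i j)) with (vadd (w e i j) (vsc e (D_1 w e i j))).
          eapply Rle_trans; [apply nrm_add|]. rewrite nrm_sc, Rabs_pos_eq by lra.
          unfold w at 2. rewrite D_1_diff. apply Rplus_le_compat; auto. apply Rmult_le_compat_l; lra.
          rewrite <- D_1_inc by auto. unfold w, vdiff, T_1. vring. }
        assert (X2 : nrm (vsub (T_2 N e i j) (T_2 n e i j)) <= M * e + e * (M * e)).
        { replace (vsub (T_2 N e i j) (T_2 n e i j)) with (vadd (w e i j) (vsc e (D_2 w e i j))).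
          eapply Rle_trans; [apply nrm_add|]. rewrite nrm_sc, Rabs_pos_eq by lra.
          unfold w at 2. rewrite D_2_diff. apply Rplus_le_compat; auto. apply Rmult_le_compat_l; lra.
          rewrite <- D_2_inc by auto. unfold w, vdiff, T_2. vring. }
        assert (e * (M * e) <= 1 * (M * e)) by (apply Rmult_le_compat_r; nra). lra. }
      assert (T1 : nrm (vsub (D_1 N e i j) (D_1 n e i j)) * nrm (D_2 N e i j) * nrm (mm N e i j) <= (M * e) * K * K) by now apply nrm_prod.
      assert (T2 : nrm (D_1 n e i j) * nrm (vsub (D_2 N e i j) (D_2 n e i j)) * nrm (mm N e i j) <= K * (M * e) * K) by now apply nrm_prod.
      assert (T3 : nrm (D_1 n e i j) * nrm (D_2 n e i j) * nrm (vsub (mm N e i j) (mm n e i j)) <= K * K * (76 * M * e)) by now apply nrm_prod.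
      lra. }
    (* Summing over a side of length below [R0] returns at most [2 * c * e]: one half from
       smallness, the other from [R0 <= 1]. This is [M * e], so the bound reproduces itself. *)
    assert (Fin : forall z, e * INR z <= r -> INR z * (e * ((78 * (K * K) * M + c) * e)) <= M * e).
    { intros z Hz. pose proof (pos_INR z).
      replace (INR z * (e * ((78 * (K * K) * M + c) * e))) with ((e * INR z) * (78 * (K * K) * M + c) * e) by ring.
      apply Rmult_le_compat_r; [lra|].
      assert (0 <= 78 * (K * K) * M + c) by nra.
      apply Rle_trans with (R0 * (78 * (K * K) * M + c)). apply Rmult_le_compat_r; lra.
      assert (R0 * (78 * (K * K) * M) = (156 * (K * K) * R0) * c) by (unfold M; ring).
      assert ((156 * (K * K) * R0) * c <= 1 * c) by (apply Rmult_le_compat_r; lra). unfold M. nra. }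
    (* Each quantity is telescoped from the axis where it vanishes: [D_1 w] upward from the first
       axis, [w] and [D_2 w] sideways from the second. Only points with smaller [i + j] are
       visited. *)
    assert (SI : forall s i j, (i + j < s)%nat -> e * INR i <= r -> e * INR j <= r ->
       nrm (w e i j) <= M * e /\ nrm (D_1 w e i j) <= M * e /\ nrm (D_2 w e i j) <= M * e).
    { induction s; intros i j Hij Hi Hj. lia.
      assert (le_mono : forall a b, (a <= b)%nat -> e * INR b <= r -> e * INR a <= r).
      { intros a b Hab Hb'. apply le_INR in Hab. nra. }
      assert (r0 : e * INR 0 <= r) by (apply (le_mono 0%nat i); [lia|auto]).
      split; [|split].
      - apply Rle_trans with (INR i * (e * (M * e))).
        + apply (telescope (fun k => w e k j)).
          * destruct (Q e He 0%nat j r0 Hj) as (_ & _ & _ & _ & ((E & _) & _)). unfold w, vdiff. rewrite E.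
            vring.
          * intros k Hk. rewrite D_1_inc by auto. rewrite nrm_sc, Rabs_pos_eq by lra. apply Rmult_le_compat_l; [lra|].
            apply (IHs k j). lia. apply (le_mono k i); auto; lia. auto.
        + replace (INR i * (e * (M * e))) with ((e * INR i) * (M * e)) by ring.
          rewrite <- (Rmult_1_l (M * e)) at 2. apply Rmult_le_compat_r. apply Rmult_le_pos; lra. lra.
      - apply Rle_trans with (INR j * (e * ((78 * (K * K) * M + c) * e))); [|now apply Fin].
        apply (telescope (fun l => D_1 w e i l)).
        + destruct (Q e He i 0%nat Hi r0) as (_ & _ & _ & ((E & E') & _)). unfold D_1, w, vdiff. rewrite E, E'.
          vring.
        + intros l Hl. rewrite D_2_inc by auto. rewrite nrm_sc, Rabs_pos_eq by lra. apply Rmult_le_compat_l; [lra|].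
          rewrite <- D12_comm. assert (Hl' : e * INR l <= r) by (apply (le_mono l j); auto; lia).
          destruct (IHs i l ltac:(lia) Hi Hl') as (W0 & W1 & W2). now apply BT.
      - apply Rle_trans with (INR i * (e * ((78 * (K * K) * M + c) * e))); [|now apply Fin].
        apply (telescope (fun k => D_2 w e k j)).
        + destruct (Q e He 0%nat j r0 Hj) as (_ & _ & _ & _ & ((E & E') & _)). unfold D_2, w, vdiff. rewrite E, E'.
          vring.
        + intros k Hk. rewrite D_1_inc by auto. rewrite nrm_sc, Rabs_pos_eq by lra. apply Rmult_le_compat_l; [lra|].
          assert (Hk' : e * INR k <= r) by (apply (le_mono k i); auto; lia).
          destruct (IHs k j ltac:(lia) Hk' Hj) as (W0 & W1 & W2). now apply BT. }
    intros i j Hi Hj. apply (SI (S (i + j))); auto. }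
  assert (HM : 0 <= M) by (unfold M; lra).
  split; [|split]; exists M; (split; [exact HM|]); revert Main; apply ev_mono; intros e i j _ (A & B & C); rewrite pow_1; auto.
Qed.

Lemma VBd_mm b R0 k N : VBd b R0 0 k N -> ev R0 (fun e i j => 1 <= den N e i j) -> VBd b R0 0 k (mm N).
Proof.
  intros HN Hd. apply (VBd_sc _ _ 0 0). apply Bd_inv; auto.
  apply Bd_plus. apply Bd_const. apply (Bd_dot _ _ 0 0). now apply VBd_t1. now apply VBd_t2.
  apply VBd_add. now apply VBd_t1. now apply VBd_t2.
Qed.

(** The difference of reciprocals is expanded so that every term contains one factor [vdiff N n],
    the only factor that is of order [e]. *)
Lemma VBd_mm_diff b R0 k N n : VBd b R0 0 k N -> VBd b R0 0 k n -> VBd b R0 1 k (vdiff N n) ->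
  ev R0 (fun e i j => 1 <= den N e i j /\ 1 <= den n e i j) ->
  VBd b R0 1 k (fun e i j => vsub (mm N e i j) (mm n e i j)).
Proof.
  intros HN Hn Hd Hden.
  assert (Hd1 : ev R0 (fun e i j => 1 <= den N e i j)) by (revert Hden; apply ev_mono; tauto).
  assert (Hd2 : ev R0 (fun e i j => 1 <= den n e i j)) by (revert Hden; apply ev_mono; tauto).
  assert (Bden : forall N, VBd b R0 0 k N -> Bd b R0 0 k (den N)).
  { intros N' H. apply Bd_plus. apply Bd_const. apply (Bd_dot _ _ 0 0). now apply VBd_t1. now apply VBd_t2. }
  apply (VBd_ext _ _ _ _ (fun e i j =>
    vadd (vsc (/ den N e i j) (vadd (T_1 (vdiff N n) e i j) (T_2 (vdiff N n) e i j)))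
      (vsc (- (dot (T_1 (vdiff N n) e i j) (T_2 N e i j) + dot (T_1 n e i j) (T_2 (vdiff N n) e i j)) * (/ den N e i j * / den n e i j))
         (vadd (T_1 n e i j) (T_2 n e i j))))).
  - revert Hden. apply ev_mono. intros e i j _ [A B].
    replace (- (dot (T_1 (vdiff N n) e i j) (T_2 N e i j) + dot (T_1 n e i j) (T_2 (vdiff N n) e i j)) * (/ den N e i j * / den n e i j))
      with (/ den N e i j - / den n e i j).
    + unfold mm, vdiff, T_1, T_2. vring.
    + replace (- (dot (T_1 (vdiff N n) e i j) (T_2 N e i j) + dot (T_1 n e i j) (T_2 (vdiff N n) e i j)))
        with (den n e i j - den N e i j). field; lra.
      unfold den, vdiff, T_1, T_2. generalize (N e (S i) j) (N e i (S j)) (n e (S i) j) (n e i (S j)).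
      intros. vunfold; ring.
  - apply VBd_add.
    + apply (VBd_sc _ _ 0 1). apply Bd_inv; auto. apply VBd_add. now apply VBd_t1. now apply VBd_t2.
    + apply (VBd_sc _ _ 1 0). apply (Bd_mult _ _ 1 0). apply Bd_opp, Bd_plus.
      apply (Bd_dot _ _ 1 0). now apply VBd_t1. now apply VBd_t2.
      apply (Bd_dot _ _ 0 1). now apply VBd_t1. now apply VBd_t2.
      apply (Bd_mult _ _ 0 0); apply Bd_inv; auto.
      apply VBd_add. now apply VBd_t1. now apply VBd_t2.
Qed.

(** Gains one order for [D_1] of the error. The linear equation controls repeated quotients in the
    first direction, the Gauss equation everything mixed, and [VBd_iso] combines them. *)
Lemma stab_step R0 K N n rest k : stab R0 K N n rest -> 6 <= K -> 2 * (K * K) * R0 <= 1 ->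
  VBd true R0 1 (S k) (vdiff N n) -> VBd true R0 1 (S k) (D_1 (vdiff N n)).
Proof.
  intros H HK Hs Hw. set (w := vdiff N n) in *.
  pose proof (sn H) as Hn.
  assert (HN : VBd true R0 0 (S k) N).
  { apply (VBd_ext_all _ _ _ _ (fun e i j => vadd (n e i j) (w e i j))).
    intros. unfold w, vdiff. vring. apply VBd_add; auto. now apply VBd_weaken. }
  pose proof (VBd_D1 _ _ _ _ _ Hw) as Hw1. pose proof (VBd_D2 _ _ _ _ Hw) as Hw2.
  pose proof (VBd_D1 _ _ _ _ _ (Hn (S (S k)))) as Hn1. pose proof (VBd_D2 _ _ _ _ (Hn (S (S k)))) as Hn2.
  pose proof (VBd_D2 _ _ _ _ HN) as HN2.
  assert (Hd1 : ev R0 (fun e i j => 1 <= den N e i j)) by (generalize (sden H); apply ev_mono; tauto).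
  pose proof (VBd_mm _ _ _ _ HN Hd1) as HmN.
  pose proof (VBd_mm_diff _ _ _ _ _ HN (Hn (S k)) Hw (sden H)) as Hmd.
  set (dm := fun e i j => vsub (mm N e i j) (mm n e i j)) in *.
  set (b := fun e i j => vsub (vadd (tri (D_1 n e i j) (D_2 w e i j) (mm N e i j))
                       (tri (D_1 n e i j) (D_2 n e i j) (dm e i j))) (rest e i j)).
  assert (E : ev R0 (fun e i j => vadd (tri (D_1 w e i j) (D_2 N e i j) (mm N e i j)) (b e i j) = D_2 (D_1 w) e i j)).
  { generalize (ev_and _ _ _ (sE1 H) (sE2 H)). apply ev_mono. intros e i j _ [E1 E2].
    rewrite <- D12_comm. unfold b, dm, w. rewrite D_12_diff, E1, E2, D_1_diff, D_2_diff.
    vring. }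
  (* The right-hand side contains at most first quotients of the error, known up to order [k]. *)
  assert (HT : VBd true R0 1 k (D_2 (D_1 w))).
  { eapply VBd_ext; [exact E|]. apply VBd_add.
    - apply (VBd_tri _ _ 1 0 0); auto. now apply VBd_pred.
    - apply VBd_sub; [|apply (srest H)]. apply VBd_add.
      apply (VBd_tri _ _ 0 1 0); auto; now apply VBd_pred.
      apply (VBd_tri _ _ 0 0 1); now apply VBd_pred. }
  (* The inhomogeneity [b] contains [D_2 w]. At order [S k] only its quotients in the first
     direction are available, through the mixed ones just bounded, and these are all that
     [lattice_linear] asks for. *)
  assert (Hw2x : VBd false R0 1 (S k) (D_2 w)).
  { apply VBd_S. split; [|split].
    - apply vbdd_VBd. exact (VBd_vbdd _ _ _ _ _ Hw2).
    - apply VBd_false. eapply VBd_ext_all; [|exact HT]. intros; now rewrite D12_comm.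
    - discriminate. }
  assert (HN2x : VBd false R0 0 (S k) (D_2 N)).
  { apply (VBd_ext_all _ _ _ _ (fun e i j => vadd (D_2 n e i j) (D_2 w e i j))).
    intros. unfold w. rewrite D_2_diff. vring.
    apply VBd_add. now apply VBd_false. now apply VBd_weaken. }
  assert (Hb : VBd false R0 1 (S k) b).
  { apply VBd_sub; [|apply VBd_false, (srest H)]. apply VBd_add.
    apply (VBd_tri _ _ 0 1 0); auto using VBd_false.
    apply (VBd_tri _ _ 0 0 1); auto using VBd_false. }
  apply VBd_iso; auto.
  apply (lattice_linear R0 K (S k) ltac:(lra) Hs (D_1 w) (D_2 N) (mm N) b); auto using VBd_false.
  - generalize (ev_and _ _ _ (ev_and _ _ _ (ev_shift _ _ (sbd H)) (sbdD H)) Hd1). apply ev_mono.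
    intros e i j _ ((((B1 & _) & (B2 & _)) & (_ & B3 & _)) & B4). split; auto.
    apply Rle_trans with 6; [|lra]. now apply mm_le.
  - revert E. apply ev_mono. intros e i j _ E. now rewrite E.
  - generalize (ev_and _ _ _ (s01 H) (ev_S1 _ _ (s01 H))). apply ev_mono.
    intros e i j _ [E1 E2]. unfold D_1, w, vdiff. rewrite E1, E2. vring.
Qed.

Theorem stab_conv R0 K N n rest : stab R0 K N n rest -> 6 <= K -> 156 * (K * K) * R0 <= 1 -> 0 <= R0 <= 1 ->
  forall k, VBd true R0 1 k (vdiff N n).
Proof.
  intros H HK Hs HR0.
  assert (G : forall k, VBd true R0 1 (S k) (vdiff N n)).
  { induction k.
    - destruct (stab_base _ _ _ _ _ H HK Hs HR0) as (A & B & C).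
      apply VBd_S. split; [|split; [|intros _]]; now apply vbdd_VBd.
    - assert (Hs' : 2 * (K * K) * R0 <= 1) by nra.
      apply VBd_S. split; [|split; [|intros _]].
      + apply vbdd_VBd. exact (VBd_vbdd _ _ _ _ _ IHk).
      + now apply (stab_step R0 K N n rest).
      + pose proof (stab_step _ _ _ _ _ k (stab_sw _ _ _ _ _ H) HK Hs' (VBd_sw _ _ _ _ IHk)) as P.
        exact (VBd_sw _ _ _ _ P). }
  intros k. apply VBd_pred, G.
Qed.

(** * Convergence *)

Lemma nrm_dist2 v w M : 0 <= M -> dist2 v w <= M * M -> nrm (vsub v w) <= 3 * M.
Proof. apply dot_le_nrm. Qed.
Lemma dist2_nrm v w M : nrm (vsub v w) <= M -> dist2 v w <= M * M.
Proof. apply dot_self_nrm. Qed.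

Lemma nrm_D_1 g e i j M : 0 < e -> nrm (vsub (g e (S i) j) (g e i j)) <= M * e -> nrm (D_1 g e i j) <= M.
Proof.
  intros He H. unfold D_1. rewrite nrm_sc, Rabs_pos_eq by (apply Rlt_le, Rinv_0_lt_compat; auto).
  apply Rmult_le_reg_l with e; auto. rewrite <- Rmult_assoc, Rinv_r, Rmult_1_l by lra. lra.
Qed.

Lemma nrm_D_2 g e i j M : 0 < e -> nrm (vsub (g e i (S j)) (g e i j)) <= M * e -> nrm (D_2 g e i j) <= M.
Proof. intros He H. exact (nrm_D_1 (vsw g) e j i M He H). Qed.

Lemma den_ge1 a b n L : dot a a = 1 -> dot b b = 1 -> 2 * L * L <= 1 ->
  dist2 a n <= L * L -> dist2 b n <= L * L -> 1 <= 1 + dot a b.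
Proof.
  intros A B HL D1 D2. pose proof (dist2_tri a n b) as T. rewrite (dist2_sphere a b) in T by auto. lra.
Qed.

(** For a unit vector [n], the factor [q] of the step satisfies
    [q - 1 = - <a - n, b - n> / (1 + <a, b>)], and the mixed second difference is [q - 1] times
    [a + b]. *)
Lemma D_12_kstep e (n a b m : V3) : e <> 0 -> dot n n = 1 -> 1 + dot a b <> 0 ->
  vadd m n = vsc (dot n (vadd a b) / (1 + dot a b)) (vadd a b) ->
  vsc (/ e) (vsub (vsc (/ e) (vsub m a)) (vsc (/ e) (vsub b n))) =
  tri (vsc (/ e) (vsub a n)) (vsc (/ e) (vsub b n)) (vsc (/ (1 + dot a b)) (vadd a b)).
Proof.
  intros He Hn Hd Hm.
  set (q := dot n (vadd a b) / (1 + dot a b)) in *.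
  assert (Hq : q - 1 = - (dot (vsub a n) (vsub b n)) * / (1 + dot a b)).
  { replace (dot (vsub a n) (vsub b n)) with (dot a b - dot n (vadd a b) + dot n n)
      by (vunfold; ring).
    rewrite Hn. unfold q. field. auto. }
  assert (Em : m = vsub (vsc q (vadd a b)) n) by (rewrite <- Hm; vring).
  transitivity (vsc (/ e * / e * (q - 1)) (vadd a b)).
  - rewrite Em. clearbody q. vring.
  - rewrite Hq. vring.
Qed.

Section Converge.
Context (n1 n2 : R -> V3) (rho U R0 : R) (f0 : V3) (Nc P Q F : R -> R -> V3)
  (S1 : smoothV n1) (S2 : smoothV n2) (HB : pic_bound n1 n2 rho U) (H0 : n1 0 = n2 0)
  (Sp1 : forall t, dot (n1 t) (n1 t) = 1) (Sp2 : forall t, dot (n2 t) (n2 t) = 1)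
  (HG : goursat n1 n2 rho U f0 Nc P Q F) (HR0 : 0 < R0 < rho).

Let N : vfam := fun e => dN n1 n2 e.
Let n : vfam := vrestr Nc.
Let HU : 1 <= U. Proof. apply HB. Qed.

Lemma data_dist2 e k : 0 < e -> e * INR (S k) <= R0 ->
  dist2 (n1 (e * INR (S k))) (n1 (e * INR k)) <= (3 * U * e) * (3 * U * e) /\
  dist2 (n2 (e * INR (S k))) (n2 (e * INR k)) <= (3 * U * e) * (3 * U * e).
Proof.
  intros He Hk. pose proof (pos_INR k) as Pk. rewrite S_INR in *.
  assert (Hb : forall t, Rmin (e * INR k) (e * (INR k + 1)) <= t <= Rmax (e * INR k) (e * (INR k + 1)) -> Rabs t <= rho).
  { intros t Ht. rewrite Rmin_left, Rmax_right in Ht by nra. rewrite Rabs_pos_eq; nra. }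
  assert (K : forall h, smoothV h -> (forall t, Rabs t <= rho -> nrm (dV h t) <= U - 1) ->
    dist2 (h (e * (INR k + 1))) (h (e * INR k)) <= (3 * U * e) * (3 * U * e)).
  { intros h Sh Hh. apply dist2_nrm.
    replace (3 * U * e) with (3 * U * Rabs (e * (INR k + 1) - e * INR k)).
    apply (vmvt h (dV h)). intros t Ht. split.
    now apply smoothV_vder.
    specialize (Hh t (Hb t Ht)). lra.
    replace (e * (INR k + 1) - e * INR k) with e by ring. rewrite Rabs_pos_eq; lra. }
  destruct HB as (_ & _ & _ & Bd). split; apply K; auto; intros t Ht; apply (Bd t Ht).
Qed.

Lemma lattice_bounds e i j : 0 < e -> 2 * (3 * U * e) * (3 * U * e) <= 1 ->
  e * INR i <= R0 -> e * INR j <= R0 ->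
  dot (N e i j) (N e i j) = 1 /\
   (e * INR (S i) <= R0 -> dist2 (N e (S i) j) (N e i j) <= (3 * U * e) * (3 * U * e)) /\
   (e * INR (S j) <= R0 -> dist2 (N e i (S j)) (N e i j) <= (3 * U * e) * (3 * U * e)).
Proof.
  intros He Hs. apply (dN_invariant n1 n2 e He R0 (3 * U)); auto; intros k Hk; now apply data_dist2.
Qed.

Lemma small_e : exists e0, 0 < e0 /\ forall e, 0 < e < e0 -> 2 * (3 * U * e) * (3 * U * e) <= 1.
Proof.
  exists (/ (9 * U)). split. apply Rinv_0_lt_compat; lra. intros e He.
  assert (9 * U * e <= 1).
  { apply Rmult_le_reg_l with (/ (9 * U)). apply Rinv_0_lt_compat; lra.
    rewrite <- Rmult_assoc, Rinv_l, Rmult_1_l, Rmult_1_r; lra. }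
  assert (0 <= 3 * U * e) by nra. nra.
Qed.

Lemma ev_lattice : ev R0 (fun e i j => dot (N e i j) (N e i j) = 1 /\
   dist2 (N e (S i) j) (N e i j) <= (3 * U * e) * (3 * U * e) /\
   dist2 (N e i (S j)) (N e i j) <= (3 * U * e) * (3 * U * e) /\ 2 * (3 * U * e) * (3 * U * e) <= 1).
Proof.
  destruct small_e as (e0 & He0 & He).
  generalize (ev_and _ _ _ (ev_small R0 e0 He0) (ev_and _ _ _ (ev_dom R0) (ev_shift _ _ (ev_dom R0)))).
  apply ev_mono. intros e i j Pe (A & (B & C) & ((D & _) & (_ & E))).
  pose proof (He e (conj Pe A)) as Hs.
  destruct (lattice_bounds e i j Pe Hs B C) as (X & Y & Z). auto.
Qed.

Lemma ev_smooth : ev R0 (fun e i j => dot (n e i j) (n e i j) = 1 /\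
   nrm (vsub (n e (S i) j) (n e i j)) <= 3 * U * e /\ nrm (vsub (n e i (S j)) (n e i j)) <= 3 * U * e).
Proof.
  generalize (ev_and _ _ _ (ev_dom R0) (ev_shift _ _ (ev_dom R0))).
  apply ev_mono. intros e i j Pe ((B & C) & ((D & _) & (_ & E))).
  pose proof (pos_INR i) as Pi. pose proof (pos_INR j) as Pj. rewrite S_INR in D, E.
  assert (Ho : forall x y, 0 <= x <= R0 -> 0 <= y <= R0 -> obox rho x y).
  { intros x y Hx Hy. split; rewrite Rabs_pos_eq; lra. }
  assert (Ii : 0 <= e * INR i) by nra. assert (Ij : 0 <= e * INR j) by nra.
  unfold n, vrestr. split; [|split].
  - apply (gsph HG). now apply Ho.
  - rewrite S_INR. replace (3 * U * e) with (3 * U * Rabs (e * (INR i + 1) - e * INR i))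
      by (replace (e * (INR i + 1) - e * INR i) with e by ring; rewrite Rabs_pos_eq; lra).
    apply (vmvt (fun t => Nc t (e * INR j)) (fun t => P t (e * INR j))). intros t Ht.
    rewrite Rmin_left, Rmax_right in Ht by nra.
    assert (Hob : obox rho t (e * INR j)) by (apply Ho; lra).
    split. now apply (gNx HG). now apply (gbd HG).
  - rewrite S_INR. replace (3 * U * e) with (3 * U * Rabs (e * (INR j + 1) - e * INR j))
      by (replace (e * (INR j + 1) - e * INR j) with e by ring; rewrite Rabs_pos_eq; lra).
    apply (vmvt (fun t => Nc (e * INR i) t) (fun t => Q (e * INR i) t)). intros t Ht.
    rewrite Rmin_left, Rmax_right in Ht by nra.
    assert (Hob : obox rho (e * INR i) t) by (apply Ho; lra).
    split. now apply (gNy HG). now apply (gbd HG).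
Qed.

Lemma ev_den_n : ev R0 (fun e i j => 1 <= den n e i j).
Proof.
  generalize (ev_and _ _ _ ev_lattice (ev_and _ _ _ ev_smooth (ev_shift _ _ ev_smooth))). apply ev_mono.
  intros e i j He ((_ & _ & _ & Hs) & (A & B & C) & ((D & _) & (E & _))).
  unfold den. apply (den_ge1 _ _ (n e i j) (3 * U * e)); auto; now apply dist2_nrm.
Qed.

Lemma ev_den_N : ev R0 (fun e i j => 1 <= den N e i j).
Proof.
  generalize (ev_and _ _ _ ev_lattice (ev_shift _ _ ev_lattice)). apply ev_mono.
  intros e i j He ((A & B & C & Hs) & ((D & _) & (E & _))).
  unfold den. now apply (den_ge1 _ _ (N e i j) (3 * U * e)).
Qed.

Let rest : vfam := fun e i j => vsub (D_1 (D_2 n) e i j) (tri (D_1 n e i j) (D_2 n e i j) (mm n e i j)).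

Let Hn k : VBd true R0 0 k n.
Proof. apply (CbV_VBd R0 rho). lra. apply (gN HG). Qed.
Let HP k : VBd true R0 0 k (vrestr P).
Proof. apply (CbV_VBd R0 rho). lra. apply (gP HG). Qed.
Let HQ k : VBd true R0 0 k (vrestr Q).
Proof. apply (CbV_VBd R0 rho). lra. apply (gQ HG). Qed.
Let HnP k : VBd true R0 1 k (fun e i j => vsub (D_1 n e i j) (vrestr P e i j)).
Proof. apply (CbV_consistent1 R0 rho). lra. apply (gN HG). apply (gNx HG). Qed.
Let HnQ k : VBd true R0 1 k (fun e i j => vsub (D_2 n e i j) (vrestr Q e i j)).
Proof. apply (CbV_consistent2 R0 rho). lra. apply (gN HG). apply (gNy HG). Qed.

(** Writing both shifts as [n] plus [e] times a quotient, the denominator becomes [2 + e X] because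
    [n] is a unit vector. The terms of order zero then cancel and a factor [e] comes out. *)
Lemma mm_consistent k : VBd true R0 1 k (fun e i j => vsub (mm n e i j) (n e i j)).
Proof.
  pose proof (VBd_D1 _ _ _ _ _ (Hn (S k))) as H1. pose proof (VBd_D2 _ _ _ _ (Hn (S k))) as H2.
  apply (VBd_ext _ _ _ _ (fun e i j => vsc (/ den n e i j) (vsc e (vsub (vadd (D_1 n e i j) (D_2 n e i j))
     (vsc (dot (n e i j) (D_2 n e i j) + dot (D_1 n e i j) (n e i j) + e * dot (D_1 n e i j) (D_2 n e i j)) (n e i j)))))).
  - generalize (ev_and _ _ _ ev_den_n ev_smooth). apply ev_mono. intros e i j He (A & (B & _)).
    unfold mm. set (a := T_1 n e i j). set (b := T_2 n e i j).
    assert (Ea : a = vadd (n e i j) (vsc e (D_1 n e i j))).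
    { rewrite <- D_1_inc by lra. unfold a, T_1. vring. }
    assert (Eb : b = vadd (n e i j) (vsc e (D_2 n e i j))).
    { rewrite <- D_2_inc by lra. unfold b, T_2. vring. }
    assert (Ed : den n e i j = 2 + e * (dot (n e i j) (D_2 n e i j) + dot (D_1 n e i j) (n e i j) + e * dot (D_1 n e i j) (D_2 n e i j))).
    { unfold den. fold a b. rewrite Ea, Eb.
      transitivity (1 + dot (n e i j) (n e i j) + e * (dot (n e i j) (D_2 n e i j) + dot (D_1 n e i j) (n e i j) + e * dot (D_1 n e i j) (D_2 n e i j))).
      vunfold; ring.
      rewrite B. ring. }
    set (X := dot (n e i j) (D_2 n e i j) + dot (D_1 n e i j) (n e i j) + e * dot (D_1 n e i j) (D_2 n e i j)) in *.
    rewrite Ea, Eb.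
    transitivity (vsc (/ den n e i j) (vsub (vadd (vadd (n e i j) (vsc e (D_1 n e i j))) (vadd (n e i j) (vsc e (D_2 n e i j)))) (vsc (den n e i j) (n e i j)))).
    + rewrite Ed at 3. generalize (/ den n e i j). clearbody X. intros. vring.
    + generalize (vadd (vadd (n e i j) (vsc e (D_1 n e i j))) (vadd (n e i j) (vsc e (D_2 n e i j)))).
      revert A. generalize (n e i j) (den n e i j). clear. intros q d A p. vfield; lra.
  - apply (VBd_sc _ _ 0 1). apply Bd_inv; [|exact ev_den_n].
    apply Bd_plus. apply Bd_const. apply (Bd_dot _ _ 0 0). now apply VBd_t1. now apply VBd_t2.
    apply (VBd_sc _ _ 1 0). apply Bd_eps. apply VBd_sub. now apply VBd_add.
    apply (VBd_sc _ _ 0 0); auto. apply Bd_plus. apply Bd_plus; now apply (Bd_dot _ _ 0 0).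
    apply Bd_weaken. apply (Bd_mult _ _ 1 0). apply Bd_eps. now apply (Bd_dot _ _ 0 0).
Qed.

(** Telescoping against [Q_x = tri P Q N]: every term contains one consistency error. The quotient
    [D_1] of the error of [D_2 n] is still of order [e], because consistency includes all difference
    quotients. *)
Lemma rest_VBd k : VBd true R0 1 k rest.
Proof.
  pose proof (VBd_D1 _ _ _ _ _ (Hn (S k))) as H1. pose proof (VBd_D2 _ _ _ _ (Hn (S k))) as H2.
  pose proof (VBd_mm _ _ _ _ (Hn k) ev_den_n) as Hm.
  pose proof (VBd_D1 _ _ _ _ _ (HnQ (S k))) as C1.
  assert (C2 : VBd true R0 1 k (fun e i j => vsub (D_1 (vrestr Q) e i j)
     (vrestr (fun x y => tri (P x y) (Q x y) (Nc x y)) e i j))).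
  { apply (CbV_consistent1 R0 rho). lra. apply (gQ HG). apply (gQx HG). }
  apply (VBd_ext_all _ _ _ _ (fun e i j =>
    vsub (vadd (D_1 (fun e i j => vsub (D_2 n e i j) (vrestr Q e i j)) e i j)
               (vsub (D_1 (vrestr Q) e i j) (vrestr (fun x y => tri (P x y) (Q x y) (Nc x y)) e i j)))
     (vadd (vadd (tri (vsub (D_1 n e i j) (vrestr P e i j)) (D_2 n e i j) (mm n e i j))
            (tri (vrestr P e i j) (vsub (D_2 n e i j) (vrestr Q e i j)) (mm n e i j)))
            (tri (vrestr P e i j) (vrestr Q e i j) (vsub (mm n e i j) (n e i j)))))).
  - intros e i j. unfold rest.
    assert (E : D_1 (fun e i j => vsub (D_2 n e i j) (vrestr Q e i j)) e i j = vsub (D_1 (D_2 n) e i j) (D_1 (vrestr Q) e i j)).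
    { unfold D_1 at 1 2 3. vring. }
    rewrite E.
    change (vrestr (fun x y => tri (P x y) (Q x y) (Nc x y)) e i j) with (tri (vrestr P e i j) (vrestr Q e i j) (n e i j)).
    vring.
  - apply VBd_sub. now apply VBd_add. apply VBd_add. apply VBd_add.
    now apply (VBd_tri _ _ 1 0 0). now apply (VBd_tri _ _ 0 1 0).
    apply (VBd_tri _ _ 0 0 1); auto. apply mm_consistent.
Qed.

(** Edges have Euclidean length at most [3 * U * e]; passing to the sum norm gives quotients below
    [9 * U]. *)
Lemma lattice_stab : stab R0 (9 * U) N n rest.
Proof.
  constructor.
  - generalize (ev_and _ _ _ ev_lattice ev_den_N). apply ev_mono. intros e i j He ((A & _) & B).
    apply D_12_kstep; auto. lra. unfold den, T_1, T_2 in B. lra. apply kstep_add.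
  - apply ev_all. intros e i j _. unfold rest.
    vring.
  - exact Hn.
  - exact rest_VBd.
  - exact (ev_and _ _ _ ev_den_N ev_den_n).
  - generalize (ev_and _ _ _ ev_lattice ev_smooth). apply ev_mono. intros e i j He ((A & _) & (B & _)).
    split; [rewrite <- (Rmult_1_r 3)|rewrite <- (Rmult_1_r 3)]; apply dot_le_nrm; lra.
  - generalize (ev_and _ _ _ ev_lattice ev_smooth). apply ev_mono. intros e i j He ((_ & A & B & _) & (_ & C & D)).
    assert (0 <= 3 * U * e) by nra.
    split; [|split; [|split]].
    + apply nrm_D_1; auto. replace (9 * U * e) with (3 * (3 * U * e)) by ring. now apply nrm_dist2.
    + apply nrm_D_2; auto. replace (9 * U * e) with (3 * (3 * U * e)) by ring. now apply nrm_dist2.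
    + apply nrm_D_1; auto. lra.
    + apply nrm_D_2; auto. lra.
  - generalize (ev_dom R0). apply ev_mono. intros e i j He [A _]. pose proof (pos_INR i).
    unfold N, n, vrestr. rewrite (dN_i0 n1 n2 e) by auto. simpl (INR 0). rewrite Rmult_0_r.
    symmetry. apply (gN1 HG). rewrite Rabs_pos_eq; nra.
  - generalize (ev_dom R0). apply ev_mono. intros e i j He [_ A]. pose proof (pos_INR j).
    unfold N, n, vrestr. rewrite dN_0j. simpl (INR 0). rewrite Rmult_0_r.
    symmetry. apply (gN2 HG). rewrite Rabs_pos_eq; nra.
Qed.

Context (HK : 156 * ((9 * U) * (9 * U)) * R0 <= 1).

Lemma gauss_converges k : VBd true R0 1 k (vdiff N n).
Proof.
  apply (stab_conv R0 (9 * U) N n rest). apply lattice_stab. lra. auto.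
  assert (1 <= (9 * U) * (9 * U)) by nra. split. lra. nra.
Qed.

Let fe : vfam := fun e => dF n1 n2 e f0.

(** The cross product in the representation formula is telescoped into the error of the Gauss map,
    the consistency errors of its quotients, and that of the surface itself. *)
Lemma surface_D k : VBd true R0 1 k (D_1 (vdiff fe (vrestr F))) /\ VBd true R0 1 k (D_2 (vdiff fe (vrestr F))).
Proof.
  pose proof (gauss_converges (S k)) as Hw.
  pose proof (VBd_D1 _ _ _ _ _ Hw) as Hw1. pose proof (VBd_D2 _ _ _ _ Hw) as Hw2.
  pose proof (VBd_pred _ _ _ _ _ Hw) as Hw0.
  assert (HN : VBd true R0 0 (S k) N).
  { apply (VBd_ext_all _ _ _ _ (fun e i j => vadd (n e i j) (vdiff N n e i j))).
    intros. unfold vdiff. vring. apply VBd_add; auto. now apply VBd_weaken. }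
  pose proof (VBd_pred _ _ _ _ _ HN) as HN0.
  assert (CF1 : VBd true R0 1 k (fun e i j => vsub (D_1 (vrestr F) e i j) (vrestr (fun x y => cross (P x y) (Nc x y)) e i j))).
  { apply (CbV_consistent1 R0 rho). lra. apply (gF HG). apply (gFx HG). }
  assert (CF2 : VBd true R0 1 k (fun e i j => vsub (D_2 (vrestr F) e i j) (vrestr (fun x y => cross (Nc x y) (Q x y)) e i j))).
  { apply (CbV_consistent2 R0 rho). lra. apply (gF HG). apply (gFy HG). }
  split.
  - apply (VBd_ext _ _ _ _ (fun e i j =>
      vsub (vadd (vadd (cross (D_1 (vdiff N n) e i j) (N e i j)) (cross (vsub (D_1 n e i j) (vrestr P e i j)) (N e i j)))
             (cross (vrestr P e i j) (vdiff N n e i j)))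
        (vsub (D_1 (vrestr F) e i j) (vrestr (fun x y => cross (P x y) (Nc x y)) e i j)))).
    + apply ev_all. intros e i j He. rewrite !D_1_diff.
      change (vrestr (fun x y => cross (P x y) (Nc x y)) e i j) with (cross (vrestr P e i j) (n e i j)).
      assert (E : D_1 fe e i j = cross (D_1 N e i j) (N e i j)).
      { unfold D_1, fe. rewrite dF_step1 by auto. fold (N e). vring. }
      rewrite E. unfold vdiff.
      vring.
    + apply VBd_sub; auto. apply VBd_add; [apply VBd_add|].
      now apply (VBd_cross _ _ 1 0). now apply (VBd_cross _ _ 1 0). now apply (VBd_cross _ _ 0 1).
  - apply (VBd_ext _ _ _ _ (fun e i j =>
      vsub (vadd (vadd (cross (N e i j) (D_2 (vdiff N n) e i j)) (cross (N e i j) (vsub (D_2 n e i j) (vrestr Q e i j))))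
             (cross (vdiff N n e i j) (vrestr Q e i j)))
        (vsub (D_2 (vrestr F) e i j) (vrestr (fun x y => cross (Nc x y) (Q x y)) e i j)))).
    + apply ev_all. intros e i j He. rewrite !D_2_diff.
      change (vrestr (fun x y => cross (Nc x y) (Q x y)) e i j) with (cross (n e i j) (vrestr Q e i j)).
      assert (E : D_2 fe e i j = cross (N e i j) (D_2 N e i j)).
      { unfold D_2, fe. change (dF n1 n2 e f0 i (S j)) with (vadd (dF n1 n2 e f0 i j) (cross (N e i j) (N e i (S j)))).
        vring. }
      rewrite E. unfold vdiff.
      vring.
    + apply VBd_sub; auto. apply VBd_add; [apply VBd_add|].
      now apply (VBd_cross _ _ 0 1). now apply (VBd_cross _ _ 0 1). now apply (VBd_cross _ _ 1 0).
Qed.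

Lemma surface_converges k : VBd true R0 1 k (vdiff fe (vrestr F)).
Proof.
  assert (B0 : VBd true R0 1 0 (vdiff fe (vrestr F))).
  { apply vbdd_VBd. destruct (surface_D 0) as [A B].
    destruct (VBd_vbdd _ _ _ _ _ A) as (a & Ha & HA). destruct (VBd_vbdd _ _ _ _ _ B) as (b & Hb & HBb).
    exists (R0 * a + R0 * b). split. nra.
    (* The error vanishes at the origin and is summed along the first axis, then upward, over total
       lengths at most [R0] each. *)
    intros r Hr. destruct (ev_and _ _ _ HA HBb r Hr) as (e1 & He1 & H). exists e1. split; auto.
    intros e He i j Hi Hj. rewrite pow_1.
    assert (le_mono : forall a b, (a <= b)%nat -> e * INR b <= r -> e * INR a <= r).
    { intros p q Hpq Hb'. apply le_INR in Hpq. nra. }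
    assert (r0 : e * INR 0 <= r) by (apply (le_mono 0%nat i); [lia|auto]).
    set (w := vdiff fe (vrestr F)) in *.
    assert (T1 : nrm (w e i 0%nat) <= INR i * (e * (a * e))).
    { apply (telescope (fun k => w e k 0%nat)).
      - unfold w, vdiff, vrestr, fe. simpl. rewrite Rmult_0_r, (gF0 HG). vring.
      - intros l Hl. rewrite D_1_inc, nrm_sc, Rabs_pos_eq by lra. apply Rmult_le_compat_l; [lra|].
        assert (Hl' : e * INR l <= r) by (apply (le_mono l i); auto; lia).
        destruct (H e He l 0%nat Hl' r0) as [X _]. rewrite pow_1 in X. exact X. }
    assert (T2 : nrm (vsub (w e i j) (w e i 0%nat)) <= INR j * (e * (b * e))).
    { apply (telescope (fun l => vsub (w e i l) (w e i 0%nat))).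
      - vring.
      - intros l Hl. replace (vsub (vsub (w e i (S l)) (w e i 0%nat)) (vsub (w e i l) (w e i 0%nat)))
          with (vsub (w e i (S l)) (w e i l)) by vring.
        rewrite D_2_inc, nrm_sc, Rabs_pos_eq by lra. apply Rmult_le_compat_l; [lra|].
        assert (Hl' : e * INR l <= r) by (apply (le_mono l j); auto; lia).
        destruct (H e He i l Hi Hl') as [_ X]. rewrite pow_1 in X. exact X. }
    replace (w e i j) with (vadd (vsub (w e i j) (w e i 0%nat)) (w e i 0%nat)) by vring.
    eapply Rle_trans; [apply nrm_add|].
    assert (INR i * (e * (a * e)) <= R0 * (a * e)).
    { replace (INR i * (e * (a * e))) with ((e * INR i) * (a * e)) by ring. apply Rmult_le_compat_r; [nra|lra]. }
    assert (INR j * (e * (b * e)) <= R0 * (b * e)).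
    { replace (INR j * (e * (b * e))) with ((e * INR j) * (b * e)) by ring. apply Rmult_le_compat_r; [nra|lra]. }
    lra. }
  induction k; auto. destruct (surface_D k). apply VBd_S. auto.
Qed.
End Converge.

(** * From lattice families to the difference quotients of the statement *)

Lemma Bd_iter1 R0 s a : forall k g, Bd true R0 s (a + k) g -> Bd true R0 s k (Nat.iter a dq1 g).
Proof.
  induction a; intros k g H. exact H.
  replace (S a + k)%nat with (a + S k)%nat in H by lia. apply IHa in H. apply H.
Qed.

Lemma Bd_iter2 R0 s a : forall k g, Bd true R0 s (a + k) g -> Bd true R0 s k (Nat.iter a dq2 g).
Proof.
  induction a; intros k g H. exact H.
  replace (S a + k)%nat with (a + S k)%nat in H by lia. apply IHa in H. now apply H.
Qed.

(** [delta] acts for a fixed [eps], whereas families carry [eps] as an argument; any coordinate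
    compatible with scaled differences translates one into the other. *)
Lemma delta_coord (c : V3 -> R) : (forall a v w, c (scal a (minus v w)) = a * (c v - c w)) ->
  forall (G : vfam) eps a1 a2 i j,
  c (delta eps a1 a2 (G eps) i j) = Nat.iter a1 dq1 (Nat.iter a2 dq2 (fun e i j => c (G e i j))) eps i j.
Proof.
  intros Hc G eps a1 a2. unfold delta.
  assert (K : forall i j, c (Nat.iter a2 (delta2 eps) (G eps) i j) = Nat.iter a2 dq2 (fun e i j => c (G e i j)) eps i j).
  { induction a2; intros i j. reflexivity. simpl. unfold delta2 at 1, dq2 at 1, tau2. now rewrite Hc, !IHa2. }
  induction a1; intros i j. apply K. simpl. unfold delta1 at 1, dq1 at 1, tau1. now rewrite Hc, !IHa1.
Qed.

Lemma norm_nrm (w : V3) : norm (w : R * R * R) <= nrm w.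
Proof.
  rewrite norm_V3. rewrite <- (sqrt_square (nrm w)) by apply nrm_pos. apply sqrt_le_1.
  unfold dot; nra. pose proof (nrm_pos w); nra. apply dot_self_nrm. lra.
Qed.

Lemma VBd_delta R0 r (G : vfam) a1 a2 : r < R0 -> VBd true R0 1 (a2 + a1) G ->
  exists c eps1, 0 < eps1 /\ forall eps, 0 < eps < eps1 -> forall i j, in_grid eps r (i + a1) (j + a2) ->
   norm (delta eps a1 a2 (G eps) i j : R * R * R) <= c * eps.
Proof.
  intros Hr (A & B & C).
  assert (K : forall g, Bd true R0 1 (a2 + a1) g -> bdd R0 1 (Nat.iter a1 dq1 (Nat.iter a2 dq2 g))).
  { intros g H. apply Bd_iter2 in H. replace a1 with (a1 + 0)%nat in H by lia. apply Bd_iter1 in H. apply H. }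
  destruct (K _ A) as [a HA], (K _ B) as [b HB], (K _ C) as [c HC].
  destruct (ev_and _ _ _ HA (ev_and _ _ _ HB HC) r Hr) as (e1 & He1 & H).
  exists (a + b + c), e1. split; auto. intros eps He i j [[_ Gi] [_ Gj]].
  rewrite plus_INR in Gi, Gj. pose proof (pos_INR a1). pose proof (pos_INR a2).
  destruct (H eps He i j ltac:(nra) ltac:(nra)) as (X & Y & Z).
  eapply Rle_trans; [apply norm_nrm|]. unfold nrm.
  rewrite (delta_coord c1), (delta_coord c2), (delta_coord c3) by reflexivity.
  rewrite pow_1 in X, Y, Z. lra.
Qed.

(** * Choice of the constants and the conclusion *)

Lemma smoothV_bounded h : smoothV h -> exists c, forall t, Rabs t <= 1 -> nrm (h t) <= c.
Proof.
  intros (A & B & C).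
  destruct (smooth1_bounded _ (-1) 1 ltac:(lra) A) as [a HA].
  destruct (smooth1_bounded _ (-1) 1 ltac:(lra) B) as [b HB].
  destruct (smooth1_bounded _ (-1) 1 ltac:(lra) C) as [c HC].
  exists (a + b + c). intros t Ht. apply Rabs_le_between in Ht.
  specialize (HA t Ht). specialize (HB t Ht). specialize (HC t Ht). unfold nrm. lra.
Qed.

Lemma pic_bound_exists n1 n2 : smoothV n1 -> smoothV n2 -> exists rho U, pic_bound n1 n2 rho U.
Proof.
  intros S1 S2.
  destruct (smoothV_bounded n1 S1) as [a Ha]. destruct (smoothV_bounded n2 S2) as [b Hb].
  destruct (smoothV_bounded _ (smoothV_dV _ S1)) as [c Hc]. destruct (smoothV_bounded _ (smoothV_dV _ S2)) as [d Hd].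
  set (U := 1 + Rabs a + Rabs b + Rabs c + Rabs d).
  pose proof (Rabs_pos a). pose proof (Rabs_pos b). pose proof (Rabs_pos c). pose proof (Rabs_pos d).
  pose proof (Rle_abs a). pose proof (Rle_abs b). pose proof (Rle_abs c). pose proof (Rle_abs d).
  assert (HU : 1 <= U) by (unfold U; lra).
  assert (HU3 : 1 <= U ^ 3) by (simpl; nra).
  assert (Hi : 0 < / (18 * U ^ 3)) by (apply Rinv_0_lt_compat; lra).
  assert (Hm : 18 * / (18 * U ^ 3) * U ^ 3 = 1) by (field; lra).
  (* This [rho] is at most 1/18, so the box lies where the data were bounded. *)
  exists (/ (18 * U ^ 3)), U. split; [auto|split; [auto|split; [lra|]]].
  intros t Ht. assert (Ht' : Rabs t <= 1) by nra.
  specialize (Ha t Ht'). specialize (Hb t Ht'). specialize (Hc t Ht'). specialize (Hd t Ht').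
  unfold U. lra.
Qed.

Theorem theorem3p16 (n1 n2 : R -> V3) (Hdata : initial_data_K n1 n2) :
  exists r : R, 0 < r /\
  forall f0 : V3,
  exists (f n : R -> R -> V3) (feps neps : R -> lattice_fun),
    (K_surface_with_data n1 n2 r f n /\ f 0 0 = f0 /\
     forall f' n' : R -> R -> V3,
       K_surface_with_data n1 n2 r f' n' -> f' 0 0 = f0 ->
       forall x y : R, in_square r x y -> f' x y = f x y /\ n' x y = n x y) /\
    (exists eps0 : R, 0 < eps0 /\
     forall eps : R, 0 < eps < eps0 ->
       canonical_discrete_K_surface n1 n2 eps r (feps eps) (neps eps) /\
       feps eps 0%nat 0%nat = f0 /\
       forall f' n' : lattice_fun,
         canonical_discrete_K_surface n1 n2 eps r f' n' ->
         f' 0%nat 0%nat = f0 ->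
         forall i j : nat, in_grid eps r i j ->
           f' i j = feps eps i j /\ n' i j = neps eps i j) /\
    converges_smooth_order_eps r feps f.
Proof.
  destruct Hdata as [D1 D2 Sp1 Sp2 H0].
  apply smooth_curve_V in D1. apply smooth_curve_V in D2.
  assert (Sp1' : forall t, dot (n1 t) (n1 t) = 1) by (intro; now apply on_sphere_dot).
  assert (Sp2' : forall t, dot (n2 t) (n2 t) = 1) by (intro; now apply on_sphere_dot).
  destruct (pic_bound_exists n1 n2 D1 D2) as (rho & U & HB).
  pose proof HB as (Hrho & HU & _).
  (* Half of [rho] keeps the closed square inside the open box; the other bound is the condition of
     [stab_conv] for [K = 9 U], and it implies the condition with 114 for uniqueness. *)
  set (R0 := Rmin (rho / 2) (/ (156 * ((9 * U) * (9 * U))))).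
  assert (HUU : 1 <= U * U) by nra.
  assert (Hi : 0 < / (156 * ((9 * U) * (9 * U)))) by (apply Rinv_0_lt_compat; nra).
  assert (HR0 : 0 < R0 < rho).
  { unfold R0. split. apply Rmin_pos; lra. eapply Rle_lt_trans; [apply Rmin_l|]. lra. }
  assert (HK : 156 * ((9 * U) * (9 * U)) * R0 <= 1).
  { apply Rle_trans with (156 * ((9 * U) * (9 * U)) * / (156 * ((9 * U) * (9 * U)))).
    apply Rmult_le_compat_l. nra. apply Rmin_r. right. field. lra. }
  (* Strictly below [R0], as [ev] demands, and chosen before [f0], on which no estimate depends. *)
  exists (R0 / 2). split. lra. intros f0.
  destruct (goursat_exists n1 n2 rho U f0 D1 D2 HB H0 Sp1' Sp2') as (N & P & Q & F & HG).
  exists F, N, (fun e => dF n1 n2 e f0), (fun e => dN n1 n2 e).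
  split; [|split].
  - split; [|split].
    + apply (goursat_K_surface n1 n2 rho U f0 N P Q F HG). lra.
    + apply (gF0 HG).
    + intros f' n' HK' Hf'. apply (goursat_unique n1 n2 rho U f0 N P Q F (R0 / 2) f' n' HG); auto. lra. nra.
  - destruct (small_e n1 n2 rho U HB) as (e0 & He0 & He). exists e0. split; auto.
    intros eps Heps. split; [|split].
    + apply (canonical_exists n1 n2 eps (proj1 Heps) (R0 / 2) R0 (3 * U)); auto. lra.
      * intros k Hk. now apply (data_dist2 n1 n2 rho U R0).
      * intros k Hk. now apply (data_dist2 n1 n2 rho U R0).
    + reflexivity.
    + intros f' n' HC Hf'. apply (canonical_unique n1 n2 eps (proj1 Heps) (R0 / 2)); auto.
  - intros a1 a2.
    apply (VBd_delta R0 (R0 / 2) (vdiff (fun e => dF n1 n2 e f0) (vrestr F))). lra.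
    now apply (surface_converges n1 n2 rho U R0 f0 N P Q F).
Qed.
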